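(* Let $(M,g)$ be an oriented Lorentzian $3$-manifold of class $C^r$ with $r\ge4$ (so $n=2$), let $U\subset\mathbb{R}^2$ be a domain, $o\in U$, $\hat o\in M$, and let $F:U\to M$ be an immersion with $F(o)=\hat o$ and $F\in\mathcal{X}^4_0(M,\hat o)$. Then, after replacing $U$ by a sufficiently small neighborhood of $o$, one of the following two cases occurs: (a) The point $o$ is a non-degenerate light-like point, and there exists a null regular curve $\sigma(t)$ in $M$ parametrizing $F(\Sigma_F)$ such that the acceleration vector $\sigma''(t)=D_{\sigma'(t)}\sigma'(t)$ is linearly independent of the velocity vector $\sigma'(t)$. Moreover, $F$ changes its causal type from space-like to time-like across the curve $\sigma$. (b) The point $o$ is a degenerate light-like point, and $F(\Sigma_F)$ contains a light-like geodesic segment of $M$ passing through $\hat o=F(o)$.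
   Context: The signature of $g$ is $(-,+,+)$. The underlying manifold is taken real analytic and $g$ of class $C^r$; $D$ is the Levi-Civita connection and $\Omega$ the Lorentzian volume form. Let $F:U\to M$ be a $C^k$-immersion ($k\ge2$) of a domain $U\subset\mathbb{R}^n$ ($n=2$) with coordinates $(u_1,\dots,u_n)$, and put $F_{u_i}=dF(\partial/\partial u_i)$. $S_F=(s_{i,j})$ with $s_{i,j}=g(F_{u_i},F_{u_j})$, and $B_F=\det S_F$. $F$ is space-like where $B_F>0$, time-like where $B_F<0$; $\Sigma_F=\{B_F=0\}$ is the set of light-like points. A light-like point $p$ is degenerate if $dB_F(p)=0$ and non-degenerate otherwise. The normal field $\tilde\nu$ along $F$ is defined by $g(\tilde\nu,w)=\Omega(F_{u_1},\dots,F_{u_n},w)$ for all $w$; it satisfies $g(\tilde\nu,\tilde\nu)=-B_F$. Let $\tilde h_{i,j}=g(D_{\partial/\partial u_i}F_{u_j},\tilde\nu)$, let $(\tilde s^{i,j})$ be the cofactor matrix of $S_F$, and $A_F=\sum_{i,j}\tilde s^{i,j}\tilde h_{i,j}$. $F\in\mathcal{X}^4_0(M,\hat o)$ means: $F$ is a $C^4$-immersion (germ at $o$), $F(o)=\hat o$, $o$ is a light-like point, and there is a $C^2$-function $\varphi$ near $o$ with $A_F=\varphi B_F$ identically near $o$. A regular curve $\sigma$ in $M$ is null if $g(\sigma'(t),\sigma'(t))=0$ for all $t$. A light-like geodesic segment passing through $\hat o$ is the image of a null geodesic with nonzero velocity, defined on an open interval containing $0$, taking the value $\hat o$ at $0$.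 *)

(* Defs.v *)
From HB Require Import structures.
From mathcomp Require Import all_boot all_order all_algebra.
From mathcomp Require Import all_classical all_reals all_analysis.

Set Implicit Arguments.
Unset Strict Implicit.
Unset Printing Implicit Defensive.

Import Order.TTheory GRing.Theory Num.Theory.
Import numFieldNormedType.Exports.

Local Open Scope classical_set_scope.
Local Open Scope ring_scope.

(** * Differentiability classes *)

Section Smoothness.
Context {R : realType} {V W : normedModType R}.

(* Meant for finite-dimensional V and W and for A open: f is C^(k+1) when it is
   differentiable and x |-> df_x(v) is C^k for each fixed v. *)
Fixpoint Ck (k : nat) (A : set V) (f : V -> W) : Prop :=
  match k with
  | 0 => forall x, A x -> {for x, continuous f}
  | k'.+1 => (forall x, A x -> differentiable f x) /\
             forall v : V, Ck k' A ('D_v f)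
  end.

(* The Taylor series is grouped by homogeneous degree: its term of degree k at
   the increment h is (D_h)^k f (p) / k!. *)
Definition real_analytic (A : set V) (f : V -> W) : Prop :=
  (forall k, Ck k A f) /\
  forall p, A p -> \forall h \near (0 : V),
    series (fun k => (k`!%:R : R)^-1 *:
                     iter k (fun g : V -> W => 'D_h g) f p) @ \oo --> f (p + h).

End Smoothness.

Inductive smoothness := Cfinite of nat | Cinfinity | Comega.

Definition at_least (k : nat) (r : smoothness) : bool :=
  if r is Cfinite n then (k <= n)%N else true.

Definition of_class {R : realType} {V W : normedModType R} (r : smoothness)
    (A : set V) (f : V -> W) : Prop :=
  match r with
  | Cfinite k => Ck k A f
  | Cinfinity => forall k, Ck k A f
  | Comega => real_analytic A f
  end.

(** * Oriented Lorentzian 3-manifolds *)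

Section Manifold.
Variable R : realType.

(* The atlas is an oriented one.  [chart_at p] is a chosen chart around p, used
   to represent the tangent space at p by row vectors. *)
Record oriented_manifold3 := OrientedManifold3 {
  carrier :> topologicalType;
  chart : Type;
  dom : chart -> set carrier;
  coord : chart -> carrier -> 'rV[R]_3;
  param : chart -> 'rV[R]_3 -> carrier;
  chart_at : carrier -> chart;
  carrier_hausdorff : hausdorff_space carrier;
  carrier_second_countable : @second_countable carrier;
  dom_open : forall c, open (dom c);
  coord_open : forall c, open (coord c @` dom c);
  coordK : forall c p, dom c p -> param c (coord c p) = p;
  coord_continuous : forall c p, dom c p -> {for p, continuous (coord c)};
  param_continuous : forall c x, (coord c @` dom c) x ->
    {for x, continuous (param c)};
  dom_chart_at : forall p, dom (chart_at p) p;
  transition_analytic : forall c c',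
    real_analytic (coord c @` (dom c `&` dom c')) (coord c' \o param c);
  transition_oriented : forall c c' x, (coord c @` (dom c `&` dom c')) x ->
    0 < \det ('J (coord c' \o param c) x)
}.

(* gram c x is the Gram matrix of g in the chart c at the point of coordinates
   x.  Since 'J acts on row vectors on the right (v *m 'J f x = df_x(v)), g
   transforms with the transpose of the Jacobian on the right. *)
Record lorentz_metric (M : oriented_manifold3) (r : smoothness) :=
  LorentzMetric {
  gram : chart M -> 'rV[R]_3 -> 'M[R]_3;
  gram_class : forall c, of_class r (coord c @` dom c) (gram c);
  gram_sym : forall c x, (coord c @` dom c) x -> (gram c x)^T = gram c x;
  gram_signature : forall c x, (coord c @` dom c) x ->
    exists2 P : 'M[R]_3, P \in unitmx &
      P *m gram c x *m P^T =
      diag_mx (\row_(i < 3) if i == ord0 then -1 else 1);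
  gram_transition : forall c c' x, (coord c @` (dom c `&` dom c')) x ->
    let tau := coord c' \o param c in
    gram c x = 'J tau x *m gram c' (tau x) *m ('J tau x)^T
}.

End Manifold.

Notation basis_vec i := (delta_mx 0 i).

Section LocalGeometry.
Context {R : realType} {M : oriented_manifold3 R} {r : smoothness}.
Variable g : lorentz_metric M r.

(* In the following definitions, c is a chart and x the coordinates in c of the
   base point of the tangent vectors v, w. *)

Definition metric (c : chart M) (x v w : 'rV[R]_3) : R :=
  (v *m gram g c x *m w^T) 0 0.

Definition volume (c : chart M) (x v1 v2 v3 : 'rV[R]_3) : R :=
  Num.sqrt `|\det (gram g c x)| *
  \det (\matrix_(i < 3) nth 0 [:: v1; v2; v3] i).

(* The Christoffel symbol Gamma^k_ij of the Levi-Civita connection. *)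
Definition christoffel (c : chart M) (x : 'rV[R]_3) (k i j : 'I_3) : R :=
  2^-1 * \sum_(l < 3) invmx (gram g c x) k l *
    (('D_(basis_vec i) (gram g c) x) j l + ('D_(basis_vec j) (gram g c) x) i l
     - ('D_(basis_vec l) (gram g c) x) i j).

Definition gamma (c : chart M) (x v w : 'rV[R]_3) : 'rV[R]_3 :=
  \row_k \sum_(i < 3) \sum_(j < 3) christoffel c x k i j * v 0 i * w 0 j.

End LocalGeometry.

(* C^k maps into M defined on an open subset A of a normed space. *)
Definition Ck_map {R : realType} {V : normedModType R}
    {M : oriented_manifold3 R} (k : nat) (A : set V) (f : V -> M) : Prop :=
  (forall x, A x -> {for x, continuous f}) /\
  forall c : chart M, Ck k (A `&` f @^-1` dom c) (coord c \o f).

(** * Immersed surfaces *)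

(* Tangent vectors at F u are expressed in the chart [chart_at (F u)]. *)
Section Surface.
Context {R : realType} {M : oriented_manifold3 R} {r : smoothness}.
Variable g : lorentz_metric M r.
Variable F : 'rV[R]_2 -> M.

Definition base_chart (u : 'rV[R]_2) : chart M := chart_at (F u).

Definition base_point (u : 'rV[R]_2) : 'rV[R]_3 :=
  coord (base_chart u) (F u).

Definition F_ (i : 'I_2) (u : 'rV[R]_2) : 'rV[R]_3 :=
  'D_(basis_vec i) (coord (base_chart u) \o F) u.

Definition immersion (k : nat) (A : set 'rV[R]_2) : Prop :=
  Ck_map k A F /\ forall u, A u -> row_free (\matrix_(i < 2) F_ i u).

Definition S_F (u : 'rV[R]_2) : 'M[R]_2 :=
  \matrix_(i, j) metric g (base_chart u) (base_point u) (F_ i u) (F_ j u).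

Definition B_F (u : 'rV[R]_2) : R := \det (S_F u).

Definition spacelike (u : 'rV[R]_2) : Prop := 0 < B_F u.
Definition timelike (u : 'rV[R]_2) : Prop := B_F u < 0.
Definition lightlike (u : 'rV[R]_2) : Prop := B_F u = 0.

Definition degenerate_lightlike (u : 'rV[R]_2) : Prop :=
  lightlike u /\ forall v, 'd B_F u v = 0.

Definition nondegenerate_lightlike (u : 'rV[R]_2) : Prop :=
  lightlike u /\ exists v, 'd B_F u v != 0.

(* D_{d/du_i} F_{u_j} *)
Definition DF_ (i j : 'I_2) (u : 'rV[R]_2) : 'rV[R]_3 :=
  'D_(basis_vec i) ('D_(basis_vec j) (coord (base_chart u) \o F)) u
  + gamma g (base_chart u) (base_point u) (F_ i u) (F_ j u).

(* Such a vector exists and is unique because g is nondegenerate. *)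
Definition nu_tilde (u : 'rV[R]_2) : 'rV[R]_3 :=
  xget 0 [set n | forall w, metric g (base_chart u) (base_point u) n w =
    volume g (base_chart u) (base_point u) (F_ 0 u) (F_ 1 u) w].

Definition h_tilde (i j : 'I_2) (u : 'rV[R]_2) : R :=
  metric g (base_chart u) (base_point u) (DF_ i j u) (nu_tilde u).

Definition A_F (u : 'rV[R]_2) : R :=
  \sum_(i < 2) \sum_(j < 2) cofactor (S_F u) i j * h_tilde i j u.

Definition X4_0 (o : 'rV[R]_2) (ohat : M) : Prop :=
  exists W : set 'rV[R]_2,
    [/\ open W, W o, immersion 4 W, F o = ohat & lightlike o] /\
    exists phi : 'rV[R]_2 -> R^o,
      Ck 2 W phi /\ forall u, W u -> A_F u = phi u * B_F u.

(* Inside V, the light-like set separates a (connected) space-like side from a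
   (connected) time-like side, and each of its points is adjacent to both. *)
Definition changes_causal_type (V : set 'rV[R]_2) : Prop :=
  [/\ connected (V `&` spacelike), connected (V `&` timelike) &
      V `&` lightlike `<=`
        closure (V `&` spacelike) `&` closure (V `&` timelike)].

End Surface.

(** * Curves *)

Section Curve.
Context {R : realType} {M : oriented_manifold3 R} {r : smoothness}.
Variable g : lorentz_metric M r.
Variable sigma : R -> M.

Definition local_curve (t : R) : R -> 'rV[R]_3 :=
  coord (chart_at (sigma t)) \o sigma.

Definition velocity (t : R) : 'rV[R]_3 := derive1 (local_curve t) t.

(* D_{sigma'(t)} sigma'(t) *)
Definition acceleration (t : R) : 'rV[R]_3 :=
  derive1 (derive1 (local_curve t)) t
  + gamma g (chart_at (sigma t)) (local_curve t t) (velocity t) (velocity t).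

Definition open_interval (J : set R) : Prop :=
  [/\ open J, is_interval J & J !=set0].

Definition regular_curve (J : set R) : Prop :=
  Ck_map (V := R^o) 2 J sigma /\ forall t, J t -> velocity t != 0.

Definition null_curve (J : set R) : Prop := forall t, J t ->
  metric g (chart_at (sigma t)) (local_curve t t) (velocity t) (velocity t) = 0.

Definition geodesic (J : set R) : Prop :=
  Ck_map (V := R^o) 2 J sigma /\ forall t, J t -> acceleration t = 0.

End Curve.

Definition lightlike_geodesic_segment {R : realType}
    {M : oriented_manifold3 R} {r : smoothness} (g : lorentz_metric M r)
    (p : M) (S : set M) : Prop :=
  exists (J : set R) (gamma : R -> M),
    [/\ open_interval J, J 0 & gamma 0 = p] /\
    [/\ geodesic g gamma J, null_curve g gamma J,
        (forall t, J t -> velocity gamma t != 0) & S = gamma @` J].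

(* Main.v *)
Require Import Defs.
From HB Require Import structures.
From mathcomp Require Import all_boot all_order all_algebra.
From mathcomp Require Import all_classical all_reals all_analysis.
From mathcomp Require Import ring lra.
Import Defs.

Import Order.TTheory GRing.Theory Num.Theory.
Import numFieldNormedType.Exports.

Local Open Scope classical_set_scope.
Local Open Scope ring_scope.

Set Implicit Arguments.
Unset Strict Implicit.
Unset Printing Implicit Defensive.

(** Let S = (s_kl) be the first fundamental form and B = det S. At a light-like
point S is singular but not zero, because a nondegenerate form on a
3-dimensional space has no totally isotropic plane; so s_jj <> 0 for one
coordinate j, and i denotes the other one. Near the point put X = d_i + slope
d_j with slope = - s_ij / s_jj. Then g(dF(X), F_j) = 0 and s_jj g(dF(X),
dF(X)) = B, so X spans the kernel of S exactly where B = 0.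

The heart of the proof is [key_inequality]: |XB| <= K |B| near o. Let Z be the
sum of the cofactors of S times the second covariant derivatives of F.
Jacobi's formula for the derivative of a determinant, with the symmetry of D
dF, gives XB = 2 g(Z, dF(X)) up to a multiple of B. On the other hand A_F is,
up to sign, the volume of (F_0, F_1, Z), and a Gram determinant identity
expresses the product of g(Z, dF(X)) and g(dF(X), w), w being a fixed vector
with g(dF(X), w) <> 0 at o, by that volume up to a multiple of B
([gram_identity], [omega_trace]). Since A_F is a multiple of B, so is XB, with
a bounded factor.

By Gronwall's lemma, B vanishes on the integral curve of X through o
([null_curve_ode]), hence its image by F is a null curve sigma.
Differentiating the inequality at the zeros of B, one sees that d_j B
satisfies a linear differential inequality along the curve: it vanishes
identically if it vanishes at o. The velocity of sigma is orthogonal to dF,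
and for a parameter of velocity p X one finds 2 s_jj g(sigma'', F_k) = - p^2
d_k B ([acceleration_frame]). As XB = 0 on the curve, dB = 0 means d_j B = 0.

If d_j B(o) = 0, then the acceleration is orthogonal to dF along the whole
curve, that is, proportional to the velocity, and the factor p can be chosen,
by solving a differential equation jointly with the curve, so that the
acceleration vanishes: sigma is a light-like geodesic ([degenerate_case]). If
d_j B(o) <> 0, then the acceleration is not orthogonal to F_j while the
velocity is, so they are independent; and B is strictly monotone in the
direction j, so that the light-like set is the graph drawn by the curve, with
B > 0 on one of its sides and B < 0 on the other ([nondegenerate_case]). *)

(** * Calculus of maps of class C^k *)

Section Ck_calculus.
Context {R : realType}.
Implicit Types V W : normedModType R.

Lemma near_open {T : topologicalType} (A : set T) (x : T) (P : T -> Prop) :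
  open A -> A x -> (forall y, A y -> P y) -> \forall y \near x, P y.
Proof.
move=> oA Ax AP; have : nbhs x A by exact: open_nbhs_nbhs.
by apply: filterS => y; exact: AP.
Qed.

Lemma near_eq_continuous {T U : topologicalType} (f g : T -> U) (a : T) :
  (\near a, f a = g a) -> {for a, continuous f} -> {for a, continuous g}.
Proof.
move=> fg cf; rewrite /prop_for /continuous_at -(nbhs_singleton fg).
exact: cvg_trans (near_eq_cvg fg) cf.
Qed.

Lemma near_eq_diff {V W} (f g : V -> W) (a : V) :
  (\near a, f a = g a) -> differentiable f a -> differentiable g a.
Proof.
move=> fg df; have fga : f a = g a by exact: (nbhs_singleton fg).
(* near a the difference g - f is zero, so its differential is zero *)
have dd : (g - f) \o shift a = cst ((g - f) a) + (\0 : V -> W) +o_ 0 id.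
  apply/eqaddoP => _/posnumP[e]; rewrite nearE /= -/(nbhs _ _).
  have : \forall h \near (0 : V), f (h + a) = g (h + a).
    by have := fg; rewrite (near_shift 0 a) subr0.
  apply: filterS => h fgh; rewrite !fctE /= fgh fga !subrr addr0 subr0 normr0.
  by rewrite mulr_ge0.
have gf : differentiable (g - f) a.
  apply/diff_locallyP; rewrite (diff_unique _ dd); last exact: cst_continuous.
  by split => //; exact: cst_continuous.
have -> : g = f + (g - f) by apply/funext => x; rewrite !fctE addrC subrK.
exact: differentiableD.
Qed.

(** Differentiation is local, so it is enough that the functions agree on an
    open set. *)
Lemma Ck_ext {V W} k (A : set V) (f g : V -> W) :
  open A -> (forall x, A x -> f x = g x) -> Ck k A f -> Ck k A g.
Proof.
move=> oA; elim: k f g => [|k IH] f g fg /=.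
  move=> cf x Ax; apply: near_eq_continuous (cf x Ax).
  exact: near_open oA Ax fg.
move=> [df Df]; split=> [x Ax|v].
  by apply: near_eq_diff (df x Ax); exact: near_open oA Ax fg.
apply: IH (Df v) => x Ax; apply: near_eq_derive.
exact: near_open oA Ax fg.
Qed.

Lemma Ck_restrict {V W} k (A A' : set V) (f : V -> W) :
  A' `<=` A -> Ck k A f -> Ck k A' f.
Proof.
move=> AA; elim: k f => [|k IH] f /=; first by move=> cf x /AA; exact: cf.
by move=> [df Df]; split=> [x /AA/df //|v]; exact: IH.
Qed.

Lemma CkS {V W} k (A : set V) (f : V -> W) : Ck k.+1 A f -> Ck k A f.
Proof.
elim: k f => [|k IH] f /=.
  by move=> [df _] x /df; exact: differentiable_continuous.
by move=> [df Df]; split => // v; exact: IH.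
Qed.

Lemma Ck_le {V W} k l (A : set V) (f : V -> W) :
  (l <= k)%N -> Ck k A f -> Ck l A f.
Proof. by move=> /subnK <-; elim: (k - l)%N => // n IH /CkS. Qed.

Lemma Ck_continuous {V W} k (A : set V) (f : V -> W) x :
  Ck k A f -> A x -> {for x, continuous f}.
Proof. by move=> /(Ck_le (leq0n k)); exact. Qed.

Lemma Ck_differentiable {V W} k (A : set V) (f : V -> W) x :
  Ck k.+1 A f -> A x -> differentiable f x.
Proof. by move=> [df _]; exact: df. Qed.

Lemma Ck_derive {V W} k (A : set V) (f : V -> W) v :
  Ck k.+1 A f -> Ck k A ('D_v f).
Proof. by move=> [_]; exact. Qed.

Lemma Ck_cst {V W} k (A : set V) (w : W) : Ck k A (cst w : V -> W).
Proof.
elim: k w => [|k IH] w /=; first by move=> x _; exact: cst_continuous.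
split=> [x _|v]; first exact: differentiable_cst.
by rewrite (_ : 'D_v (cst w) = cst 0)//; apply/funext => x; exact: derive_cst.
Qed.

Lemma Ck_add {V W} k (A : set V) (f g : V -> W) : open A ->
  Ck k A f -> Ck k A g -> Ck k A (fun x => f x + g x).
Proof.
move=> oA; elim: k f g => [|k IH] f g /=.
  by move=> cf cg x Ax; apply: cvgD; [exact: cf|exact: cg].
move=> [df Df] [dg Dg]; split=> [x Ax|v].
  by apply: differentiableD; [exact: df|exact: dg].
apply: Ck_ext (IH _ _ (Df v) (Dg v)) => // x Ax.
by rewrite -deriveD//; apply: diff_derivable; [exact: df|exact: dg].
Qed.

Lemma Ck_mul {V} k (A : set V) (f g : V -> R^o) : open A ->
  Ck k A f -> Ck k A g -> Ck k A (fun x => f x * g x : R^o).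
Proof.
move=> oA; elim: k f g => [|k IH] f g /=.
  by move=> cf cg x Ax; apply: cvgM; [exact: cf|exact: cg].
move=> Cf Cg; have [df Df] := Cf; have [dg Dg] := Cg; split=> [x Ax|v].
  by apply: differentiableM; [exact: df|exact: dg].
have h : Ck k A (fun x => f x * 'D_v g x + g x * 'D_v f x : R^o).
  by apply: Ck_add => //; apply: IH => //; exact: CkS.
apply: Ck_ext h => // x Ax; rewrite [RHS](@deriveM _ _ f g)//; apply: diff_derivable.
  exact: df.
exact: dg.
Qed.

Lemma Ck_scalel {V W} k (A : set V) (f : V -> R^o) (w : W) : open A ->
  Ck k A f -> Ck k A (fun x => f x *: w).
Proof.
move=> oA; elim: k f => [|k IH] f /=.
  by move=> cf x Ax; apply: cvgZr_tmp; exact: cf.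
move=> [df Df]; split=> [x Ax|v]; first by apply: differentiableZl; exact: df.
apply: Ck_ext (IH _ (Df v)) => // x Ax.
have dfx : differentiable (f : V -> R) x by exact: df.
by rewrite !deriveE ?diffZl//; exact: differentiableZl.
Qed.

Lemma Ck_sum {V W} k (A : set V) (I : Type) (r : seq I) (P : pred I)
    (f : I -> V -> W) : open A ->
  (forall i, Ck k A (f i)) -> Ck k A (fun x => \sum_(i <- r | P i) f i x).
Proof.
move=> oA Cf; elim: r => [|i r IH].
  by apply: (Ck_ext _ _ (@Ck_cst _ _ k A 0)) => // x _; rewrite big_nil.
have [Pi|nPi] := boolP (P i).
  apply: (Ck_ext _ _ (Ck_add oA (Cf i) IH)) => // x _.
  by rewrite big_cons Pi.
by apply: (Ck_ext _ _ IH) => // x _; rewrite big_cons (negbTE nPi).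
Qed.

Lemma Ck_opp {V} k (A : set V) (f : V -> R^o) : open A ->
  Ck k A f -> Ck k A (fun x => - f x : R^o).
Proof.
move=> oA Cf; have := Ck_mul oA (@Ck_cst _ _ k A (-1 : R^o)) Cf.
by apply: Ck_ext => // x _; rewrite /cst mulN1r.
Qed.

Lemma Ck_sub {V} k (A : set V) (f g : V -> R^o) : open A ->
  Ck k A f -> Ck k A g -> Ck k A (fun x => f x - g x : R^o).
Proof. by move=> oA Cf /(Ck_opp oA); exact: Ck_add. Qed.

Lemma Ck_inv {V} k (A : set V) (f : V -> R^o) : open A ->
  (forall x, A x -> f x != 0) ->
  Ck k A f -> Ck k A (fun x => (f x)^-1 : R^o).
Proof.
move=> oA f0; elim: k f f0 => [|k IH] f f0 /=.
  by move=> cf x Ax; apply: cvgV; [exact: f0|exact: cf].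
move=> Cf; have [df Df] := Cf; split=> [x Ax|v].
  by apply: differentiableV; [exact: df|exact: f0].
have Ci := IH _ f0 (CkS Cf).
apply: Ck_ext (Ck_opp oA (Ck_mul oA (Ck_mul oA Ci Ci) (Df v))) => // x Ax.
rewrite [RHS](@deriveV _ _ f) ?f0//; last exact/diff_derivable/df.
by rewrite -[RHS]/(_ * _) expr2 invfM mulNr.
Qed.

Lemma differentiable_mxP {V} {m n} (f : V -> 'M[R]_(m, n)) x :
  differentiable f x <-> forall i j, differentiable (fun y => f y i j : R^o) x.
Proof.
split=> [df i j|df].
  by apply: (@differentiable_comp _ _ _ _ f (fun N : 'M[R]_(m, n) => N i j : R^o));
    [|exact: differentiable_coord].
have -> : f = \sum_i \sum_j (fun y => f y i j *: delta_mx i j).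
  apply/funext => y; rewrite [LHS]matrix_sum_delta fct_sumE.
  by apply: eq_bigr => i _; rewrite fct_sumE.
apply: differentiable_sum => i; apply: differentiable_sum => j.
exact: differentiableZl.
Qed.

Lemma derive_coord {V} {m n} (f : V -> 'M[R]_(m, n)) v x i j :
  differentiable f x -> 'D_v f x i j = 'D_v (fun y => f y i j : R^o) x.
Proof. by move=> df; rewrite derive_mx ?mxE//; exact: diff_derivable. Qed.

Lemma Ck_mxP {V} {m n} k (A : set V) (f : V -> 'M[R]_(m, n)) : open A ->
  Ck k A f <-> forall i j, Ck k A (fun y => f y i j : R^o).
Proof.
move=> oA; split=> [Cf i j|Cf].
  elim: k f Cf => [|k IH] f /=.
    move=> cf x Ax; apply: (@continuous_comp _ _ _ f (fun N : 'M[R]_(m, n) => N i j)).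
      exact: cf.
    exact: matrix_normedtype.coord_continuous.
  move=> [df Df]; split=> [x Ax|v].
    by have /differentiable_mxP := df x Ax; exact.
  apply: Ck_ext (IH _ (Df v)) => // x Ax.
  by rewrite derive_coord//; exact: df.
apply: (@Ck_ext _ _ k A (fun y => \sum_i \sum_j f y i j *: delta_mx i j)) => //.
  by move=> x _; rewrite -matrix_sum_delta.
by apply: Ck_sum => // i; apply: Ck_sum => // j; apply: Ck_scalel.
Qed.

Lemma derive_chain {V W} {n} (g : V -> 'rV[R]_n) (f : 'rV[R]_n -> W) v x :
  differentiable g x -> differentiable f (g x) ->
  'D_v (f \o g) x = \sum_m 'D_v g x 0 m *: 'D_(delta_mx 0 m) f (g x).
Proof.
move=> dg df; rewrite deriveE; last exact: differentiable_comp.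
rewrite diff_comp //= -(deriveE v dg).
rewrite {1}(row_sum_delta ('D_v g x)) linear_sum.
by apply: eq_bigr => m _; rewrite linearZ (deriveE _ df).
Qed.

Lemma derive_dir {W} {n} (f : 'rV[R]_n -> W) v x :
  differentiable f x ->
  'D_v f x = \sum_m v 0 m *: 'D_(delta_mx 0 m) f x.
Proof.
move=> df; rewrite deriveE// {1}(row_sum_delta v) linear_sum.
by apply: eq_bigr => m _; rewrite linearZ (deriveE _ df).
Qed.

(** By the chain rule the derivatives of the composite are sums of products of
    functions of one class less. *)
Lemma Ck_comp {V} {n} k (A : set V) (B : set 'rV[R]_n)
    (g : V -> 'rV[R]_n) (f : 'rV[R]_n -> R^o) :
  open A -> (forall x, A x -> B (g x)) ->
  Ck k A g -> Ck k B f -> Ck k A (f \o g).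
Proof.
move=> oA AB; elim: k f => [|k IH] f.
  move=> Cg Cf x Ax; apply: continuous_comp; first exact: Cg.
  exact/Cf/AB.
move=> Cg Cf; split=> [x Ax|v].
  apply: differentiable_comp; first exact: (Ck_differentiable Cg).
  exact/(Ck_differentiable Cf)/AB.
apply: (@Ck_ext _ _ k A (fun x => \sum_m 'D_v g x 0 m * 'D_(delta_mx 0 m) f (g x) : R^o)) => //.
  move=> x Ax; rewrite derive_chain//; first exact: (Ck_differentiable Cg).
  exact/(Ck_differentiable Cf)/AB.
apply: Ck_sum => // m; apply: Ck_mul => //.
  by have /(Ck_mxP _ _ oA) := Ck_derive v Cg; exact.
exact: (IH _ (CkS Cg) (Ck_derive _ Cf)).
Qed.

Lemma Ck_comp_mx {V} {n p q} k (A : set V) (B : set 'rV[R]_n)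
    (g : V -> 'rV[R]_n) (f : 'rV[R]_n -> 'M[R]_(p, q)) :
  open A -> open B -> (forall x, A x -> B (g x)) ->
  Ck k A g -> Ck k B f -> Ck k A (f \o g).
Proof.
move=> oA oB AB Cg /(Ck_mxP _ _ oB) Cf; apply/(Ck_mxP _ _ oA) => i j.
exact: Ck_comp AB Cg (Cf i j).
Qed.

End Ck_calculus.

(** * Mean value bounds and symmetry of second derivatives *)

Section MeanValue.
Context {R : realType}.

Lemma rV_coord_le {n} (v : 'rV[R]_n) j : `|v 0 j| <= `|v|.
Proof. by rewrite [leRHS]/Num.Def.normr/= mx_normrE; exact: (le_bigmax _ _ (0, j)). Qed.

Lemma rV_norm_le {n} (v : 'rV[R]_n) c :
  0 <= c -> (forall j, `|v 0 j| <= c) -> `|v| <= c.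
Proof.
move=> c0 vc; rewrite [leLHS]/Num.Def.normr/= mx_normrE.
by apply: bigmax_le => // -[i j] _; rewrite (ord1 i); exact: vc.
Qed.

Lemma within_continuous (f : R -> R) (a b : R) :
  (forall x, a <= x <= b -> {for x, continuous f}) ->
  {within `[a, b], continuous f}.
Proof.
move=> cf; apply: continuous_in_subspaceT => x; rewrite inE/= in_itv/=.
exact: cf.
Qed.

Lemma derivable_cont (f : R -> R) (x : R) :
  derivable f x 1 -> {for x, continuous f}.
Proof. by move=> /derivable1_diffP/differentiable_continuous. Qed.

Lemma mvt_exists (g dg : R -> R) (s t : R) : s < t ->
  (forall x, s <= x <= t -> is_derive x 1 g (dg x)) ->
  exists2 c, s < c < t & g t - g s = dg c * (t - s).
Proof.
move=> st dgP.
have cg : {within `[s, t], continuous g}.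
  apply: within_continuous => x xst; apply: derivable_cont.
  by have [] := dgP x xst.
have dg' x : x \in `]s, t[%R -> is_derive x 1 g (dg x).
  by rewrite in_itv/= => /andP[sx xt]; apply: dgP; rewrite !ltW.
by have [c] := MVT st dg' cg; rewrite in_itv/= => cst ->; exists c.
Qed.

Lemma mvt_bound (g dg : R -> R) (c s t : R) :
  (forall x, Num.min s t <= x <= Num.max s t -> is_derive x 1 g (dg x)) ->
  (forall x, Num.min s t <= x <= Num.max s t -> `|dg x| <= c) ->
  `|g t - g s| <= c * `|t - s|.
Proof.
wlog st : s t / s <= t => [H dgP dgc|].
  have [st|/ltW ts] := leP s t; first exact: H.
  by rewrite distrC [X in _ <= _ * X]distrC; apply: H => //;
    rewrite minC maxC.
rewrite (min_l st) (max_r st) => dgP dgc.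
move: st; rewrite le_eqVlt => /predU1P[->|st]; first by rewrite !subrr normr0 mulr0.
have [x /andP[sx xt] ->] := mvt_exists st dgP.
by rewrite normrM ler_wpM2r// dgc// !ltW.
Qed.

Lemma mvt_bound_rV {n} (g dg : R -> 'rV[R]_n) (c s t : R) :
  (forall x, Num.min s t <= x <= Num.max s t -> is_derive x 1 g (dg x)) ->
  (forall x, Num.min s t <= x <= Num.max s t -> `|dg x| <= c) ->
  `|g t - g s| <= c * `|t - s|.
Proof.
move=> dgP dgc; have c0 : 0 <= c.
  apply: le_trans (dgc s _); first exact: normr_ge0.
  by rewrite ge_min lexx/= le_max lexx.
apply: rV_norm_le => [|j]; first by rewrite mulr_ge0.
rewrite !mxE; apply: (@mvt_bound (fun x => g x 0 j) (fun x => dg x 0 j)) => x xst.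
  have [gx gdx] := dgP x xst; split; first by move/derivable_mxP : gx; exact.
  by rewrite -gdx derive_mx// mxE.
exact: le_trans (rV_coord_le _ _) (dgc x xst).
Qed.

Lemma is_derive_line {V W : normedModType R} (f : V -> W) (p a : V) (s : R) :
  differentiable f (p + s *: a) ->
  is_derive s 1 (fun x : R => f (p + x *: a)) ('D_a f (p + s *: a)).
Proof.
move=> df.
have E : (fun h : R => h^-1 *: (f (p + (h *: (1 : R^o) + s) *: a) - f (p + s *: a)))
       = (fun h : R => h^-1 *: (f (h *: a + (p + s *: a)) - f (p + s *: a))).
  apply/funext => h; congr (_ *: (f _ - _)).
  by rewrite -[h *: 1]/(h * 1) mulr1 scalerDl addrCA.
have := @diff_derivable _ _ _ f (p + s *: a) a df.
by split; rewrite /derivable /derive /= E.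
Qed.

Lemma nbhs_parallelogram {V : normedModType R} (p a b : V) (P : V -> Prop) :
  (\forall x \near p, P x) -> exists2 h : R, 0 < h &
    forall s t : R, 0 <= s <= h -> 0 <= t <= h -> P (p + s *: a + t *: b).
Proof.
move=> /nbhs_normP[e /= e0 eP].
have d0 : 0 < 1 + `|a| + `|b| by rewrite -addrA ltr_pwDl// addr_ge0.
exists (e / (1 + `|a| + `|b|)); first by rewrite divr_gt0.
move=> s t /andP[s0 sh] /andP[t0 th]; apply: eP => /=.
rewrite -addrA opprD addrA subrr sub0r normrN.
rewrite (le_lt_trans (ler_normD _ _))// !normrZ (ger0_norm s0) (ger0_norm t0).
apply: (@le_lt_trans _ _ (e / (1 + `|a| + `|b|) * (`|a| + `|b|))).
  by rewrite mulrDr lerD// ler_wpM2r.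
rewrite mulrAC ltr_pdivrMr// ltr_pM2l//.
by rewrite -addrA ltrDr.
Qed.

(** The second difference of f over a small parallelogram is, by two
    applications of the mean value theorem in either order, a nearby value of
    either mixed derivative; both are continuous. *)
Lemma derive_sym_real {V : normedModType R} (A : set V) (f : V -> R^o) a b p :
  open A -> A p -> Ck 2 A f -> 'D_a ('D_b f) p = 'D_b ('D_a f) p.
Proof.
move=> oA Ap C2f.
(* the mixed second difference of f, written as a value of D_b (D_a f) *)
have key a' b' h : 0 < h ->
    (forall s t, 0 <= s <= h -> 0 <= t <= h -> A (p + s *: a' + t *: b')) ->
    exists s t, [/\ 0 <= s <= h, 0 <= t <= h &
      f (p + h *: a' + h *: b') - f (p + h *: a') - (f (p + h *: b') - f p) =
      'D_b' ('D_a' f) (p + s *: a' + t *: b') * h * h].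
  move=> h0 Ah.
  have h00 : (0 : R) <= 0 <= h by rewrite lexx ltW.
  have h0h : (0 : R) <= h <= h by rewrite lexx ltW.
  pose g s := f (p + s *: a' + h *: b') - f (p + s *: a').
  have dg (s : R) : 0 <= s <= h -> is_derive s 1 g
      ('D_a' f (p + s *: a' + h *: b') - 'D_a' f (p + s *: a')).
    move=> sh; apply: is_deriveB.
      have /(@is_derive_line _ _ f (p + h *: b') a') : differentiable f (p + h *: b' + s *: a').
        by rewrite addrAC; apply: (Ck_differentiable C2f); exact: Ah.
      rewrite addrAC; congr (is_derive _ _ _ _).
      by apply/funext => x; rewrite addrAC.
    apply: is_derive_line; apply: (Ck_differentiable C2f).
    by have := Ah s 0 sh h00; rewrite scale0r addr0.
  have [s /andP[s0 sh] gE] := mvt_exists h0 dg.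
  have dk (t : R) : 0 <= t <= h -> is_derive t 1
      (fun t => 'D_a' f (p + s *: a' + t *: b'))
      ('D_b' ('D_a' f) (p + s *: a' + t *: b')).
    move=> th; apply: is_derive_line; apply: (Ck_differentiable (Ck_derive a' C2f)).
    by apply: Ah => //; rewrite !ltW.
  have [t /andP[t0 th]] := mvt_exists h0 dk.
  rewrite scale0r addr0 subr0 => kE.
  exists s, t; split; [by rewrite !ltW|by rewrite !ltW|].
  by move: gE; rewrite /g scale0r !addr0 subr0 kE => ->.
apply/eqP; rewrite -subr_eq0 -normr_le0; apply/ler_addgt0Pr => e e0; rewrite add0r.
have e20 : 0 < e / 2 by rewrite divr_gt0.
have c1 : {for p, continuous ('D_a ('D_b f))} by exact: (C2f.2 b).2.
have c2 : {for p, continuous ('D_b ('D_a f))} by exact: (C2f.2 a).2.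
have /(nbhs_parallelogram a b)[h h0 hP] : \forall x \near p, [/\ A x,
    `|'D_a ('D_b f) p - 'D_a ('D_b f) x| <= e / 2 &
    `|'D_b ('D_a f) p - 'D_b ('D_a f) x| <= e / 2].
  have n1 : \forall x \near p, A x by exact: near_open oA Ap (fun y h => h).
  have n2 : \forall x \near p, `|'D_a ('D_b f) p - 'D_a ('D_b f) x| <= e / 2.
    by move/cvgrPdist_le : c1; apply.
  have n3 : \forall x \near p, `|'D_b ('D_a f) p - 'D_b ('D_a f) x| <= e / 2.
    by move/cvgrPdist_le : c2; apply.
  by apply: filterS3 n1 n2 n3 => x; split.
have [s [t [sh th E1]]] := key a b h h0 (fun s t sh th => let: And3 H _ _ := hP s t sh th in H).
have Ah' s' t' : 0 <= s' <= h -> 0 <= t' <= h -> A (p + s' *: b + t' *: a).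
  by move=> sh' th'; rewrite addrAC; have [] := hP t' s' th' sh'.
have [s' [t' [sh' th' E2]]] := key b a h h0 Ah'.
have [_ _ B1] := hP s t sh th.
have [_ B2 _] := hP t' s' th' sh'.
(* the two second differences are equal, hence so are the two values *)
have hI (x y : R) : x * h * h = y * h * h -> x = y.
  by have h1 : h != 0 by [rewrite gt_eqF//]; move=> /(mulIf h1)/(mulIf h1).
have swap (u1 u2 u3 u4 : R) : u1 - u2 - (u3 - u4) = u1 - u3 - (u2 - u4) by ring.
have E3 := swap (f (p + h *: b + h *: a)) (f (p + h *: b)) (f (p + h *: a)) (f p).
have E4 : p + h *: b + h *: a = p + h *: a + h *: b by exact: addrAC.
rewrite {2}E4 in E3.
have E5 := hI _ _ (etrans (esym E1) (etrans (esym E3) E2)).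
have E6 : p + s' *: b + t' *: a = p + t' *: a + s' *: b by exact: addrAC.
rewrite E5 E6 in B1; rewrite distrC in B1; rewrite (splitr e).
apply: le_trans (lerD B2 B1); exact: ler_distD.
Qed.

Lemma derive_sym {V : normedModType R} {m n} (A : set V) (f : V -> 'M[R]_(m, n))
    a b p :
  open A -> A p -> Ck 2 A f -> 'D_a ('D_b f) p = 'D_b ('D_a f) p.
Proof.
move=> oA Ap C2f; apply/matrixP => i j.
have D v w : 'D_v ('D_w f) p i j = 'D_v ('D_w (fun x => f x i j : R^o)) p.
  rewrite derive_coord; last exact: (Ck_differentiable (Ck_derive w C2f)).
  apply: near_eq_derive; apply: near_open oA Ap _ => x Ax.
  by rewrite derive_coord//; exact: (Ck_differentiable C2f).
apply: etrans (D a b) (etrans _ (esym (D b a))).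
have Cij : Ck 2 A (fun x => f x i j : R^o) by move/(Ck_mxP _ _ oA) : C2f; exact.
exact: (derive_sym_real a b oA Ap Cij).
Qed.

Lemma ball_segment {V : normedModType R} (p x y : V) (e s : R) :
  ball p e x -> ball p e y -> 0 <= s <= 1 -> ball p e (x + s *: (y - x)).
Proof.
rewrite -!ball_normE /= => xe ye /andP[s0 s1].
have -> : p - (x + s *: (y - x)) = (1 - s) *: (p - x) + s *: (p - y).
  have e1 : p - y - (p - x) = x - y by rewrite opprB addrC addrA subrK.
  rewrite scalerBl scale1r -addrA [- _ + _]addrC -scalerBr e1.
  by rewrite opprD addrA -scalerN opprB.
rewrite (le_lt_trans (ler_normD _ _))// !normrZ (ger0_norm s0).
rewrite ger0_norm ?subr_ge0//.
have [->|s_neq0] := eqVneq s 0; first by rewrite subr0 mul1r mul0r addr0.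
have s_gt0 : 0 < s by rewrite lt_neqAle eq_sym s_neq0.
have -> : e = (1 - s) * e + s * e by ring.
by rewrite ler_ltD// ?ltr_pM2l// ler_wpM2l ?subr_ge0// ltW.
Qed.

(** The partial derivatives are bounded on a small ball, and a ball contains
    the segments that join its points. *)
Lemma C1_lipschitz_real {n} (A : set 'rV[R]_n) (f : 'rV[R]_n -> R^o) p :
  open A -> A p -> Ck 1 A f -> exists e L, [/\ 0 < e, 0 <= L, ball p e `<=` A &
    forall x y, ball p e x -> ball p e y -> `|f x - f y| <= L * `|x - y|].
Proof.
move=> oA Ap C1f.
have nA : \forall x \near p, A x by exact: near_open oA Ap (fun y h => h).
have nD : \forall x \near p, forall m,
    `|'D_(delta_mx 0 m) f x| <= `|'D_(delta_mx 0 m) f p| + 1.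
  apply: (@filter_forall _ 'I_n (fun m x => `|'D_(delta_mx 0 m) f x| <= `|'D_(delta_mx 0 m) f p| + 1) (nbhs p)) => m.
  have /cvgrPdist_le/(_ 1 ltr01) : {for p, continuous ('D_(delta_mx 0 m) f)}.
    exact: C1f.2.
  apply: filterS => x; rewrite -lerBlDl; apply: le_trans.
  by rewrite distrC; exact: lerB_dist.
have [e /= e0 eP] := (nbhs_ballP _ _).1 (filterI nA nD).
exists e, (\sum_m (`|'D_(delta_mx 0 m) f p| + 1)); split => //.
- by apply: sumr_ge0 => m _; rewrite addr_ge0.
- by move=> x /eP[].
move=> x y xe ye.
have seg (s : R) : 0 <= s <= 1 -> ball p e (y + s *: (x - y)) by exact: ball_segment.
have dg (s : R) : 0 <= s <= 1 -> is_derive s 1 (fun s : R => f (y + s *: (x - y)))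
    ('D_(x - y) f (y + s *: (x - y))).
  move=> s01; apply: is_derive_line; apply: (Ck_differentiable C1f).
  by have [] := eP _ (seg s s01).
have := @mvt_bound (fun s : R => f (y + s *: (x - y))) _
  ((\sum_m (`|'D_(delta_mx 0 m) f p| + 1)) * `|x - y|) 0 1.
rewrite (min_l ler01) (max_r ler01) => /(_ _ dg).
rewrite scale1r subrKC scale0r addr0 subr0 normr1 mulr1; apply=> s s01.
have [As Ds] := eP _ (seg s s01).
rewrite derive_dir; last exact: (Ck_differentiable C1f).
rewrite mulr_suml (le_trans (ler_norm_sum _ _ _))//; apply: ler_sum => m _.
by rewrite normrZ mulrC ler_pM//; exact: rV_coord_le.
Qed.

Lemma C1_lipschitz {n k} (A : set 'rV[R]_n) (f : 'rV[R]_n -> 'rV[R]_k) p :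
  open A -> A p -> Ck 1 A f -> exists e L, [/\ 0 < e, 0 <= L, ball p e `<=` A &
    forall x y, ball p e x -> ball p e y -> `|f x - f y| <= L * `|x - y|].
Proof.
move=> oA Ap /(Ck_mxP _ _ oA) C1f.
have /choice[e eP] j : exists e, 0 < e /\ exists L, [/\ 0 <= L, ball p e `<=` A &
    forall x y, ball p e x -> ball p e y -> `|f x 0 j - f y 0 j| <= L * `|x - y|].
  have [e [L [e0 L0 eA eL]]] := C1_lipschitz_real oA Ap (C1f 0 j).
  by exists e; split => //; exists L.
have /choice[L LP] j := (eP j).2.
have [r /= r0 rA] : exists2 r : R, 0 < r & ball p r `<=` A.
  exact: (nbhs_ballP _ _).1 (near_open oA Ap (fun y h => h)).
pose e0 := \big[Num.min/r]_j e j.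
have e0e j : e0 <= e j by exact: bigmin_le_cond.
have e0r : e0 <= r by exact: bigmin_le_id.
exists e0, (\sum_j L j); split.
- apply: (big_ind (fun x : R => 0 < x)) => // [x y x0 y0|j _].
    by rewrite lt_min x0.
  by have [] := eP j.
- by apply: sumr_ge0 => j _; have [] := LP j.
- by move=> x /(le_ball e0r)/rA.
move=> x y xe ye; apply: rV_norm_le => [|j].
  by rewrite mulr_ge0// sumr_ge0// => j _; have [] := LP j.
rewrite !mxE; have [_ _ /(_ x y)] := LP j.
move=> /(_ (le_ball (e0e j) xe) (le_ball (e0e j) ye))/le_trans; apply.
rewrite ler_wpM2r// (bigD1 j)//= lerDl sumr_ge0// => i _.
by have [] := LP i.
Qed.

End MeanValue.

(** * Primitives and the lemma of Gronwall *)

Section ODE.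
Context {R : realType}.

(** The integral starts at -1 because the fundamental theorem of calculus is
    needed in a neighborhood of 0; the second term moves the zero to 0. *)
Definition primitive (h : R -> R) (t : R) : R :=
  parameterized_integral lebesgue_measure (-1) t h -
  parameterized_integral lebesgue_measure (-1) 0 h.

Lemma primitive0 h : primitive h 0 = 0.
Proof. exact: subrr. Qed.

Lemma primitive_derive (h : R -> R) (t : R) : continuous h -> `|t| < 1 ->
  is_derive t 1 (primitive h) (h t).
Proof.
move=> ch; rewrite ltr_norml => /andP[t1 t2].
have ih : (@lebesgue_measure R).-integrable `[-1, 1] (EFin \o h).
  apply: continuous_compact_integrable; first exact: segment_compact.
  exact: continuous_subspaceT.
have [dF FE] := continuous_FTC1_closed t2 ih t1 (ch t).
rewrite -[h t]subr0; apply: is_deriveB.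
split; first exact: dF.
exact: etrans (esym (derive1E _ _)) FE.
Qed.

(** The function b(t)^2 exp(- 2 K t) is nonincreasing, nonnegative and zero at
    0. *)
Lemma gronwall0_right (b : R -> R) (K d : R) : 0 <= K ->
  (forall t, 0 <= t < d -> derivable b t 1) ->
  (forall t, 0 <= t < d -> `|'D_1 b t| <= K * `|b t|) ->
  b 0 = 0 -> forall t, 0 <= t < d -> b t = 0.
Proof.
move=> K0 db bK b0 t /andP[t0 td].
pose g (s : R) := b s * b s * expR (- (2 * K) * s).
have dg (s : R) : 0 <= s < d -> is_derive s 1 g
    ((b s * 'D_1 b s *+ 2 - 2 * K * (b s * b s)) * expR (- (2 * K) * s)).
  move=> sd; have dbs := derivableP (db s sd).
  have : is_derive s 1 (fun s => - (2 * K) * s) (- (2 * K)).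
    have /(@is_deriveZ _ _ _ _ (- (2 * K))) := @is_derive_id R R s 1.
    by rewrite -[X in is_derive _ _ _ X]/(_ * 1) mulr1.
  move=> /(is_derive1_comp (is_derive_expR _)) de.
  have D := is_deriveM (is_deriveM dbs dbs) de.
  apply: (is_derive_eq D); rewrite /GRing.scale/= -[(b * b) s]/(b s * b s); ring.
have g_t : g t <= g 0.
  apply: (@ler0_derive1_nincr _ g 0 t) => //.
  - move=> s; rewrite in_itv/= => /andP[s0 st].
    have sd : 0 <= s < d by rewrite ltW//= (lt_trans st).
    by have [] := dg s sd.
  - move=> s; rewrite in_itv/= => /andP[s0 st].
    have sd : 0 <= s < d by rewrite ltW//= (lt_trans st).
    rewrite derive1E; have [_ ->] := dg s sd.
    rewrite mulr_le0_ge0 ?expR_ge0// subr_le0.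
    rewrite -mulrnAl -mulr_natl -mulrA -mulrA ler_pM2l//.
    rewrite (le_trans (ler_norm _))// normrM.
    have -> : K * (b s * b s) = `|b s| * (K * `|b s|).
      by rewrite [RHS]mulrCA -normrM ger0_norm// -expr2 sqr_ge0.
    by rewrite ler_wpM2l// bK.
  - apply: within_continuous => s /andP[s0 st]; apply: derivable_cont.
    have sd : 0 <= s < d by rewrite s0 (le_lt_trans st).
    by have [] := dg s sd.
move: g_t; rewrite /g b0 !mul0r pmulr_lle0 ?expR_gt0// -expr2 => bt.
by apply/eqP; rewrite -sqrf_eq0 eq_le bt sqr_ge0.
Qed.

Lemma gronwall0 (b : R -> R) (K d : R) : 0 <= K ->
  (forall t, `|t| < d -> derivable b t 1) ->
  (forall t, `|t| < d -> `|'D_1 b t| <= K * `|b t|) ->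
  b 0 = 0 -> forall t, `|t| < d -> b t = 0.
Proof.
move=> K0 db bK b0 t; have [t0|t0] := leP 0 t; rewrite ltr_norml => /andP[td1 td2].
  apply: (@gronwall0_right b K d) => //; last by rewrite t0.
  - by move=> s /andP[s0 sd]; apply: db; rewrite ger0_norm.
  - by move=> s /andP[s0 sd]; apply: bK; rewrite ger0_norm.
have dN (s : R) : 0 <= s < d -> is_derive s 1 (fun s => b (- s)) (- 'D_1 b (- s)).
  move=> /andP[s0 sd]; have dbs : is_derive (- s) 1 b ('D_1 b (- s)).
    by apply/derivableP/db; rewrite normrN ger0_norm.
  have := is_derive1_comp dbs (is_deriveN (is_derive_id s 1)).
  by rewrite /GRing.scale/= mulrN1.
rewrite -[t]opprK; apply: (@gronwall0_right (fun s => b (- s)) K d) => //.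
- by move=> s /dN[].
- move=> s sd; have [_ ->] := dN s sd; rewrite normrN; apply: bK.
  by case/andP: sd => s0 sd; rewrite normrN ger0_norm.
- by rewrite oppr0.
- by rewrite oppr_ge0 ltW//= ltrNl.
Qed.

End ODE.

(** * Local solutions of autonomous differential equations *)

Section Picard.
Context {R : realType}.

(** The projection of R onto [c - r, c + r], a 1-Lipschitz map; used
    coordinatewise it extends a Lipschitz vector field from a ball to the
    whole space. *)
Definition clamp (c r x : R) : R := Num.max (c - r) (Num.min (c + r) x).

Lemma clamp_dist c r x : 0 <= r -> `|c - clamp c r x| <= r.
Proof.
move=> r0; rewrite /clamp ler_norml.
by case: (leP (c + r) x) => ?; case: (leP (c - r) _) => ?; apply/andP; split; lra.
Qed.

Lemma clamp_id c r x : `|c - x| <= r -> clamp c r x = x.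
Proof.
rewrite /clamp ler_norml => /andP[h1 h2].
by case: (leP (c + r) x) => ?; case: (leP (c - r) _) => ?; lra.
Qed.

Lemma clamp_lipschitz c r x y : 0 <= r -> `|clamp c r x - clamp c r y| <= `|x - y|.
Proof.
move=> r0; rewrite /clamp ler_norml.
have h1 := ler_norm (x - y); have h2 := ler_norm (y - x); rewrite distrC in h2.
case: (leP (c + r) x) => ?; case: (leP (c - r) _) => ?;
case: (leP (c + r) y) => ?; case: (leP (c - r) _) => ?;
by apply/andP; split; lra.
Qed.

Lemma lipschitz_cont {V W : normedModType R} (f : V -> W) (L : R) :
  0 <= L -> (forall x y, `|f x - f y| <= L * `|x - y|) -> continuous f.
Proof.
move=> L0 fL x; apply/cvgrPdist_lt => e e0.
have L1 : 0 < L + 1 by rewrite ltr_wpDl.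
have : \forall y \near x, `|x - y| < e / (L + 1).
  by apply: (@cvgr_dist_lt _ _ _ (nbhs x) _ id x) => //; rewrite divr_gt0.
apply: filterS => y; rewrite ltr_pdivlMr// => xy.
rewrite (le_lt_trans (fL _ _))// (le_lt_trans _ xy)// mulrC ler_wpM2l// lerDl.
exact: ler01.
Qed.

Lemma is_derive_rV {n} (f : R -> 'rV[R]_n) (df : 'rV[R]_n) (t : R) :
  (forall j, is_derive t 1 (fun x => f x 0 j) (df 0 j)) -> is_derive t 1 f df.
Proof.
move=> fj; have dm : derivable f t 1.
  by apply/derivable_mxP => i j; rewrite (ord1 i); have [] := fj j.
split => //; rewrite derive_mx//; apply/rowP => j; rewrite mxE.
by have [_] := fj j.
Qed.

Lemma is_derive_scaler {W : normedModType R} (w : W) (t : R) :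
  is_derive t 1 (fun x : R => x *: w) w.
Proof.
have di : differentiable (id : W -> W) (0 + t *: w) by [].
have := is_derive_line di; rewrite derive_id.
by apply: near_eq_is_derive; apply: filterE => x; rewrite add0r.
Qed.

Section iteration.
Variables (n : nat) (Phi0 : 'rV[R]_n -> 'rV[R]_n) (q0 : 'rV[R]_n) (e L : R).
Hypotheses (e0 : 0 < e) (L0 : 0 <= L).
Hypothesis lip : forall x y, ball q0 e x -> ball q0 e y ->
  `|Phi0 x - Phi0 y| <= L * `|x - y|.

Let box (x : 'rV[R]_n) : 'rV[R]_n := \row_j clamp (q0 0 j) (e / 2) (x 0 j).
Let Phi x := Phi0 (box x).
Let M := `|Phi0 q0| + L * e.

Let e20 : 0 <= e / 2. Proof. by rewrite divr_ge0// ltW. Qed.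

Let box_ball x : ball q0 e (box x).
Proof.
rewrite -ball_normE /=; apply: (@le_lt_trans _ _ (e / 2)); last first.
  by rewrite ltr_pdivrMr// ltr_pMr// ltr1n.
by apply: rV_norm_le => // j; rewrite !mxE; exact: clamp_dist.
Qed.

Let box_id x : `|q0 - x| <= e / 2 -> box x = x.
Proof.
move=> xe; apply/rowP => j; rewrite mxE; apply: clamp_id.
by have := rV_coord_le (q0 - x) j; rewrite !mxE => /le_trans; exact.
Qed.

Let box_lip x y : `|box x - box y| <= `|x - y|.
Proof.
apply: rV_norm_le => // j; rewrite !mxE (le_trans (clamp_lipschitz _ _ _ _))//.
by have := rV_coord_le (x - y) j; rewrite !mxE.
Qed.

Let Phi_lip x y : `|Phi x - Phi y| <= L * `|x - y|.
Proof. by rewrite (le_trans (lip (box_ball x) (box_ball y)))// ler_wpM2l ?box_lip. Qed.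

Let Phi_bound x : `|Phi x| <= M.
Proof.
rewrite -[Phi x](subrK (Phi0 q0)) (le_trans (ler_normD _ _))// addrC lerD2l.
have q0e : ball q0 e q0 by exact: ballxx.
rewrite (le_trans (lip (box_ball x) q0e))// ler_wpM2l// distrC ltW//.
by have := box_ball x; rewrite -ball_normE.
Qed.

Let M0 : 0 <= M. Proof. by rewrite addr_ge0// mulr_ge0// ltW. Qed.

Let Phi_cont : continuous Phi. Proof. exact: lipschitz_cont L0 Phi_lip. Qed.

Let tau (t : R) := clamp 0 2^-1 t.

Let half0 : (0 : R) <= 2^-1. Proof. by rewrite invr_ge0. Qed.

Let tau_le t : `|tau t| < 1.
Proof.
have := @clamp_dist 0 2^-1 t half0; rewrite sub0r normrN => /le_lt_trans; apply.
by rewrite invf_lt1// ltr1n.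
Qed.

Let tau_id t : `|t| <= 2^-1 -> tau t = t.
Proof. by move=> th; apply: clamp_id; rewrite sub0r normrN. Qed.

Let tau_cont : continuous tau.
Proof.
apply: (@lipschitz_cont R R _ 1) => // x y; rewrite mul1r.
exact: clamp_lipschitz.
Qed.

Let next (q : R -> 'rV[R]_n) (t : R) : 'rV[R]_n :=
  q0 + \row_j primitive (fun s => Phi (q (tau s)) 0 j) t.

Let it k := iter k next (cst q0).

Let next_derive (q : R -> 'rV[R]_n) (t : R) : (forall s : R, `|s| < 1 -> {for s, continuous q}) ->
  `|t| < 1 -> is_derive t 1 (next q) (Phi (q (tau t))).
Proof.
move=> cq t1; rewrite -[Phi _]add0r; apply: is_deriveD.
have dj j : is_derive t 1 (primitive (fun s => Phi (q (tau s)) 0 j)) (Phi (q (tau t)) 0 j).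
  apply: (@primitive_derive R (fun s => Phi (q (tau s)) 0 j)) => // s.
  apply: (@continuous_comp _ _ _ (fun s => Phi (q (tau s))) (fun N : 'rV[R]_n => N 0 j)).
    apply: (@continuous_comp _ _ _ (q \o tau) Phi); last exact: Phi_cont.
    apply: continuous_comp; first exact: tau_cont.
    exact/cq/tau_le.
  exact: matrix_normedtype.coord_continuous.
apply: is_derive_rV => j; apply: near_eq_is_derive (dj j).
by apply: filterE => x; rewrite mxE.
Qed.

Let it_cont k (t : R) : `|t| < 1 -> {for t, continuous (it k)}.
Proof.
elim: k t => [|k IH] t t1; first exact: cst_continuous.
apply: differentiable_continuous; apply/derivable1_diffP.
by have [] := next_derive IH t1.
Qed.

Let it_derive k (t : R) : `|t| <= 2^-1 -> is_derive t 1 (it k.+1) (Phi (it k t)).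
Proof.
move=> th; have t1 : `|t| < 1 by rewrite (le_lt_trans th)// invf_lt1// ltr1n.
by have := next_derive (@it_cont k) t1; rewrite tau_id.
Qed.

Let btw (s t x r : R) : `|s| <= r -> `|t| <= r ->
  Num.min s t <= x <= Num.max s t -> `|x| <= r.
Proof.
rewrite !ler_norml => /andP[s1 s2] /andP[t1 t2] /andP[].
rewrite ge_min le_max => /orP[] h1 /orP[] h2; apply/andP; split; lra.
Qed.

Let it_lip k (s t : R) : `|s| <= 2^-1 -> `|t| <= 2^-1 ->
  `|it k t - it k s| <= M * `|t - s|.
Proof.
move=> sh th; case: k => [|k]; first by rewrite subrr normr0 mulr_ge0.
apply: (@mvt_bound_rV _ _ _ (fun x => Phi (it k x))) => x xst.
  by apply: it_derive; exact: btw xst.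
exact: Phi_bound.
Qed.

Let it0 k : it k 0 = q0.
Proof.
case: k => // k; apply/rowP => j; rewrite /it/= /next !mxE primitive0.
by rewrite addr0.
Qed.

Variable d : R.
Hypotheses (d0 : 0 < d) (d_half : d <= 2^-1) (dL : L * d <= 2^-1)
  (dM : M * d <= e / 2).

Let geo k : R := 2^-1 ^+ k.

(* each step gains the factor L d <= 1/2 *)
Let it_contr k (t : R) : `|t| <= d -> `|it k.+1 t - it k t| <= M * d * geo k.
Proof.
elim: k t => [|k IH] t td.
  rewrite /geo expr0 mulr1 -[it 0 t](it0 1) (le_trans (it_lip _ _ _))//.
  - by rewrite normr0.
  - exact: le_trans d_half.
  - by rewrite subr0 ler_wpM2l.
have -> : it k.+2 t - it k.+1 t = it k.+2 t - it k.+1 t - (it k.+2 0 - it k.+1 0).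
  by rewrite !it0 subrr subr0.
apply: (@le_trans _ _ (L * (M * d * geo k) * `|t - 0|)).
  apply: (@mvt_bound_rV _ _ (fun x => it k.+2 x - it k.+1 x)
    (fun x => Phi (it k.+1 x) - Phi (it k x))) => x xst.
    have xd : `|x| <= 2^-1 by apply: le_trans (btw _ td xst) d_half; rewrite normr0 ltW.
    by apply: is_deriveB; exact: it_derive.
  have xd : `|x| <= d by apply: (btw _ td xst); rewrite normr0 ltW.
  by rewrite (le_trans (Phi_lip _ _))// ler_wpM2l// IH.
have g0 : 0 <= M * d * geo k by rewrite !mulr_ge0// ?exprn_ge0// ltW.
rewrite subr0 (@le_trans _ _ (L * (M * d * geo k) * d))//.
  by rewrite ler_wpM2l// mulr_ge0.
have -> : L * (M * d * geo k) * d = (L * d) * (M * d * geo k) by ring.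
have -> : M * d * geo k.+1 = 2^-1 * (M * d * geo k) by rewrite /geo exprS; ring.
by rewrite ler_wpM2r.
Qed.

Let it_tail k m (t : R) : `|t| <= d ->
  `|it (m + k)%N t - it k t| <= M * d * geo k * 2.
Proof.
move=> td.
have g0 : 0 <= M * d * geo k by rewrite !mulr_ge0// ?exprn_ge0// ltW.
suff : `|it (m + k)%N t - it k t| <= M * d * geo k * (2 - 2 * geo m).
  move/le_trans; apply; rewrite ler_wpM2l// gerBl mulr_ge0//.
  by rewrite exprn_ge0.
elim: m => [|m IH].
  by rewrite add0n subrr normr0 /geo expr0 mulr1 subrr mulr0.
rewrite addSn -(subrKA (it (m + k)%N t)) (le_trans (ler_normD _ _))//.
rewrite (le_trans (lerD (it_contr _ td) IH))//.
have -> : geo (m + k) = geo m * geo k by rewrite /geo exprD.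
have -> : geo m.+1 = 2^-1 * geo m by rewrite /geo exprS.
have -> // : M * d * (geo m * geo k) + M * d * geo k * (2 - 2 * geo m) =
  M * d * geo k * (2 - 2 * (2^-1 * geo m)).
by field.
Qed.

Let geo_small (c r : R) : 0 <= c -> 0 < r -> exists k, c * geo k <= r.
Proof.
move=> c0 r0; have c1 : 0 < c + 1 by rewrite ltr_wpDl.
have /cvgrPdist_le/(_ (r / (c + 1))) : geo @ \oo --> (0 : R).
  by apply: cvg_expr; rewrite ger0_norm// invf_lt1// ltr1n.
rewrite divr_gt0// => /(_ isT)[k _ /(_ k (leqnn k))].
rewrite sub0r normrN ger0_norm ?exprn_ge0// ler_pdivlMr// => kr.
exists k; apply: le_trans kr; rewrite mulrC ler_wpM2l ?exprn_ge0//.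
by rewrite lerDl.
Qed.

Let q (t : R) : 'rV[R]_n := lim (it k t @[k --> \oo]).

Let q_cvg (t : R) : `|t| <= d -> it k t @[k --> \oo] --> q t.
Proof.
move=> td; apply/cauchy_cvgP/cauchy_exP => r r0.
have r20 : 0 < r / 2 by rewrite divr_gt0.
have c0 : 0 <= M * d * 2 by rewrite !mulr_ge0// ltW.
have [k kr] := geo_small c0 r20.
exists (it k t); exists k => // m /= km.
rewrite -ball_normE /= distrC -(subnK km) (le_lt_trans (it_tail _ _ td))//.
by rewrite mulrAC (le_lt_trans kr)// ltr_pdivrMr// ltr_pMr// ltr1n.
Qed.

Let q_close k (t : R) : `|t| <= d -> `|q t - it k t| <= M * d * geo k * 2.
Proof.
move=> td; apply/ler_addgt0Pr => r r0.
have [m _ /(_ (m + k)%N (leq_addr _ _))/= mr] :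
    \forall m \near \oo, `|q t - it m t| <= r.
  by have /cvgrPdist_le := q_cvg td; exact.
rewrite -(subrKA (it (m + k)%N t)) (le_trans (ler_normD _ _))// addrC.
by rewrite lerD// it_tail.
Qed.

(* The iterates satisfy this up to errors of order 2^-k, by the mean value
   bound for it_(k+1)(x) - x Phi(q t); Phi is L-Lipschitz and the solution
   M-Lipschitz. *)
Let q_lin (s t : R) : `|s| <= d -> `|t| <= d ->
  `|q s - q t - (s - t) *: Phi (q t)| <= L * M * `|s - t| ^+ 2.
Proof.
move=> sd td; apply/ler_addgt0Pr => r r0.
pose C := M * d * 2.
have C0 : 0 <= C by rewrite !mulr_ge0// ltW.
have c0 : 0 <= C + C + L * C * `|s - t|.
  by apply: addr_ge0; [exact: addr_ge0|apply: mulr_ge0 => //; exact: mulr_ge0].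
have [k kr] := geo_small c0 r0.
have g0 : 0 <= geo k by rewrite exprn_ge0.
have g1 : geo k.+1 <= geo k by rewrite /geo exprS ger_pMl ?exprn_gt0// invf_le1// ler1n.
have E : M * d * geo k * 2 = C * geo k by rewrite /C; ring.
have qk (x : R) : `|x| <= d -> `|q x - it k.+1 x| <= C * geo k.
  move=> xd; rewrite (le_trans (q_close _ xd))// -E ler_wpM2r// ler_wpM2l// mulr_ge0//.
  exact: ltW.
have main : `|it k.+1 s - it k.+1 t - (s - t) *: Phi (q t)| <=
    L * (M * `|s - t| + C * geo k) * `|s - t|.
  have -> : it k.+1 s - it k.+1 t - (s - t) *: Phi (q t) =
    (it k.+1 s - s *: Phi (q t)) - (it k.+1 t - t *: Phi (q t)).
    by apply/rowP => j; rewrite !mxE; ring.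
  apply: (@mvt_bound_rV _ _ (fun x => it k.+1 x - x *: Phi (q t))
    (fun x => Phi (it k x) - Phi (q t))) => x xst.
    apply: is_deriveB; first by apply: it_derive; apply: le_trans (btw td sd xst) d_half.
    exact: is_derive_scaler.
  have xd := btw td sd xst.
  rewrite (le_trans (Phi_lip _ _))// ler_wpM2l//.
  rewrite -(subrKA (it k t)) (le_trans (ler_normD _ _))// lerD//.
    rewrite (le_trans (it_lip _ _ _))//; [exact: le_trans d_half..|].
    rewrite ler_wpM2l//; move: xst; rewrite ge_min le_max !ler_norml => /andP[].
    have h1 := ler_norm (s - t); have h2 := ler_norm (t - s); rewrite distrC in h2.
    by move=> /orP[] ? /orP[] ?; apply/andP; split; lra.
  by rewrite distrC -E; exact: q_close.
have -> : q s - q t - (s - t) *: Phi (q t) = (q s - it k.+1 s) - (q t - it k.+1 t)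
   + (it k.+1 s - it k.+1 t - (s - t) *: Phi (q t)).
  by apply/rowP => j; rewrite !mxE; ring.
rewrite (le_trans (ler_normD _ _))// addrC (le_trans (lerD main (le_trans (ler_normB _ _) (lerD (qk _ sd) (qk _ td)))))//.
apply: le_trans (lerD (lexx _) kr).
rewrite le_eqVlt; apply/orP; left; apply/eqP; rewrite expr2; ring.
Qed.

Let q_dist (t : R) : `|t| <= d -> `|q t - q0| <= M * `|t|.
Proof.
move=> td; apply/ler_addgt0Pr => r r0.
have c0 : 0 <= M * d * 2 by rewrite !mulr_ge0// ltW.
have [k kr] := geo_small c0 r0.
rewrite [leRHS]addrC -(subrKA (it k t)) (le_trans (ler_normD _ _))// lerD//.
  by rewrite (le_trans (q_close k td))// mulrAC.
rewrite -(it0 k) (le_trans (it_lip _ _ _)) ?subr0// ?normr0//.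
exact: le_trans d_half.
Qed.

(** Picard iteration. The field is made bounded and globally Lipschitz by
    clamping the coordinates to a box inside the ball, and time is clamped to
    [-1/2, 1/2] so that the integrands are continuous on the line. The
    solution is proved to be differentiable by the quadratic estimate q_lin,
    which passes to the limit; no integral equation for the limit is used. *)
Lemma picard_local : exists q : R -> 'rV[R]_n, q 0 = q0 /\
  forall t : R, `|t| < d -> ball q0 e (q t) /\ is_derive t 1 q (Phi0 (q t)).
Proof.
exists q; split=> [|t td].
  apply/eqP; rewrite -subr_eq0 -normr_le0 (le_trans (q_dist _))// ?normr0 ?mulr0//.
  exact: ltW.
have tq : `|q0 - q t| <= e / 2.
  rewrite distrC (le_trans (q_dist (ltW td)))// (le_trans _ dM)//.
  by rewrite ler_wpM2l// ltW.
have tb := box_id tq; split; first by rewrite -tb.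
have <- : Phi (q t) = Phi0 (q t) by rewrite /Phi tb.
suff cv : h^-1 *: (q (h *: (1 : R^o) + t) - q t) @[h --> 0^'] --> Phi (q t).
  by split; [apply/cvg_ex; exists (Phi (q t))|apply/cvg_lim].
apply/cvgrPdist_le => r r0.
have LM0 : 0 < L * M + 1 by rewrite ltr_wpDl// mulr_ge0.
near=> h.
have h0 : h != 0 by near: h; exact: nbhs_dnbhs_neq.
have hd : `|h| <= d - `|t|.
  by near: h; apply: dnbhs0_le; rewrite subr_gt0.
have hr : `|h| <= r / (L * M + 1).
  by near: h; apply: dnbhs0_le; rewrite divr_gt0.
have -> : h *: (1 : R^o) + t = h + t by congr (_ + _); exact: mulr1.
have -> : Phi (q t) - h^-1 *: (q (h + t) - q t) =
    - (h^-1 *: (q (h + t) - q t - (h + t - t) *: Phi (q t))).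
  by rewrite addrK [in RHS]scalerBr scalerA mulVf// scale1r opprB.
rewrite normrN normrZ normfV ler_pdivrMl ?normr_gt0//.
have htd : `|h + t| <= d.
  by rewrite (le_trans (ler_normD _ _))// -lerBrDr.
rewrite (le_trans (q_lin htd (ltW td)))// addrK expr2 mulrA mulrC ler_wpM2l//.
move: hr; rewrite ler_pdivlMr// mulrC; apply: le_trans.
by rewrite ler_wpM2r// lerDl.
Unshelve. all: by end_near. Qed.

End iteration.

(** A C^1 field is Lipschitz near the initial point, and the existence time d
    only has to be small compared with its Lipschitz constant and its bound.
    *)
Lemma picard_lindelof {n} (A : set 'rV[R]_n) (Phi : 'rV[R]_n -> 'rV[R]_n) q0 :
  open A -> A q0 -> Ck 1 A Phi ->
  exists d (q : R -> 'rV[R]_n), [/\ 0 < d, q 0 = q0 &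
    forall t : R, `|t| < d -> A (q t) /\ is_derive t 1 q (Phi (q t))].
Proof.
move=> oA Aq0 C1; have [e [L [e0 L0 eA lip]]] := C1_lipschitz oA Aq0 C1.
pose M := `|Phi q0| + L * e.
have M0 : 0 <= M by rewrite addr_ge0// mulr_ge0// ltW.
pose d : R := Num.min 2^-1 (Num.min (2^-1 / (L + 1)) (e / 2 / (M + 1))).
have d0 : 0 < d by rewrite !lt_min invr_gt0 ltr0n !divr_gt0// ?ltr_wpDl// invr_gt0.
have d1 : d <= 2^-1 by rewrite ge_min lexx.
have d2 : L * d <= 2^-1.
  have : d <= 2^-1 / (L + 1) by rewrite !ge_min lexx orbT.
  rewrite ler_pdivlMr ?ltr_wpDl//; apply: le_trans.
  by rewrite mulrC ler_wpM2l ?lerDl// ltW.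
have d3 : M * d <= e / 2.
  have : d <= e / 2 / (M + 1) by rewrite !ge_min lexx !orbT.
  rewrite ler_pdivlMr ?ltr_wpDl//; apply: le_trans.
  by rewrite mulrC ler_wpM2l ?lerDl// ltW.
have [q [q00 qP]] := picard_local e0 L0 lip d0 d1 d2 d3.
by exists d, q; split => // t td; have [/eA] := qP t td.
Qed.

End Picard.

(** * Derivatives of matrix products *)

Section MatrixDerivative.
Context {R : realType} {V : normedModType R}.

Lemma is_derive_mx {m n} (f : V -> 'M[R]_(m, n)) (df : 'M[R]_(m, n)) x v :
  (forall i j, is_derive x v (fun y => f y i j : R^o) (df i j)) -> is_derive x v f df.
Proof.
move=> fj; have dm : derivable f x v.
  by apply/derivable_mxP => i j; have [] := fj i j.
split => //; rewrite derive_mx//; apply/matrixP => i j; rewrite mxE.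
by have [_] := fj i j.
Qed.

Lemma is_derive_coord {m n} (f : V -> 'M[R]_(m, n)) (df : 'M[R]_(m, n)) x v i j :
  is_derive x v f df -> is_derive x v (fun y => f y i j : R^o) (df i j).
Proof.
move=> [dm <-]; split; first by move/derivable_mxP : dm; exact.
by rewrite derive_mx// mxE.
Qed.

Lemma is_derive_mulmx {m n p} (f : V -> 'M[R]_(m, n)) (h : V -> 'M[R]_(n, p))
    df dh x v : is_derive x v f df -> is_derive x v h dh ->
  is_derive x v (fun y => f y *m h y) (df *m h x + f x *m dh).
Proof.
move=> Df Dh; apply: is_derive_mx => i j.
have D : is_derive x v (\sum_k ((fun y => f y i k : R^o) * (fun y => h y k j : R^o)))
    (\sum_k (f x i k *: dh k j + h x k j *: df i k)).
  by apply: is_derive_sum => k; apply: is_deriveM; exact: is_derive_coord.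
have E : (df *m h x + f x *m dh) i j =
    \sum_k (f x i k *: dh k j + h x k j *: df i k).
  rewrite !mxE -big_split/=; apply: eq_bigr => k _.
  by rewrite addrC; congr (_ + _); rewrite mulrC.
rewrite E; apply: near_eq_is_derive D; apply: filterE => y.
by rewrite mxE fct_sumE.
Qed.

Lemma is_derive_trmx {m n} (f : V -> 'M[R]_(m, n)) df x v :
  is_derive x v f df -> is_derive x v (fun y => (f y)^T) df^T.
Proof.
move=> Df; apply: is_derive_mx => i j; rewrite mxE.
apply: near_eq_is_derive (is_derive_coord j i Df).
by apply: filterE => y; rewrite mxE.
Qed.

Lemma diff_is_derive {W : normedModType R} (f : V -> W) x v :
  differentiable f x -> is_derive x v f ('D_v f x).
Proof. by move=> df; split => //; exact: diff_derivable. Qed.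

Lemma derive_comp {W : normedModType R} {n} (f : 'rV[R]_n -> W) (h : V -> 'rV[R]_n) x v :
  differentiable h x -> differentiable f (h x) ->
  'D_v (f \o h) x = 'D_('D_v h x) f (h x).
Proof. by move=> dh df; rewrite derive_chain// [RHS]derive_dir. Qed.

End MatrixDerivative.

(** * Bilinear forms on row vectors *)

Section Bilinear.
Context {R : realType} {n : nat}.
Implicit Types (G : 'M[R]_n) (v w : 'rV[R]_n).

Definition bil G v w : R := (v *m G *m w^T) 0 0.

Lemma bilE G v w : bil G v w = \sum_i \sum_j v 0 i * G i j * w 0 j.
Proof.
rewrite /bil mxE exchange_big/=; apply: eq_bigr => j _.
by rewrite !mxE mulr_suml.
Qed.

Lemma bilC G v w : G^T = G -> bil G v w = bil G w v.
Proof.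
by move=> GT; rewrite /bil -[in LHS]GT -{1}[v]trmxK -!trmx_mul mxE mulmxA.
Qed.

Lemma bilDl G u v w : bil G (u + v) w = bil G u w + bil G v w.
Proof. by rewrite /bil !mulmxDl mxE. Qed.

Lemma bilDr G u v w : bil G w (u + v) = bil G w u + bil G w v.
Proof. by rewrite /bil linearD/= mulmxDr mxE. Qed.

Lemma bilZl G a v w : bil G (a *: v) w = a * bil G v w.
Proof. by rewrite /bil -!scalemxAl mxE. Qed.

Lemma bilZr G a v w : bil G w (a *: v) = a * bil G w v.
Proof. by rewrite /bil linearZ/= -scalemxAr mxE. Qed.

Lemma bil_nondeg G v w : G \in unitmx ->
  (forall z, bil G v z = bil G w z) -> v = w.
Proof.
move=> Gu vw; suff : v *m G = w *m G by move/(can_inj (mulmxK Gu)).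
apply/rowP => j; have := vw (delta_mx 0 j).
by rewrite /bil trmx_delta -!colE !mxE.
Qed.

Lemma bil_mulmx G J v w : bil (J *m G *m J^T) v w = bil G (v *m J) (w *m J).
Proof. by rewrite /bil trmx_mul !mulmxA. Qed.

End Bilinear.

(** * The Levi-Civita connection in a chart *)

Lemma of_class_Ck {R : realType} {V W : normedModType R} r k (A : set V) (f : V -> W) :
  of_class r A f -> at_least k r -> Ck k A f.
Proof.
case: r => [n||] /=.
- by move=> Cn kn; exact: Ck_le Cn.
- by move=> C _; exact: C.
- by move=> [C _] _; exact: C.
Qed.

Section ChartGeometry.
Context {R : realType} {M : oriented_manifold3 R} {r : smoothness}.
Variable g : lorentz_metric M r.
Hypothesis hr : at_least 4 r.

Lemma gram_C4 c : Ck 4 (coord c @` dom c) (gram g c).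
Proof. exact: of_class_Ck (gram_class g c) hr. Qed.

Lemma gram_unit c x : (coord c @` dom c) x -> gram g c x \in unitmx.
Proof.
move=> /(gram_signature g)[P Pu PGP].
have : P *m gram g c x *m P^T \in unitmx.
  rewrite PGP unitmxE det_diag unitfE; apply/prodf_neq0 => i _.
  by rewrite mxE; case: ifP => _; rewrite ?oppr_eq0 oner_neq0.
by rewrite !unitmx_mul => /andP[/andP[]].
Qed.

(** The right-hand side of the Koszul formula for constant fields in the
    chart, that is, g(Gamma(v, w), z). *)
Definition koszul (c : chart M) (x v w z : 'rV[R]_3) : R :=
  2^-1 * (bil ('D_v (gram g c) x) w z + bil ('D_w (gram g c) x) v z
          - bil ('D_z (gram g c) x) v w).

Lemma metricE c x v w : metric g c x v w = bil (gram g c x) v w.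
Proof. by []. Qed.

Lemma derive_gram c x v : (coord c @` dom c) x ->
  'D_v (gram g c) x = \sum_m v 0 m *: 'D_(delta_mx 0 m) (gram g c) x.
Proof. by move=> cx; apply/derive_dir/(Ck_differentiable (gram_C4 c)). Qed.

(** As g is nondegenerate, this characterizes gamma; the Christoffel symbols
    are not expanded any more below. *)
Lemma gamma_koszul c x v w z : (coord c @` dom c) x ->
  metric g c x (gamma g c x v w) z = koszul c x v w z.
Proof.
move=> cx; rewrite metricE /koszul.
set G := gram g c x; have Gu : G \in unitmx by exact: gram_unit.
have GT : G^T = G by exact: gram_sym.
pose T : 'rV[R]_3 := \row_l \sum_i \sum_j (('D_(delta_mx 0 i) (gram g c) x) j l
  + ('D_(delta_mx 0 j) (gram g c) x) i l - ('D_(delta_mx 0 l) (gram g c) x) i j)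
  * v 0 i * w 0 j.
have -> : gamma g c x v w = 2^-1 *: (T *m invmx G).
  apply/rowP => k; rewrite !mxE mulr_sumr.
  transitivity (\sum_i \sum_j \sum_l 2^-1 * (invmx G k l *
    (('D_(delta_mx 0 i) (gram g c) x) j l + ('D_(delta_mx 0 j) (gram g c) x) i l
     - ('D_(delta_mx 0 l) (gram g c) x) i j) * v 0 i * w 0 j)).
    apply: eq_bigr => i _; apply: eq_bigr => j _.
    rewrite /christoffel -!mulrA mulr_suml mulr_sumr.
    by apply: eq_bigr => l _; rewrite !mulrA.
  under eq_bigr do rewrite exchange_big/=.
  rewrite exchange_big/=; apply: eq_bigr => l _.
  rewrite mxE mulr_suml mulr_sumr; apply: eq_bigr => i _.
  rewrite mulr_suml mulr_sumr; apply: eq_bigr => j _.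
  have -> : invmx G k l = invmx G l k by rewrite -[in LHS]GT -trmx_inv mxE.
  by move: (2^-1 : R) => h; ring.
rewrite bilZl; congr (_ * _).
rewrite [LHS]/bil mulmxKV// mxE.
under eq_bigr => l _ do rewrite !mxE mulr_suml.
transitivity (\sum_l \sum_i \sum_j
  (v 0 i * w 0 j * z 0 l * ('D_(delta_mx 0 i) (gram g c) x) j l +
  (v 0 i * w 0 j * z 0 l * ('D_(delta_mx 0 j) (gram g c) x) i l -
   v 0 i * w 0 j * z 0 l * ('D_(delta_mx 0 l) (gram g c) x) i j))).
  apply: eq_bigr => l _; apply: eq_bigr => i _; rewrite mulr_suml.
  by apply: eq_bigr => j _; ring.
have D (a b d : 'rV[R]_3) : bil ('D_a (gram g c) x) b d = \sum_m \sum_i \sum_j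
    a 0 m * b 0 i * d 0 j * ('D_(delta_mx 0 m) (gram g c) x) i j.
  rewrite bilE derive_gram// exchange_big/=.
  under eq_bigr => j _ do under eq_bigr => i _ do
    rewrite summxE mulr_sumr mulr_suml.
  rewrite exchange_big/=; under eq_bigr do rewrite exchange_big/=.
  rewrite exchange_big/=; apply: eq_bigr => m _; apply: eq_bigr => i _.
  by apply: eq_bigr => j _; rewrite mxE; ring.
under eq_bigr do under eq_bigr do rewrite big_split/=.
under eq_bigr do rewrite big_split/=.
rewrite big_split/= -addrA; congr (_ + _).
  rewrite D; rewrite exchange_big/=; apply: eq_bigr => i _.
  by rewrite exchange_big/=; apply: eq_bigr => j _; apply: eq_bigr => l _; ring.
under eq_bigr do under eq_bigr do rewrite big_split/=.
under eq_bigr do rewrite big_split/=.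
rewrite big_split/=; congr (_ + _).
  rewrite D; rewrite exchange_big/= [RHS]exchange_big/=; apply: eq_bigr => i _.
  by rewrite exchange_big/=; apply: eq_bigr => j _; apply: eq_bigr => l _; ring.
rewrite D -sumrN; apply: eq_bigr => l _; rewrite -sumrN; apply: eq_bigr => i _.
by rewrite -sumrN; apply: eq_bigr => j _; ring.
Qed.

End ChartGeometry.

(** * Change of chart *)

(** When the metric is pulled back by a map of derivative T and second
    derivative beta, each derivative of the metric acquires two terms in beta.
    In the Koszul combination they cancel in pairs, except for the two that
    pair beta v w with T z. Only the Leibniz rule and the symmetries matter
    here, whence the abstract form. *)
Lemma koszul_algebra {R : realType} (V W : Type) (PG : V -> V -> V -> R)
    (PH : W -> W -> W -> R) (Q : W -> W -> R) (beta : V -> V -> W) (T : V -> W) :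
  (forall u a b, PG u a b =
     Q (beta u a) (T b) + PH (T u) (T a) (T b) + Q (T a) (beta u b)) ->
  (forall a b, Q a b = Q b a) -> (forall u v, beta u v = beta v u) ->
  forall v w z, 2^-1 * (PG v w z + PG w v z - PG z v w) =
    2^-1 * (PH (T v) (T w) (T z) + PH (T w) (T v) (T z) - PH (T z) (T v) (T w)) +
    Q (beta v w) (T z).
Proof.
move=> PGE Qs bs v w z; rewrite !PGE (bs w v) (bs z v) (bs z w).
rewrite (Qs (T w) (beta v z)) (Qs (T v) (beta w z)); by field.
Qed.

Section ChartChange.
Context {R : realType} {M : oriented_manifold3 R} {r : smoothness}.
Variable g : lorentz_metric M r.
Hypothesis hr : at_least 4 r.
Variables c c' : chart M.

Let O := coord c @` (dom c `&` dom c').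
Let tau := coord c' \o param c.

Lemma overlap_dom x : O x -> (coord c @` dom c) x /\ (coord c' @` dom c') (tau x).
Proof.
move=> [p [cp c'p] <-]; split; first by exists p.
by exists p => //; rewrite /tau/= coordK.
Qed.

Lemma overlap_open : open O.
Proof.
rewrite openE => x [p [cp c'p] <-].
have cx : (coord c @` dom c) (coord c p) by exists p.
have n1 : \forall y \near coord c p, (coord c @` dom c) y.
  exact: near_open (@coord_open R M c) cx (fun y h => h).
have n2 : \forall y \near coord c p, dom c' (param c y).
  apply: (param_continuous cx); rewrite coordK//.
  exact: near_open (@dom_open R M c') c'p (fun y h => h).
apply: filterS2 n1 n2 => y [q cq <-]; rewrite coordK// => c'q.
by exists q.
Qed.

Lemma transition_Ck k : Ck k O tau.
Proof. by have [+ _] := transition_analytic c c'; exact. Qed.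

Lemma transition_diff x : O x -> differentiable tau x.
Proof. by move=> Ox; exact: (Ck_differentiable (transition_Ck 1)). Qed.

Lemma transition_jacobian x v : O x -> 'D_v tau x = v *m 'J tau x.
Proof. by move=> Ox; rewrite deriveEjacobian//; exact: transition_diff. Qed.

Lemma jacobian_unit x : O x -> 'J tau x \in unitmx.
Proof.
by move=> Ox; rewrite unitmxE unitfE gt_eqF//; exact: transition_oriented.
Qed.

Lemma jacobian_C1 : Ck 1 O (jacobian tau).
Proof.
apply/(Ck_mxP _ _ overlap_open) => i j.
have := Ck_derive (delta_mx 0 i) (transition_Ck 2).
move=> /(Ck_mxP _ _ overlap_open)/(_ 0 j).
apply: Ck_ext overlap_open _ => x Ox.
by rewrite transition_jacobian// -rowE mxE.
Qed.

Lemma jacobian_diff x : O x -> differentiable (jacobian tau) x.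
Proof. by move=> Ox; exact: (Ck_differentiable jacobian_C1). Qed.

Lemma transition_derive2 x v w : O x ->
  'D_v ('D_w tau) x = w *m 'D_v (jacobian tau) x.
Proof.
move=> Ox.
have -> : 'D_v ('D_w tau) x = 'D_v (fun y => w *m 'J tau y) x.
  apply: near_eq_derive; apply: near_open overlap_open Ox _ => y Oy.
  exact: transition_jacobian.
have [_ ->] := is_derive_mulmx (is_derive_cst w x v) (diff_is_derive v (jacobian_diff Ox)).
by rewrite mul0mx add0r.
Qed.

Lemma metric_change x v w : O x ->
  metric g c x v w = metric g c' (tau x) (v *m 'J tau x) (w *m 'J tau x).
Proof.
by move=> Ox; rewrite !metricE (gram_transition g Ox) bil_mulmx.
Qed.

(** The Leibniz rule applied to the transformation rule of the metric. *)
Lemma koszul_change x v w z : O x ->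
  koszul g c x v w z =
  koszul g c' (tau x) (v *m 'J tau x) (w *m 'J tau x) (z *m 'J tau x) +
  metric g c' (tau x) ('D_v ('D_w tau) x) (z *m 'J tau x).
Proof.
move=> Ox; have [cx c'x] := overlap_dom Ox.
pose H := gram g c'; pose J := jacobian tau.
have HT : (H (tau x))^T = H (tau x) by exact: gram_sym.
have D u : 'D_u (gram g c) x =
    'D_u J x *m H (tau x) *m (J x)^T +
    J x *m 'D_(u *m J x) H (tau x) *m (J x)^T +
    J x *m H (tau x) *m ('D_u J x)^T.
  have dH : differentiable H (tau x) by exact: (Ck_differentiable (gram_C4 g hr c')).
  have dt := transition_diff Ox.
  have -> : 'D_u (gram g c) x = 'D_u (fun y => J y *m (H \o tau) y *m (J y)^T) x.
    apply: near_eq_derive; apply: near_open overlap_open Ox _ => y Oy.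
    by rewrite [LHS](gram_transition g Oy).
  have dJ := diff_is_derive u (jacobian_diff Ox).
  have dHt := diff_is_derive u (differentiable_comp dt dH).
  have [_ ->] := is_derive_mulmx (is_derive_mulmx dJ dHt) (is_derive_trmx dJ).
  by rewrite derive_comp// transition_jacobian// !mulmxDl.
have B u a b : bil ('D_u (gram g c) x) a b =
    bil (H (tau x)) (a *m 'D_u J x) (b *m J x) +
    bil ('D_(u *m J x) H (tau x)) (a *m J x) (b *m J x) +
    bil (H (tau x)) (a *m J x) (b *m 'D_u J x).
  by rewrite D /bil !mulmxDr !mulmxDl !trmx_mul !mulmxA 2!mxE.
have sym a b : 'D_a ('D_b tau) x = 'D_b ('D_a tau) x.
  exact: derive_sym overlap_open Ox (transition_Ck 2).
apply: (@koszul_algebra R _ _ (fun u a b => bil ('D_u (gram g c) x) a b)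
  (fun u a b => bil ('D_u H (tau x)) a b) (fun a b => bil (H (tau x)) a b)
  (fun a b => 'D_a ('D_b tau) x) (fun v => v *m 'J tau x)) => //.
- by move=> u a b; rewrite B !transition_derive2.
- by move=> a b; exact: bilC.
Qed.

(** Both sides have the same product with every tangent vector, by the
    transformation rule of the Koszul expression. *)
Lemma gamma_change x v w : O x ->
  gamma g c x v w *m 'J tau x =
  gamma g c' (tau x) (v *m 'J tau x) (w *m 'J tau x) + 'D_v ('D_w tau) x.
Proof.
move=> Ox; have [cx c'x] := overlap_dom Ox.
apply: (bil_nondeg (gram_unit g c'x)) => z.
have -> : z = z *m invmx ('J tau x) *m 'J tau x by rewrite mulmxKV// jacobian_unit.
move: (z *m _) => {}z.
rewrite bilDl -!metricE -metric_change// !gamma_koszul//.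
exact: koszul_change.
Qed.

(** The square root of the determinant of the metric contributes the absolute
    value of the Jacobian, which is the Jacobian in an oriented atlas. *)
Lemma volume_change x v1 v2 v3 : O x ->
  volume g c x v1 v2 v3 =
  volume g c' (tau x) (v1 *m 'J tau x) (v2 *m 'J tau x) (v3 *m 'J tau x).
Proof.
move=> Ox; rewrite /volume (gram_transition g Ox) !det_mulmx det_tr.
have J0 := transition_oriented Ox.
have -> : (\matrix_(i < 3) nth 0 [:: v1 *m 'J tau x; v2 *m 'J tau x; v3 *m 'J tau x] i)
   = (\matrix_(i < 3) nth 0 [:: v1; v2; v3] i) *m 'J tau x.
  apply/row_matrixP => i; rewrite row_mul !rowK.
  by case: i => -[|[|[|[]]]].
rewrite det_mulmx -/tau mulrAC -expr2 normrM sqrtrM// normrX sqrtr_sqr normr_id.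
rewrite (gtr0_norm J0); ring.
Qed.

End ChartChange.

Section CovariantDerivative.
Context {R : realType} {M : oriented_manifold3 R} {r : smoothness}.
Variable g : lorentz_metric M r.
Hypothesis hr : at_least 4 r.
Context {V : normedModType R}.

(** The covariant derivative D_a D_b f read in the chart c, for constant
    directions a and b; [DF_] and [acceleration] are instances of it. *)
Definition cov (c : chart M) (f : V -> M) (a b : V) (u : V) : 'rV[R]_3 :=
  'D_a ('D_b (coord c \o f)) u +
  gamma g c (coord c (f u)) ('D_a (coord c \o f) u) ('D_b (coord c \o f) u).

Variables (A : set V) (f : V -> M) (c c' : chart M).
Hypothesis oA : open A.
Hypothesis (cA : forall u, A u -> dom c (f u)).
Hypothesis (c'A : forall u, A u -> dom c' (f u)).
Hypothesis Cf : Ck 2 A (coord c \o f).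

Let tau := coord c' \o param c.

Lemma chart_overlap u : A u -> (coord c @` (dom c `&` dom c')) (coord c (f u)).
Proof. by move=> Au; exists (f u) => //; split; [exact: cA|exact: c'A]. Qed.

Lemma tau_coord u : A u -> tau (coord c (f u)) = coord c' (f u).
Proof. by move=> Au; rewrite /tau/= coordK//; exact: cA. Qed.

Lemma derive_change u a : A u ->
  'D_a (coord c' \o f) u = 'D_a (coord c \o f) u *m 'J tau (coord c (f u)).
Proof.
move=> Au; have Ou := chart_overlap Au.
rewrite -transition_jacobian// -derive_comp.
- apply: near_eq_derive; apply: near_open oA Au _ => y Ay.
  exact: esym (tau_coord Ay).
- exact: (Ck_differentiable Cf).
- exact: transition_diff.
Qed.

(** The second derivative of the transition map, produced by the chain rule,
    is the one in the transformation rule of gamma: the covariant derivative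
    is a tangent vector. *)
Lemma cov_change u a b : A u ->
  cov c' f a b u = cov c f a b u *m 'J tau (coord c (f u)).
Proof.
move=> Au; have Ou := chart_overlap Au.
have E : 'D_a ('D_b (coord c' \o f)) u =
    'D_a ('D_b (coord c \o f)) u *m 'J tau (coord c (f u)) +
    'D_b (coord c \o f) u *m 'D_('D_a (coord c \o f) u) (jacobian tau) (coord c (f u)).
  have -> : 'D_a ('D_b (coord c' \o f)) u =
      'D_a (fun y => 'D_b (coord c \o f) y *m (jacobian tau \o (coord c \o f)) y) u.
    apply: near_eq_derive; apply: near_open oA Au _ => y Ay.
    exact: derive_change.
  have dx : differentiable (coord c \o f) u by exact: (Ck_differentiable Cf).
  have dJ := @jacobian_diff _ _ c c' _ Ou.
  have [_ ->] := is_derive_mulmx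
    (diff_is_derive a (Ck_differentiable (Ck_derive b Cf) Au))
    (diff_is_derive a (differentiable_comp dx dJ)).
  by rewrite derive_comp.
rewrite /cov E mulmxDl (gamma_change g hr _ _ Ou) (transition_derive2 _ _ Ou).
rewrite (derive_change a Au) (derive_change b Au) -(tau_coord Au).
by rewrite -!addrA; congr (_ + _); exact: addrC.
Qed.

End CovariantDerivative.

(** * Determinants of order two and three *)

Section SmallMatrices.
Context {R : realType}.

Lemma sum_ord3 (F : 'I_3 -> R) :
  \sum_(i < 3) F i = F (inord 0) + F (inord 1) + F (inord 2).
Proof.
rewrite !big_ord_recl big_ord0 addr0 addrA.
by congr (_ + _ + _); congr (F _); apply/val_inj; rewrite /= inordK.
Qed.

Lemma ord2_or (i j k : 'I_2) : i != j -> k = i \/ k = j.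
Proof.
move=> ij; case: (eqVneq k i) => [|ki]; [by left|right].
by move: ij ki; case: i j k => [[|[|[]]]//?] [[|[|[]]]//?] [[|[|[]]]//?];
  rewrite -?val_eqE// => _ _; exact/val_inj.
Qed.

Lemma sum_ord2 {V : nmodType} (i j : 'I_2) (F : 'I_2 -> V) : i != j ->
  \sum_(k < 2) F k = F i + F j.
Proof.
move=> ij; rewrite (bigD1 i)//= (bigD1 j)/=; last by rewrite eq_sym.
rewrite big1 ?addr0// => k /andP[ki kj].
by case: i j k ij ki kj => [[|[|[]]]//?] [[|[|[]]]//?] [[|[|[]]]//?].
Qed.

(** A function on nat is expanded, so that the indices on the right are
    numerals rather than ordinals. *)
Lemma det3E (f : nat -> nat -> R) :
  \det (\matrix_(i < 3, j < 3) f i j) =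
  f 0%N 0%N * (f 1%N 1%N * f 2%N 2%N - f 1%N 2%N * f 2%N 1%N)
  - f 0%N 1%N * (f 1%N 0%N * f 2%N 2%N - f 1%N 2%N * f 2%N 0%N)
  + f 0%N 2%N * (f 1%N 0%N * f 2%N 1%N - f 1%N 1%N * f 2%N 0%N).
Proof.
rewrite (expand_det_row _ ord0) !big_ord_recl big_ord0 /cofactor.
rewrite !(expand_det_row _ ord0) !big_ord_recl !big_ord0 /cofactor !det_mx11 !mxE /=.
rewrite /bump /= !addn0 !add0n /=.
rewrite !(addn1,addn0,add1n) /= ?expr0 ?expr1 ?expr2; ring.
Qed.

Definition det3 (v1 v2 v3 : 'rV[R]_3) : R :=
  \det (\matrix_(i < 3) nth 0 [:: v1; v2; v3] i).

Lemma det3_coord v1 v2 v3 (p := fun v : 'rV[R]_3 => fun k => v 0 (inord k)) :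
  det3 v1 v2 v3 =
  p v1 0%N * (p v2 1%N * p v3 2%N - p v2 2%N * p v3 1%N)
  - p v1 1%N * (p v2 0%N * p v3 2%N - p v2 2%N * p v3 0%N)
  + p v1 2%N * (p v2 0%N * p v3 1%N - p v2 1%N * p v3 0%N).
Proof.
rewrite -(det3E (fun i k => p (nth 0 [:: v1; v2; v3] i) k)).
by congr (\det _); apply/matrixP => i k; rewrite !mxE /p inord_val.
Qed.

Lemma det3_delta v1 v2 w :
  det3 v1 v2 w = \sum_k w 0 k * det3 v1 v2 (delta_mx 0 k).
Proof.
have e k l : (k < 3)%N -> (l < 3)%N ->
    (delta_mx 0 (inord k) : 'rV[R]_3) 0 (inord l) = (k == l)%:R.
  by move=> k3 l3; rewrite mxE eqxx/= -val_eqE/= !inordK// eq_sym.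
rewrite sum_ord3 !det3_coord !e//=; ring.
Qed.

(** The product of the determinants of two triples and of the Gram matrix is
    the determinant of their mutual products. *)
Lemma det3_gram (G : 'M[R]_3) v1 v2 v3 w1 w2 w3 (b := bil G) :
  \det G * det3 v1 v2 v3 * det3 w1 w2 w3 =
  b v1 w1 * (b v2 w2 * b v3 w3 - b v2 w3 * b v3 w2)
  - b v1 w2 * (b v2 w1 * b v3 w3 - b v2 w3 * b v3 w1)
  + b v1 w3 * (b v2 w1 * b v3 w2 - b v2 w2 * b v3 w1).
Proof.
rewrite -(det3E (fun i k => b (nth 0 [:: v1; v2; v3] i) (nth 0 [:: w1; w2; w3] k))).
rewrite /det3.
set P := \matrix_(i < 3) nth 0 [:: v1; v2; v3] i.
set Q := \matrix_(i < 3) nth 0 [:: w1; w2; w3] i.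
transitivity (\det (P *m G *m Q^T)); first by rewrite !det_mulmx det_tr; ring.
congr (\det _); apply/matrixP => i k.
rewrite -[LHS]/((P *m G *m Q^T) i k) !mxE /b /bil !mxE.
apply: eq_bigr => l _; rewrite !mxE; congr (_ * _).
by apply: eq_bigr => m _; rewrite !mxE.
Qed.

Lemma det2E (A : 'M[R]_2) (i j : 'I_2) : i != j ->
  \det A = A i i * A j j - A i j * A j i.
Proof.
have E : \det A = A ord0 ord0 * A ord_max ord_max - A ord0 ord_max * A ord_max ord0.
  rewrite (expand_det_row _ ord0) !big_ord_recl big_ord0 /cofactor !det_mx11 !mxE /=.
  have -> : lift ord0 ord0 = ord_max :> 'I_2 by apply/val_inj.
  have -> : lift ord_max ord0 = ord0 :> 'I_2 by apply/val_inj.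
  by rewrite !(addn0, add0n, expr0, expr1); ring.
case: (unliftP ord0 i) => [i'|] ->; case: (unliftP ord0 j) => [j'|] -> //;
  rewrite ?(ord1 i') ?(ord1 j').
- by rewrite eqxx.
- by move=> _; rewrite E (_ : lift ord0 0 = ord_max); [ring|exact/val_inj].
- by move=> _; rewrite E (_ : lift ord0 0 = ord_max); [ring|exact/val_inj].
Qed.

Lemma cofactor2 (A : 'M[R]_2) (i j : 'I_2) : i != j ->
  [/\ cofactor A i i = A j j, cofactor A i j = - A j i,
      cofactor A j i = - A i j & cofactor A j j = A i i].
Proof.
have l1 : lift ord0 ord0 = ord_max :> 'I_2 by apply/val_inj.
have l2 : lift ord_max ord0 = ord0 :> 'I_2 by apply/val_inj.
have E1 : cofactor A ord0 ord0 = A ord_max ord_max.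
  by rewrite /cofactor det_mx11 !mxE l1 mul1r.
have E2 : cofactor A ord_max ord_max = A ord0 ord0.
  by rewrite /cofactor det_mx11 !mxE l2 /= expr2 mulrNN !mul1r.
have E3 : cofactor A ord0 ord_max = - A ord_max ord0.
  by rewrite /cofactor det_mx11 !mxE l1 l2 /= expr1 mulN1r.
have E4 : cofactor A ord_max ord0 = - A ord0 ord_max.
  by rewrite /cofactor det_mx11 !mxE l1 l2 /= expr1 mulN1r.
have m : lift ord0 0 = ord_max :> 'I_2 by exact/val_inj.
case: (unliftP ord0 i) => [i'|] ->; case: (unliftP ord0 j) => [j'|] -> //;
  rewrite ?(ord1 i') ?(ord1 j') ?m ?eqxx//.
Qed.

End SmallMatrices.

(** * The first and second derivatives of a surface *)

Section CkMatrix.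
Context {R : realType} {V : normedModType R}.

Lemma Ck_bil {n} k (A : set V) (G : V -> 'M[R]_n) (v w : V -> 'rV[R]_n) : open A ->
  Ck k A G -> Ck k A v -> Ck k A w ->
  Ck k A (fun x => bil (G x) (v x) (w x) : R^o).
Proof.
move=> oA /(Ck_mxP _ _ oA) CG /(Ck_mxP _ _ oA) Cv /(Ck_mxP _ _ oA) Cw.
apply: (@Ck_ext _ _ _ k A (fun x => \sum_i \sum_j v x 0 i * G x i j * w x 0 j : R^o)) => //.
  by move=> x _; rewrite bilE.
apply: Ck_sum => // i; apply: Ck_sum => // j; apply: Ck_mul => //.
exact: Ck_mul.
Qed.

Lemma Ck_derive_dir {n p} k (A : set V) (B : set 'rV[R]_n) (x v : V -> 'rV[R]_n)
    (f : 'rV[R]_n -> 'M[R]_(p, p)) : open A -> open B -> (forall u, A u -> B (x u)) ->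
  Ck k A x -> Ck k A v -> Ck k.+1 B f -> Ck k A (fun u => 'D_(v u) f (x u)).
Proof.
move=> oA oB AB Cx Cv Cf.
have E u : A u -> \sum_m v u 0 m *: 'D_(delta_mx 0 m) f (x u) = 'D_(v u) f (x u).
  by move=> Au; rewrite [RHS]derive_dir//; exact/(Ck_differentiable Cf)/AB.
apply: (Ck_ext oA E); apply/(Ck_mxP _ _ oA) => i j.
apply: (@Ck_ext _ _ _ k A (fun u =>
    \sum_m v u 0 m * ('D_(delta_mx 0 m) f (x u)) i j : R^o)) => //.
  by move=> u _; rewrite summxE; apply: eq_bigr => m _; rewrite mxE.
apply: Ck_sum => // m; apply: Ck_mul => //.
  by move/(Ck_mxP _ _ oA) : Cv; exact.
have /(Ck_mxP _ _ oA) := Ck_comp_mx oA oB AB Cx (Ck_derive (delta_mx 0 m) Cf).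
exact.
Qed.

End CkMatrix.

Section Surface.
Context {R : realType} {M : oriented_manifold3 R} {r : smoothness}.
Variable g : lorentz_metric M r.
Hypothesis hr : at_least 4 r.
Variables (F : 'rV[R]_2 -> M) (W : set 'rV[R]_2).
Hypotheses (oW : open W) (CF : Ck_map 4 W F).

Definition in_chart (c : chart M) : set 'rV[R]_2 := W `&` F @^-1` dom c.

Definition frame (c : chart M) (k : 'I_2) : 'rV[R]_2 -> 'rV[R]_3 :=
  'D_(basis_vec k) (coord c \o F).

Definition D2F (c : chart M) (k l : 'I_2) : 'rV[R]_2 -> 'rV[R]_3 :=
  cov g c F (basis_vec k) (basis_vec l).

Lemma in_chart_open c : open (in_chart c).
Proof.
rewrite openE => u [Wu cu]; apply: filterI; first exact: near_open oW Wu (fun y h => h).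
by apply: (CF.1 _ Wu); exact: near_open (@dom_open R M c) cu (fun y h => h).
Qed.

Lemma in_chart_coord c u : in_chart c u -> (coord c @` dom c) (coord c (F u)).
Proof. by move=> [_ cu]; exists (F u). Qed.

Lemma coordF_Ck c : Ck 4 (in_chart c) (coord c \o F).
Proof. exact: CF.2. Qed.

Lemma frame_Ck c k : Ck 3 (in_chart c) (frame c k).
Proof. exact: Ck_derive (coordF_Ck c). Qed.

Lemma gramF_Ck c : Ck 4 (in_chart c) (gram g c \o (coord c \o F)).
Proof.
exact: Ck_comp_mx (@in_chart_open c) (@coord_open R M c) (@in_chart_coord c)
  (coordF_Ck c) (gram_C4 g hr c).
Qed.

Section TwoCharts.
Variables c c' : chart M.
Let A := in_chart c `&` in_chart c'.
Let oA : open A. Proof. by apply: openI; exact: in_chart_open. Qed.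
Let cA u : A u -> dom c (F u). Proof. by move=> [[]]. Qed.
Let c'A u : A u -> dom c' (F u). Proof. by move=> [_ []]. Qed.
Let CA : Ck 2 A (coord c \o F).
Proof. by apply: (@Ck_restrict _ _ _ 2 (in_chart c)) => [u []//|]; exact: Ck_le (coordF_Ck c). Qed.

Lemma frame_change k u : A u ->
  frame c' k u = frame c k u *m 'J (coord c' \o param c) (coord c (F u)).
Proof. exact: (derive_change oA cA c'A CA). Qed.

Lemma D2F_change k l u : A u ->
  D2F c' k l u = D2F c k l u *m 'J (coord c' \o param c) (coord c (F u)).
Proof. exact: (cov_change g hr oA cA c'A CA). Qed.

Lemma coordF_change u : A u ->
  (coord c' \o param c) (coord c (F u)) = coord c' (F u).
Proof. exact: (tau_coord c' cA). Qed.

Lemma coordF_overlap u : A u -> (coord c @` (dom c `&` dom c')) (coord c (F u)).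
Proof. exact: (chart_overlap cA c'A). Qed.

End TwoCharts.

Lemma in_base_chart u : W u -> in_chart (base_chart F u) u.
Proof. by move=> Wu; split => //; exact: dom_chart_at. Qed.

(** The first fundamental form is defined in a chart that depends on the
    point; derivatives require a fixed chart. *)
Lemma S_F_chart c u k l : in_chart c u ->
  S_F g F u k l = metric g c (coord c (F u)) (frame c k u) (frame c l u).
Proof.
move=> cu; have bu := in_base_chart cu.1.
have Au : (in_chart c `&` in_chart (base_chart F u)) u by [].
rewrite mxE (metric_change g _ _ (coordF_overlap Au)).
by rewrite (coordF_change Au) -!(frame_change _ Au).
Qed.

Lemma S_F_sym u k l : W u -> S_F g F u k l = S_F g F u l k.
Proof.
move=> Wu; have bu := in_base_chart Wu.
rewrite (S_F_chart k l bu) (S_F_chart l k bu).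
exact: bilC (gram_sym g (in_chart_coord bu)).
Qed.

Lemma S_F_Ck c k l : Ck 3 (in_chart c) (fun u => S_F g F u k l : R^o).
Proof.
have E u : in_chart c u ->
    bil ((gram g c \o (coord c \o F)) u) (frame c k u) (frame c l u) = S_F g F u k l.
  by move=> cu; rewrite (S_F_chart _ _ cu).
apply: (Ck_ext (@in_chart_open c) E); apply: Ck_bil; try exact: frame_Ck.
  exact: in_chart_open.
exact: Ck_le (gramF_Ck c).
Qed.

Lemma derive_gram_sym c x v : (coord c @` dom c) x ->
  ('D_v (gram g c) x)^T = 'D_v (gram g c) x.
Proof.
move=> cx; have dG := Ck_differentiable (gram_C4 g hr c) cx.
have [_ <-] := is_derive_trmx (diff_is_derive v dG).
apply: near_eq_derive; apply: near_open (@coord_open R M c) cx _ => y cy.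
exact: gram_sym.
Qed.

Lemma koszul_sym c x v w z : (coord c @` dom c) x ->
  koszul g c x v w z = koszul g c x w v z.
Proof.
move=> cx.
have alg (a b p q : R) : p = q -> 2^-1 * (a + b - p) = 2^-1 * (b + a - q).
  by move=> ->; rewrite (addrC a).
exact: alg (bilC v w (derive_gram_sym z cx)).
Qed.

Lemma gamma_sym c x v w : (coord c @` dom c) x -> gamma g c x v w = gamma g c x w v.
Proof.
move=> cx; apply: (bil_nondeg (gram_unit g cx)) => z.
exact: etrans (gamma_koszul g hr v w z cx)
  (etrans (koszul_sym v w z cx) (esym (gamma_koszul g hr w v z cx))).
Qed.

Lemma D2F_sym c k l u : in_chart c u -> D2F c k l u = D2F c l k u.
Proof.
move=> cu.
have C2 : Ck 2 (in_chart c) (coord c \o F) by exact: Ck_le (coordF_Ck c).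
have E := derive_sym (basis_vec k) (basis_vec l) (@in_chart_open c) cu C2.
have S := gamma_sym (frame c k u) (frame c l u) (in_chart_coord cu).
exact: congr2 E S.
Qed.

(** Compatibility of the connection with the metric: the antisymmetric terms
    cancel in the sum of the Koszul formulas for (u, v, w) and (u, w, v). *)
Lemma metric_gamma c x u v w : (coord c @` dom c) x ->
  metric g c x (gamma g c x u v) w + metric g c x v (gamma g c x u w) =
  bil ('D_u (gram g c) x) v w.
Proof.
move=> cx.
have alg (p p' s t : R) : p' = p -> 2^-1 * (p + s - t) + 2^-1 * (p' + t - s) = p.
  by move=> ->; field.
have E1 := gamma_koszul g hr u v w cx; have E2 := gamma_koszul g hr u w v cx.
have E3 := bilC v (gamma g c x u w) (gram_sym g cx).
apply: etrans (congr2 +%R E1 (etrans E3 E2)) _.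
exact: alg (bilC w v (derive_gram_sym u cx)).
Qed.

(** The Leibniz rule for g along F; the derivative of the Gram matrix is
    absorbed by the two connection terms. *)
Lemma derive_metric_frame c (v w : 'rV[R]_2 -> 'rV[R]_3) k u : in_chart c u ->
  differentiable v u -> differentiable w u ->
  is_derive u (basis_vec k) (fun y => metric g c (coord c (F y)) (v y) (w y))
   (metric g c (coord c (F u)) ('D_(basis_vec k) v u + gamma g c (coord c (F u)) (frame c k u) (v u)) (w u) +
    metric g c (coord c (F u)) (v u) ('D_(basis_vec k) w u + gamma g c (coord c (F u)) (frame c k u) (w u))).
Proof.
move=> cu dv dw; have cx := in_chart_coord cu.
have dx : differentiable (coord c \o F) u by exact: (Ck_differentiable (coordF_Ck c)).
have dG : differentiable (gram g c) ((coord c \o F) u).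
  exact: (Ck_differentiable (gram_C4 g hr c)).
have D := is_derive_coord 0 0 (is_derive_mulmx (is_derive_mulmx
  (diff_is_derive (basis_vec k) dv)
  (diff_is_derive (basis_vec k) (differentiable_comp dx dG)))
  (is_derive_trmx (diff_is_derive (basis_vec k) dw))).
apply: (is_derive_eq D); rewrite (derive_comp (basis_vec k) dx dG).
have leib (G H : 'M[R]_3) (p a q b : 'rV[R]_3) :
    ((a *m G + p *m H) *m q^T + p *m G *m b^T) 0 0 = bil G a q + bil H p q + bil G p b.
  by rewrite mulmxDl 2!mxE.
apply: etrans (leib (gram g c (coord c (F u)))
  ('D_(frame c k u) (gram g c) (coord c (F u))) (v u) ('D_(basis_vec k) v u)
  (w u) ('D_(basis_vec k) w u)) _.
have E := metric_gamma (frame c k u) (v u) (w u) cx.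
have alg (G : 'M[R]_3) (p a a' q b b' : 'rV[R]_3) (X : R) :
    bil G a' q + bil G p b' = X ->
    bil G a q + X + bil G p b = bil G (a + a') q + bil G p (b + b').
  by move=> <-; rewrite bilDl bilDr; ring.
exact: (@alg (gram g c (coord c (F u))) (v u) ('D_(basis_vec k) v u)
  (gamma g c (coord c (F u)) (frame c k u) (v u)) (w u) ('D_(basis_vec k) w u)
  (gamma g c (coord c (F u)) (frame c k u) (w u)) _ E).
Qed.

Lemma derive_S_F c k l m u : in_chart c u ->
  'D_(basis_vec k) (fun y => S_F g F y l m : R^o) u =
  metric g c (coord c (F u)) (D2F c k l u) (frame c m u) +
  metric g c (coord c (F u)) (frame c l u) (D2F c k m u).
Proof.
move=> cu.
have d n : differentiable (frame c n) u by exact: (Ck_differentiable (frame_Ck c n)).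
have [_ <-] := derive_metric_frame k cu (d l) (d m).
apply: near_eq_derive; apply: near_open (@in_chart_open c) cu _ => y cy.
exact: S_F_chart.
Qed.

(** The product with a vector is given by the Koszul formula, so that its
    regularity follows from that of the metric without differentiating the
    inverse Gram matrix. *)
Lemma D2F_metric_Ck c k l (w : 'rV[R]_2 -> 'rV[R]_3) : Ck 1 (in_chart c) w ->
  Ck 1 (in_chart c) (fun u => metric g c (coord c (F u)) (D2F c k l u) (w u) : R^o).
Proof.
move=> Cw; have oA := @in_chart_open c.
have E u : in_chart c u ->
    bil ((gram g c \o (coord c \o F)) u) ('D_(basis_vec k) (frame c l) u) (w u) +
    2^-1 * (bil ('D_(frame c k u) (gram g c) ((coord c \o F) u)) (frame c l u) (w u)
     + bil ('D_(frame c l u) (gram g c) ((coord c \o F) u)) (frame c k u) (w u)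
     - bil ('D_(w u) (gram g c) ((coord c \o F) u)) (frame c k u) (frame c l u)) =
    metric g c (coord c (F u)) (D2F c k l u) (w u).
  move=> cu; rewrite /D2F /cov metricE bilDl; congr (_ + _).
  by rewrite -metricE (gamma_koszul g hr) => [//|]; exact: in_chart_coord.
have CG := gramF_Ck c; have C1 n : Ck 1 (in_chart c) (frame c n).
  exact: Ck_le (frame_Ck c n).
have Cd (v : 'rV[R]_2 -> 'rV[R]_3) : Ck 1 (in_chart c) v ->
    Ck 1 (in_chart c) (fun u => 'D_(v u) (gram g c) ((coord c \o F) u)).
  move=> Cv.
  have Cx : Ck 1 (in_chart c) (coord c \o F) by exact: Ck_le (coordF_Ck c).
  have Cg : Ck 2 (coord c @` dom c) (gram g c) by exact: Ck_le (gram_C4 g hr c).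
  exact: (@Ck_derive_dir R _ 3 3 1 (in_chart c) (coord c @` dom c) (coord c \o F)
    v (gram g c) oA (@coord_open R M c) (@in_chart_coord c) Cx Cv Cg).
have CGx : Ck 1 (in_chart c) (gram g c \o (coord c \o F)) by exact: Ck_le CG.
have Cll : Ck 1 (in_chart c) ('D_(basis_vec k) (frame c l)).
  exact: Ck_le (Ck_derive (basis_vec k) (frame_Ck c l)).
have t0 := Ck_bil oA CGx Cll Cw.
have t1 := Ck_bil oA (Cd _ (C1 k)) (C1 l) Cw.
have t2 := Ck_bil oA (Cd _ (C1 l)) (C1 k) Cw.
have t3 := Ck_bil oA (Cd _ Cw) (C1 k) (C1 l).
have t4 := Ck_sub oA (Ck_add oA t1 t2) t3.
have t5 := Ck_mul oA (@Ck_cst _ _ _ 1 (in_chart c) (2^-1 : R^o)) t4.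
exact: (Ck_ext oA E (Ck_add oA t0 t5)).
Qed.

Lemma metric_frame_Ck c k (w : 'rV[R]_2 -> 'rV[R]_3) : Ck 3 (in_chart c) w ->
  Ck 3 (in_chart c) (fun u => metric g c (coord c (F u)) (frame c k u) (w u) : R^o).
Proof.
move=> Cw; have CG : Ck 3 (in_chart c) (gram g c \o (coord c \o F)).
  exact: Ck_le (gramF_Ck c).
exact: (Ck_bil (@in_chart_open c) CG (frame_Ck c k) Cw).
Qed.

Lemma volumeE c x v1 v2 v3 :
  volume g c x v1 v2 v3 = Num.sqrt `|\det (gram g c x)| * det3 v1 v2 v3.
Proof. by []. Qed.

(** The volume is linear in its last argument and g is nondegenerate, so the
    defining equation of the normal field has a solution. *)
Lemma nu_tildeP u w : W u ->
  metric g (base_chart F u) (base_point F u) (nu_tilde g F u) w =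
  volume g (base_chart F u) (base_point F u) (F_ F 0 u) (F_ F 1 u) w.
Proof.
move=> Wu; have cx := in_chart_coord (in_base_chart Wu).
pose a : 'rV[R]_3 := \row_k volume g (base_chart F u) (base_point F u)
  (F_ F 0 u) (F_ F 1 u) (delta_mx 0 k).
suff [n nP] : exists n : 'rV[R]_3, forall w, metric g (base_chart F u) (base_point F u) n w =
    volume g (base_chart F u) (base_point F u) (F_ F 0 u) (F_ F 1 u) w.
  move: w; rewrite /nu_tilde.
  by apply: (@xgetPex _ 0 [set n | forall w, _ n w = _ w]); exists n.
exists (a *m invmx (gram g (base_chart F u) (base_point F u))) => z.
rewrite /metric mulmxKV; last exact: gram_unit.
rewrite mxE volumeE det3_delta mulr_sumr; apply: eq_bigr => k _.
by rewrite !mxE volumeE; ring.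
Qed.

(** The product with the normal field is a volume, and volumes may be computed
    in any chart. *)
Lemma h_tilde_volume c k l u : in_chart c u ->
  h_tilde g F k l u =
  volume g c (coord c (F u)) (frame c 0 u) (frame c 1 u) (D2F c k l u).
Proof.
move=> cu; have bu := in_base_chart cu.1.
have Au : (in_chart c `&` in_chart (base_chart F u)) u by [].
rewrite /h_tilde metricE bilC; last exact: gram_sym (in_chart_coord bu).
rewrite -metricE nu_tildeP; last exact: cu.1.
rewrite (volume_change g _ _ _ (coordF_overlap Au)).
by rewrite (coordF_change Au) -!(frame_change _ Au) -(D2F_change _ _ Au).
Qed.

End Surface.

(** * A Gram determinant identity *)

Section GramIdentity.
Context {R : realType}.
Variables (G : 'M[R]_3) (v1 v2 w : 'rV[R]_3) (a b d wi wj ww B : R).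
Hypotheses (GT : G^T = G) (E11 : bil G v1 v1 = a) (E12 : bil G v1 v2 = b)
  (E22 : bil G v2 v2 = d) (E1w : bil G v1 w = wi) (E2w : bil G v2 w = wj)
  (Eww : bil G w w = ww) (EB : B = a * d - b * b).

(** With v1, v2 spanning the plane and v = d v1 - b v2 orthogonal to v2, the
    left-hand side is g(z, v) g(v, w). The identity is the expansion of the
    Gram determinant of the triples (v1, v2, z) and (v1, v2, w); where B = 0
    it expresses g(z, v) by the volume of (v1, v2, z), provided that v is not
    orthogonal to w. *)
Lemma gram_identity z zi zj zw :
  bil G z v1 = zi -> bil G z v2 = zj -> bil G z w = zw ->
  (d * zi - b * zj) * (d * wi - b * wj) =
  B * (d * zw - wj * zj) - d * (\det G * det3 v1 v2 z * det3 v1 v2 w).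
Proof.
move=> <- <- <-; rewrite det3_gram (bilC v2 v1 GT) E11 E12 E22 E1w E2w EB; ring.
Qed.

(** The case where both triples are (v1, v2, w). *)
Lemma gram_identity_sq :
  \det G * det3 v1 v2 w * det3 v1 v2 w =
  B * ww - (a * (wj * wj) - 2 * b * (wi * wj) + d * (wi * wi)).
Proof.
rewrite det3_gram (bilC v2 v1 GT) (bilC w v1 GT) (bilC w v2 GT).
by rewrite E11 E12 E22 E1w E2w Eww EB; ring.
Qed.

End GramIdentity.

Lemma det3_comb {R : realType} (v1 v2 z1 z2 z2' z3 : 'rV[R]_3) (a1 a2 a3 : R) :
  det3 v1 v2 (a1 *: z1 - a2 *: (z2 + z2') + a3 *: z3) =
  a1 * det3 v1 v2 z1 - a2 * (det3 v1 v2 z2 + det3 v1 v2 z2') + a3 * det3 v1 v2 z3.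
Proof. by rewrite !det3_coord !mxE; ring. Qed.

Lemma det3_swap {R : realType} (v1 v2 z : 'rV[R]_3) : det3 v1 v2 z = - det3 v2 v1 z.
Proof. by rewrite !det3_coord; ring. Qed.

Lemma norm_det3_ord2 {R : realType} (v : 'I_2 -> 'rV[R]_3) z (i j : 'I_2) : i != j ->
  `|det3 (v i) (v j) z| = `|det3 (v 0) (v 1) z|.
Proof.
have l1 : lift ord0 0 = 1 :> 'I_2 by exact/val_inj.
case: (unliftP ord0 i) => [i'|] ->; case: (unliftP ord0 j) => [j'|] ->;
  rewrite ?(ord1 i') ?(ord1 j') ?l1 ?eqxx// => _.
by rewrite det3_swap normrN.
Qed.

Lemma bil_comb {R : realType} (G : 'M[R]_3) z1 z2 z2' z3 w (a1 a2 a3 : R) :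
  bil G (a1 *: z1 - a2 *: (z2 + z2') + a3 *: z3) w =
  a1 * bil G z1 w - a2 * (bil G z2 w + bil G z2' w) + a3 * bil G z3 w.
Proof. by rewrite -scaleNr !(bilDl, bilZl) mulNr. Qed.

Lemma adjugate2_sum {R : realType} (A : 'M[R]_2) (h : 'I_2 -> 'I_2 -> R) (i j : 'I_2) :
  i != j -> \sum_(k < 2) \sum_(l < 2) cofactor A k l * h k l =
  A j j * h i i - A j i * h i j + (- A i j * h j i + A i i * h j j).
Proof.
move=> ij; rewrite (sum_ord2 _ ij) !(sum_ord2 _ ij).
by have [-> -> -> ->] := cofactor2 A ij; rewrite mulNr.
Qed.

(** * The null direction and the derivatives of B_F *)

Section KeyEstimate.
Context {R : realType} {M : oriented_manifold3 R} {r : smoothness}.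
Variable g : lorentz_metric M r.
Hypothesis hr : at_least 4 r.
Variables (F : 'rV[R]_2 -> M) (W : set 'rV[R]_2).
Hypotheses (oW : open W) (CF : Ck_map 4 W F).
Variables i j : 'I_2.
Hypothesis ij : i != j.

Local Notation Sf k l := (fun u => S_F g F u k l).
Local Notation s k l u := (S_F g F u k l).

Lemma B_FE u : W u -> B_F g F u = s i i u * s j j u - s i j u * s i j u.
Proof.
by move=> Wu; rewrite /B_F (det2E _ ij) [X in _ - _ * X](S_F_sym g oW CF j i Wu).
Qed.

Lemma B_F_Ck c : Ck 3 (in_chart F W c) (B_F g F : _ -> R^o).
Proof.
have oA := @in_chart_open _ _ _ _ oW CF c.
have C k l := S_F_Ck g hr oW CF c k l.
have E u : in_chart F W c u ->
    (s i i u * s j j u - s i j u * s i j u : R^o) = B_F g F u.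
  by move=> [Wu _]; rewrite B_FE.
exact: (Ck_ext oA E (Ck_sub oA (Ck_mul oA (C i i) (C j j)) (Ck_mul oA (C i j) (C i j)))).
Qed.

Variable c : chart M.
Local Notation A := (in_chart F W c).

(** The Christoffel symbols of the first kind of the surface. *)
Definition conn (k l m : 'I_2) (u : 'rV[R]_2) : R :=
  metric g c (coord c (F u)) (D2F g F c k l u) (frame F c m u).

Lemma conn_Ck k l m : Ck 1 A (conn k l m : _ -> R^o).
Proof. apply: D2F_metric_Ck => //; exact: Ck_le (frame_Ck CF c m). Qed.

Lemma derive_S k l m u : A u -> 'D_(basis_vec k) (Sf l m : _ -> R^o) u =
  conn k l m u + conn k m l u.
Proof.
move=> Au; rewrite (derive_S_F g hr oW CF k l m Au); congr (_ + _).
exact: bilC (gram_sym g (in_chart_coord Au)).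
Qed.

(** Jacobi's formula for a 2 by 2 determinant, with the derivatives of S
    expressed by the symbols [conn]. *)
Lemma derive_B_F k u : A u -> 'D_(basis_vec k) (B_F g F : _ -> R^o) u =
  2 * conn k i i u * s j j u + 2 * conn k j j u * s i i u
  - 2 * s i j u * (conn k i j u + conn k j i u).
Proof.
move=> Au; have oA := @in_chart_open _ _ _ _ oW CF c.
have -> : 'D_(basis_vec k) (B_F g F : _ -> R^o) u =
    'D_(basis_vec k) (Sf i i * Sf j j - Sf i j * Sf i j : _ -> R^o) u.
  apply: near_eq_derive; apply: near_open oA Au _ => y [Wy _].
  by rewrite B_FE.
have D l m : is_derive u (basis_vec k) (Sf l m : _ -> R^o) (conn k l m u + conn k m l u).
  rewrite -derive_S//; apply: diff_is_derive.
  exact: (Ck_differentiable (S_F_Ck g hr oW CF c l m)).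
have [_ ->] := is_deriveB (is_deriveM (D i i) (D j j)) (is_deriveM (D i j) (D i j)).
have alg (a b d p q s t : R) :
    ((a : R) *: (q + q : R^o) + d *: (p + p : R^o)) - (b *: (s + t : R^o) + b *: (s + t : R^o)) =
    2 * p * d + 2 * q * a - 2 * b * (s + t).
  by rewrite /GRing.scale/=; ring.
exact: alg.
Qed.

Variable w : 'rV[R]_3.

Definition frame_w k (u : 'rV[R]_2) : R := metric g c (coord c (F u)) (frame F c k u) w.
Definition w_w (u : 'rV[R]_2) : R := metric g c (coord c (F u)) w w.
Definition conn_w k l (u : 'rV[R]_2) : R :=
  metric g c (coord c (F u)) (D2F g F c k l u) w.

Lemma conn_w_Ck k l : Ck 1 A (conn_w k l : _ -> R^o).
Proof. by apply: D2F_metric_Ck => //; exact: Ck_cst. Qed.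

Lemma frame_w_Ck k : Ck 3 A (frame_w k : _ -> R^o).
Proof. by apply: metric_frame_Ck => //; exact: Ck_cst. Qed.

Lemma w_w_Ck : Ck 3 A (w_w : _ -> R^o).
Proof.
have CG : Ck 3 A (gram g c \o (coord c \o F)) by exact: Ck_le (gramF_Ck g hr oW CF c).
have Cw := @Ck_cst R _ _ 3 A w.
exact: (Ck_bil (@in_chart_open _ _ _ _ oW CF c) CG Cw Cw).
Qed.

(** The product of w with the tangent vector s_jj F_i - s_ij F_j, which is
    g-orthogonal to F_j, and to F_i as well where B = 0. *)
Definition omega u : R := s j j u * frame_w i u - s i j u * frame_w j u.
Definition trace_frame m u : R := s j j u * conn i i m u - s i j u * (conn i j m u + conn j i m u)
   + s i i u * conn j j m u.
Definition trace_w u : R := s j j u * conn_w i i u - s i j u * (conn_w i j u + conn_w j i u)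
   + s i i u * conn_w j j u.
(** The Gram determinant of (F_i, F_j, w), see [gram_wE]. *)
Definition gram_w u : R := B_F g F u * w_w u
  - (s i i u * (frame_w j u * frame_w j u) - 2 * s i j u * (frame_w i u * frame_w j u) + s j j u * (frame_w i u * frame_w i u)).

(** The trace of the second covariant derivative of F with respect to the
    cofactor matrix of S; [trace_frame] and [trace_w] are its products with
    F_m and w. *)
Definition cof_trace u : 'rV[R]_3 := s j j u *: D2F g F c i i u
   - s i j u *: (D2F g F c i j u + D2F g F c j i u) + s i i u *: D2F g F c j j u.

Local Notation G u := (gram g c (coord c (F u))).
Local Notation d3 u z := (det3 (frame F c i u) (frame F c j u) z).

Lemma cof_trace_frame m u : bil (G u) (cof_trace u) (frame F c m u) = trace_frame m u.
Proof. exact: bil_comb. Qed.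

Lemma cof_trace_w u : bil (G u) (cof_trace u) w = trace_w u.
Proof. exact: bil_comb. Qed.

Lemma omega_trace u : A u -> (s j j u * trace_frame i u - s i j u * trace_frame j u) * omega u =
  B_F g F u * (s j j u * trace_w u - frame_w j u * trace_frame j u)
  - s j j u * (\det (G u) * d3 u (cof_trace u) * d3 u w).
Proof.
move=> Au; exact: (gram_identity (gram_sym g (in_chart_coord Au))
  (esym (S_F_chart g oW CF i i Au)) (esym (S_F_chart g oW CF i j Au))
  (esym (S_F_chart g oW CF j j Au)) (erefl (frame_w i u)) (erefl (frame_w j u))
  (B_FE Au.1) (cof_trace_frame i u) (cof_trace_frame j u) (cof_trace_w u)).
Qed.

Lemma gram_wE u : A u -> \det (G u) * d3 u w * d3 u w = gram_w u.
Proof.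
move=> Au; exact: (gram_identity_sq (gram_sym g (in_chart_coord Au))
  (esym (S_F_chart g oW CF i i Au)) (esym (S_F_chart g oW CF i j Au))
  (esym (S_F_chart g oW CF j j Au)) (erefl (frame_w i u)) (erefl (frame_w j u)) (erefl (w_w u))
  (B_FE Au.1)).
Qed.

(** By linearity of the volume, A_F is the volume of F_0, F_1 and [cof_trace].
    *)
Lemma A_F_det3 u : A u ->
  `|A_F g F u| = Num.sqrt `|\det (G u)| * `|d3 u (cof_trace u)|.
Proof.
move=> Au; have Wu := Au.1.
rewrite (norm_det3_ord2 (fun k => frame F c k u) (cof_trace u) ij).
rewrite -[X in X * _]ger0_norm ?sqrtr_ge0// -normrM; congr `|_|.
rewrite /A_F (adjugate2_sum _ (fun k l => h_tilde g F k l u) ij).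
rewrite (S_F_sym g oW CF j i Wu).
have H k l := h_tilde_volume g hr oW CF k l Au.
rewrite (H i i) (H i j) (H j i) (H j j).
have alg (a b d q t1 t2 t3 t4 : R) :
    d * (q * t1) - b * (q * t2) + (- b * (q * t3) + a * (q * t4)) =
    q * (d * t1 - b * (t2 + t3) + a * t4) by ring.
apply: etrans (alg _ _ _ _ _ _ _ _) _.
by rewrite /cof_trace det3_comb.
Qed.

End KeyEstimate.

(** * The derivative of B_F in the null direction *)

Section KeyInequality.
Context {R : realType} {M : oriented_manifold3 R} {r : smoothness}.
Variable g : lorentz_metric M r.
Hypothesis hr : at_least 4 r.
Variables (F : 'rV[R]_2 -> M) (W : set 'rV[R]_2).
Hypotheses (oW : open W) (CF : Ck_map 4 W F).
Variables i j : 'I_2.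
Hypothesis ij : i != j.
Variables (c : chart M) (w : 'rV[R]_3).

Local Notation A := (in_chart F W c).
Local Notation s k l u := (S_F g F u k l).
Local Notation G u := (gram g c (coord c (F u))).
Local Notation d3 u z := (det3 (frame F c i u) (frame F c j u) z).
Local Notation cn := (conn g F c).
Local Notation om := (omega g F i j c w).
Local Notation Zm := (trace_frame g F i j c).
Local Notation ZW := (trace_w g F i j c w).
Local Notation fW := (frame_w g F c w).
Local Notation gW := (gram_w g F i j c w).

(** The square root of |det G| is shared between the two determinants: with
    the first it gives |A_F| = |phi B|, with the second the square root of
    |gram_w|, which is at most 1 + |gram_w|. *)
Lemma volume_bound u phi : A u -> A_F g F u = phi * B_F g F u ->
  `|\det (G u) * d3 u (cof_trace g F i j c u) * d3 u w| <=
  `|B_F g F u| * (`|phi| * (1 + `|gW u|)).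
Proof.
move=> Au AF.
have E1 := A_F_det3 g hr oW CF ij Au; have E2 := gram_wE g oW CF ij w Au.
rewrite AF normrM in E1; rewrite -E2.
set D := \det _ in E1 *; set t := det3 _ _ (cof_trace _ _ _ _ _ _) in E1 *; set y := det3 _ _ w.
pose q := Num.sqrt `|D|.
have q2 : `|D| = q * q by rewrite -expr2 sqr_sqrtr.
rewrite -/q in E1; rewrite !normrM q2.
have -> : q * q * `|t| * `|y| = (q * `|t|) * (q * `|y|) by ring.
have -> : q * q * `|y| * `|y| = (q * `|y|) ^+ 2 by rewrite expr2; ring.
rewrite -E1 [leRHS]mulrA [`|B_F g F u| * `|phi|]mulrC ler_wpM2l// ?mulr_ge0//.
have : 0 <= (q * `|y| - 1) ^+ 2 by exact: sqr_ge0.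
have : 0 <= q * `|y| by rewrite mulr_ge0// sqrtr_ge0.
by move: (q * `|y|) => x x0; rewrite !expr2; nra.
Qed.

(** The derivative of B in the direction d_i + slope d_j. *)
Definition null_derivative u : R :=
  'D_(basis_vec i) (B_F g F : _ -> R^o) u +
  - s i j u / s j j u * 'D_(basis_vec j) (B_F g F : _ -> R^o) u.

Definition coef_frame u : R := om u * (- 2 * (s j j u * cn j j i u - s i j u * cn j j j u)
  + s j j u * (2 * cn i j j u) - s i j u * (2 * cn j j j u)).

Definition coef_w u : R := s j j u * ZW u - fW j u * Zm j u.

(** Up to a multiple of B, the null derivative of B is twice the product of
    [cof_trace] with the null vector, by the symmetry of the second
    derivatives; the Gram identity and the volume bound take care of it. *)
Lemma null_derivative_bound u phi : A u -> s j j u != 0 -> A_F g F u = phi * B_F g F u ->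
  `|null_derivative u| * `|s j j u * s j j u * om u| <=
  `|B_F g F u| * (`|coef_frame u| +
    `|2 * s j j u| * (`|coef_w u| + `|s j j u| * (`|phi| * (1 + `|gW u|)))).
Proof.
move=> Au d0 AF; have V := volume_bound Au AF.
have O := omega_trace g oW CF ij w Au.
have E : null_derivative u * (s j j u * s j j u * om u) =
    B_F g F u * coef_frame u + 2 * s j j u *
    ((s j j u * Zm i u - s i j u * Zm j u) * om u).
  have alg (a b d iii ijj iij iji jii jjj jij jji o B : R) :
      d != 0 -> B = a * d - b * b ->
      (2 * iii * d + 2 * ijj * a - 2 * b * (iij + iji) +
       - b / d * (2 * jii * d + 2 * jjj * a - 2 * b * (jij + jji))) * (d * d * o) =
      B * (o * (- 2 * (d * jji - b * jjj) + d * (2 * ijj) - b * (2 * jjj))) +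
      2 * d * ((d * (d * iii - b * (iji + jii) + a * jji)
        - b * (d * iij - b * (ijj + jij) + a * jjj)) * o).
    by move=> dn ->; field.
  rewrite /null_derivative (derive_B_F g hr oW CF ij i Au) (derive_B_F g hr oW CF ij j Au).
  exact: alg _ _ _ _ _ _ _ _ _ _ _ _ _ d0 (B_FE g oW CF ij Au.1).
have alg2 (B b1 d b2 e V' : R) : `|e| <= `|B| * V' ->
    `|B * b1 + 2 * d * (B * b2 - d * e)| <=
    `|B| * (`|b1| + `|2 * d| * (`|b2| + `|d| * V')).
  move=> eV; have -> : `|B| * (`|b1| + `|2 * d| * (`|b2| + `|d| * V')) =
    `|B * b1| + `|2 * d| * (`|B * b2| + `|d| * (`|B| * V')) by rewrite !normrM; ring.
  rewrite (le_trans (ler_normD _ _))// lerD2l normrM ler_wpM2l//.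
  by rewrite (le_trans (ler_normB _ _))// lerD2l normrM ler_wpM2l.
by rewrite -normrM E O; exact: alg2 V.
Qed.

(** In [null_derivative_bound] the factor on the left is nonzero at o, and all
    the coefficients are continuous. *)
Lemma key_inequality o (phi : 'rV[R]_2 -> R^o) : A o -> Ck 0 A phi ->
  (forall u, W u -> A_F g F u = phi u * B_F g F u) ->
  s j j o != 0 -> om o != 0 ->
  exists2 K, 0 <= K & \forall u \near o, `|null_derivative u| <= K * `|B_F g F u|.
Proof.
move=> Ao Cphi AF d0 om0.
have oA : open A := @in_chart_open _ _ _ _ oW CF c.
have Cs k l : Ck 0 A (fun u => s k l u : R^o) by exact: Ck_le (S_F_Ck g hr oW CF c k l).
have Cc k l m : Ck 0 A (cn k l m : _ -> R^o) by exact: Ck_le (conn_Ck g hr oW CF c k l m).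
have Ccw k l : Ck 0 A (conn_w g F c w k l : _ -> R^o).
  exact: Ck_le (conn_w_Ck g hr oW CF c w k l).
have Cf k : Ck 0 A (fW k : _ -> R^o) by exact: Ck_le (frame_w_Ck g hr oW CF c w k).
have Cw : Ck 0 A (w_w g F c w : _ -> R^o) by exact: Ck_le (w_w_Ck g hr oW CF c w).
have CB : Ck 0 A (B_F g F : _ -> R^o) by exact: Ck_le (B_F_Ck g hr oW CF ij c).
have C_ a : Ck 0 A (fun=> a : R^o) by exact: Ck_cst.
have Com : Ck 0 A (om : _ -> R^o).
  exact: (Ck_sub oA (Ck_mul oA (Cs j j) (Cf i)) (Ck_mul oA (Cs i j) (Cf j))).
have CZ k : Ck 0 A (Zm k : _ -> R^o).
  exact: (Ck_add oA (Ck_sub oA (Ck_mul oA (Cs j j) (Cc i i k))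
    (Ck_mul oA (Cs i j) (Ck_add oA (Cc i j k) (Cc j i k))))
    (Ck_mul oA (Cs i i) (Cc j j k))).
have CZw : Ck 0 A (ZW : _ -> R^o).
  exact: (Ck_add oA (Ck_sub oA (Ck_mul oA (Cs j j) (Ccw i i))
    (Ck_mul oA (Cs i j) (Ck_add oA (Ccw i j) (Ccw j i))))
    (Ck_mul oA (Cs i i) (Ccw j j))).
have Cg : Ck 0 A (gW : _ -> R^o).
  exact: (Ck_sub oA (Ck_mul oA CB Cw) (Ck_add oA
    (Ck_sub oA (Ck_mul oA (Cs i i) (Ck_mul oA (Cf j) (Cf j)))
      (Ck_mul oA (Ck_mul oA (C_ 2) (Cs i j)) (Ck_mul oA (Cf i) (Cf j))))
    (Ck_mul oA (Cs j j) (Ck_mul oA (Cf i) (Cf i))))).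
have C1 : Ck 0 A (coef_frame : _ -> R^o).
  exact: (Ck_mul oA Com (Ck_sub oA (Ck_add oA
    (Ck_mul oA (C_ (- 2)) (Ck_sub oA (Ck_mul oA (Cs j j) (Cc j j i))
      (Ck_mul oA (Cs i j) (Cc j j j))))
    (Ck_mul oA (Cs j j) (Ck_mul oA (C_ 2) (Cc i j j))))
    (Ck_mul oA (Cs i j) (Ck_mul oA (C_ 2) (Cc j j j))))).
have C2 : Ck 0 A (coef_w : _ -> R^o).
  exact: (Ck_sub oA (Ck_mul oA (Cs j j) CZw) (Ck_mul oA (Cf j) (CZ j))).
have nrm (f : 'rV[R]_2 -> R^o) : Ck 0 A f -> Ck 0 A (fun u => `|f u| : R^o).
  by move=> cf x Ax; exact: (cvg_norm (cf x Ax)).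
pose m u : R := `|coef_frame u| +
    `|2 * s j j u| * (`|coef_w u| + `|s j j u| * (`|phi u| * (1 + `|gW u|))).
pose q u : R := s j j u * s j j u * om u.
have Cm : {for o, continuous (m : _ -> R^o)}.
  exact: (Ck_add oA (nrm _ C1) (Ck_mul oA (nrm _ (Ck_mul oA (C_ 2) (Cs j j)))
    (Ck_add oA (nrm _ C2) (Ck_mul oA (nrm _ (Cs j j)) (Ck_mul oA (nrm _ Cphi)
      (Ck_add oA (C_ 1) (nrm _ Cg))))))) _ Ao.
have Cq : {for o, continuous (q : _ -> R^o)}.
  exact: (Ck_mul oA (Ck_mul oA (Cs j j) (Cs j j)) Com) _ Ao.
have q0 : 0 < `|q o| by rewrite normr_gt0 !mulf_neq0.
have m0 : 0 <= m o by rewrite addr_ge0// mulr_ge0// addr_ge0// mulr_ge0// mulr_ge0// addr_ge0.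
exists ((m o + 1) / (`|q o| / 2)); first by rewrite divr_ge0// ?addr_ge0// divr_ge0// ltW.
have nA : \forall u \near o, A u by exact: near_open oA Ao (fun y h => h).
have nm : \forall u \near o, m u <= m o + 1.
  have /cvgrPdist_le/(_ 1 ltr01) := Cm.
  by apply: filterS => u; rewrite ler_norml => /andP[h1 h2]; lra.
have nq : \forall u \near o, `|q o| / 2 <= `|q u|.
  have q20 : 0 < `|q o| / 2 by rewrite divr_gt0.
  have /cvgrPdist_le/(_ _ q20) := Cq.
  apply: filterS => u; have := lerB_dist (q o) (q u); lra.
have ns : \forall u \near o, s j j u != 0.
  exact: (cvgr_neq0 _ (Cs j j _ Ao) d0).
near=> u.
have Au : A u by near: u.
have su : s j j u != 0 by near: u.
have mu : m u <= m o + 1 by near: u.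
have qu : `|q o| / 2 <= `|q u| by near: u.
have T := null_derivative_bound Au su (AF u Au.1).
rewrite mulrAC ler_pdivlMr ?divr_gt0//.
apply: le_trans (_ : `|null_derivative u| * `|q u| <= _); first by rewrite ler_wpM2l.
by rewrite (le_trans T)// mulrC ler_wpM2r.
Unshelve. all: by end_near. Qed.

End KeyInequality.

(** * Integral curves of the null direction *)

Section NullCurve.
Context {R : realType}.

Lemma Ck_id {V : normedModType R} k (A : set V) : Ck k A (@id V).
Proof.
case: k => [|k]; first by move=> x _; exact: cvg_id.
split=> [x _|v]; first exact: ex_diff.
rewrite (_ : 'D_v id = cst v); first exact: Ck_cst.
by apply/funext => x; exact: derive_id.
Qed.

Lemma Ck_entry {n} k (A : set 'rV[R]_n) (m : 'I_n) : open A ->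
  Ck k A (fun q => q 0 m : R^o).
Proof. by move=> oA; have /(Ck_mxP _ _ oA) := @Ck_id 'rV[R]_n k A; exact. Qed.

Lemma derive_curve {W : normedModType R} (J : set R) (q q' : R -> W) :
  (forall t : R, J t -> is_derive t 1 q (q' t)) ->
  (forall t, J t -> differentiable (q : R^o -> W) t) /\
   forall v : R^o, forall t, J t -> 'D_v (q : R^o -> W) t = v *: q' t.
Proof.
move=> dq; have df t : J t -> differentiable (q : R^o -> W) t.
  by move=> Jt; apply/derivable1_diffP; have [] := dq t Jt.
split => // v t Jt; have [_ <-] := dq t Jt.
rewrite !deriveE; [|exact: df..].
by rewrite -linearZ -[v *: 1]/(v * 1) mulr1.
Qed.

Lemma Ck_curveS {n} k (J : set R) (q q' : R -> 'rV[R]_n) : open J ->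
  (forall t : R, J t -> is_derive t 1 q (q' t)) ->
  Ck (V := R^o) k J q' -> Ck (V := R^o) k.+1 J q.
Proof.
move=> oJ dq Cq'; have [df Dq] := derive_curve dq; split => // v.
apply: (@Ck_ext _ _ _ k J (fun t => v *: q' t)) => //.
  by move=> t Jt; rewrite Dq.
apply/(@Ck_mxP _ R^o) => // a b; rewrite (ord1 a).
apply: (@Ck_ext _ _ _ k J (fun t => v * q' t 0 b : R^o)) => //.
  by move=> t _; rewrite mxE.
apply: Ck_mul => //; first exact: Ck_cst.
by move/(@Ck_mxP _ R^o _ _ _ _ _ oJ) : Cq'; exact.
Qed.

Lemma derive_lin2 {V W : normedModType R} (f : V -> W) (v w : V) (a b : R) x :
  differentiable f x ->
  'D_(a *: v + b *: w) f x = a *: 'D_v f x + b *: 'D_w f x.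
Proof. by move=> df; rewrite !deriveE// linearD !linearZ. Qed.

Lemma is_derive_scalel {W : normedModType R} (a : R -> R) (w : W) (t da : R) :
  is_derive t 1 a da -> is_derive t 1 (fun s => a s *: w) (da *: w).
Proof.
move=> [ad <-]; have df : differentiable a t by apply/derivable1_diffP.
have dw : differentiable (fun s => a s *: w) t by exact: differentiableZl.
split; first exact: diff_derivable.
by rewrite (deriveE _ dw) (diffZl _ df) (deriveE _ df).
Qed.

(** At a zero of f, h vanishes too, and the bound holds between the difference
    quotients. *)
Lemma derive_bound_at_zero {V : normedModType R} (f h : V -> R^o) (K : R) (v x : V) :
  differentiable f x -> differentiable h x ->
  (\forall y \near x, `|h y| <= K * `|f y|) -> f x = 0 ->
  `|'D_v h x| <= K * `|'D_v f x|.
Proof.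
move=> df dh hK fx.
have hx : h x = 0.
  by have := nbhs_singleton hK; rewrite fx normr0 mulr0 normr_le0 => /eqP.
have cf : (t^-1 *: (f (t *: v + x) - f x) : R^o) @[t --> (0:R)^'] --> 'D_v f x.
  exact: (diff_derivable (v := v) df).
have ch : (t^-1 *: (h (t *: v + x) - h x) : R^o) @[t --> (0:R)^'] --> 'D_v h x.
  exact: (diff_derivable (v := v) dh).
have nh : `|t^-1 *: (h (t *: v + x) - h x) : R^o| @[t --> (0 : R)^'] --> `|'D_v h x|.
  exact: cvg_norm.
have nf : K * `|t^-1 *: (f (t *: v + x) - f x) : R^o| @[t --> (0 : R)^'] -->
    K * `|'D_v f x|.
  by apply: cvgM; [exact: cvg_cst|exact: cvg_norm].
refine (@ler_cvg_to R ((0 : R)^') _ R (fun t => `|t^-1 *: (h (t *: v + x) - h x) : R^o|)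
  (fun t => K * `|t^-1 *: (f (t *: v + x) - f x) : R^o|) _ _ nh nf _).
have hK' : \forall t \near (0 : R), `|h (t *: v + x)| <= K * `|f (t *: v + x)|.
  have cv : (t *: v + x) @[t --> (0 : R)] --> x.
    rewrite -[X in _ --> X]add0r -(scale0r v).
    by apply: cvgD; [apply: cvgZr_tmp; exact: cvg_id|exact: cvg_cst].
  exact: cv hK.
apply: cvg_within; apply: filterS hK' => t ht.
by rewrite hx fx !subr0 !normrZ mulrCA ler_wpM2l.
Qed.

Variables i j : 'I_2.
Hypothesis ij : i != j.
Variables (W : set 'rV[R]_2) (f rr B : 'rV[R]_2 -> R^o) (o : 'rV[R]_2) (K C : R).
Hypotheses (oW : open W) (Wo : W o).
Hypotheses (Cf : Ck 1 W f) (Cr : Ck 1 W rr) (CB : Ck 2 W B) (B0 : B o = 0).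
Hypotheses (K0 : 0 <= K) (C0 : 0 <= C).

Local Notation ei := (delta_mx 0 i : 'rV[R]_2).
Local Notation ej := (delta_mx 0 j : 'rV[R]_2).

Let h (u : 'rV[R]_2) : R^o := 'D_ei B u + f u * 'D_ej B u.
Hypothesis hB : forall u, W u -> `|h u| <= K * `|B u|.
Hypothesis fC : forall u, W u -> `|'D_ej f u| <= C.

(* The bound |h| <= K |B| is differentiated in the direction j at a zero of B;
   the symmetry of second derivatives brings out the null derivative of d_j B,
   and the derivative of the slope accounts for C. *)
Let h_bound u : W u -> B u = 0 ->
  `|'D_ei ('D_ej B) u + f u * 'D_ej ('D_ej B) u| <= (K + C) * `|'D_ej B u|.
Proof.
move=> Wu Bu.
have dD v : differentiable ('D_v B) u by exact: (Ck_differentiable (Ck_derive v CB)).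
have df : differentiable f u by exact: (Ck_differentiable Cf).
have dh := is_deriveD (diff_is_derive ej (dD ei))
  (is_deriveM (diff_is_derive ej df) (diff_is_derive ej (dD ej))).
have dB : differentiable B u by exact: (Ck_differentiable CB).
have dfh : differentiable h u.
  by apply: differentiableD; [exact: dD|apply: differentiableM; [exact: df|exact: dD]].
have nh : \forall y \near u, `|h y| <= K * `|B y| by exact: near_open oW Wu hB.
have H := derive_bound_at_zero ej dB dfh nh Bu.
have E : 'D_ei ('D_ej B) u + f u * 'D_ej ('D_ej B) u =
    'D_ej h u - 'D_ej f u * 'D_ej B u.
  have S : 'D_ei ('D_ej B) u = 'D_ej ('D_ei B) u by exact: derive_sym_real oW Wu CB.
  have -> : 'D_ej h u = 'D_ej ('D_ei B) u + (f u * 'D_ej ('D_ej B) u + 'D_ej B u * 'D_ej f u).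
    by have [_] := dh.
  have alg (a b p q s : R) : a = b -> a + p = b + (p + q * s) - s * q.
    by move=> ->; ring.
  exact: alg S.
rewrite E (le_trans (ler_normB _ _))// mulrDl lerD// normrM ler_wpM2r//.
exact: fC.
Qed.

Let pos (q : 'rV[R]_3) : 'rV[R]_2 := q 0 (inord 0) *: ei + q 0 (inord 1) *: ej.

Let A3 := pos @^-1` W.

Let pos_Ck k (A : set 'rV[R]_3) : open A -> Ck k A pos.
Proof. by move=> oA; apply: Ck_add => //; apply: Ck_scalel => //; exact: Ck_entry. Qed.

Let oA3 : open A3.
Proof.
apply: open_comp => // q _; exact: (Ck_continuous (pos_Ck 0 openT)).
Qed.

Let Phi (q : 'rV[R]_3) : 'rV[R]_3 := \row_k
  (let p := q 0 (inord 2) in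
   nth 0 [:: p; p * f (pos q); - (p * p * rr (pos q))] k).

Let Phi_Ck : Ck 1 A3 Phi.
Proof.
apply/(Ck_mxP _ _ oA3) => a k; rewrite (ord1 a).
have Cp : Ck 1 A3 (fun q => q 0 (inord 2) : R^o) by exact: Ck_entry.
have Cpos := pos_Ck 1 oA3.
have Cfp := @Ck_comp R _ 2 1 A3 W pos f oA3 (fun q Aq => Aq) Cpos Cf.
have Crp := @Ck_comp R _ 2 1 A3 W pos rr oA3 (fun q Aq => Aq) Cpos Cr.
have E : forall q, A3 q -> nth 0 [:: q 0 (inord 2); q 0 (inord 2) * f (pos q);
    - (q 0 (inord 2) * q 0 (inord 2) * rr (pos q))] k = Phi q 0 k.
  by move=> q _; rewrite mxE.
apply: (Ck_ext oA3 E); case: k {E} => m m3.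
case: m m3 => [|[|[|m]]] m3; last by exfalso; move: m3.
- exact: Cp.
- exact: (Ck_mul oA3 Cp Cfp).
- exact: (Ck_opp oA3 (Ck_mul oA3 (Ck_mul oA3 Cp Cp) Crp)).
Qed.

Let q0 : 'rV[R]_3 := \row_k nth 0 [:: o 0 i; o 0 j; 1] k.

Let pos_q0 : pos q0 = o.
Proof.
rewrite /pos !mxE !inordK//=; rewrite [RHS]row_sum_delta.
by rewrite (sum_ord2 _ ij).
Qed.

(** The equation for the curve and that for the factor p are solved together,
    as a system in the unknowns (u_i, u_j, p); the term rr is free, for the
    choice of the parametrization. Gronwall's lemma applies to B by
    hypothesis, and to d_j B by h_bound once B is known to vanish. *)
Lemma null_curve_ode : exists d (kappa : R -> 'rV[R]_2) (p : R -> R),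
  [/\ 0 < d, kappa 0 = o, p 0 = 1,
    (forall t : R, `|t| < d -> [/\ W (kappa t), 0 < p t,
      is_derive t 1 kappa (p t *: (ei + f (kappa t) *: ej)),
      is_derive t 1 p (- (p t * p t * rr (kappa t))) & B (kappa t) = 0]) &
    ('D_ej B o = 0 -> forall t : R, `|t| < d -> 'D_ej B (kappa t) = 0) /\
    Ck (V := R^o) 2 [set t : R | `|t| < d] kappa].
Proof.
have A3q0 : A3 q0 by rewrite /A3/= pos_q0.
have [d1 [q [d10 q00 qP]]] := picard_lindelof oA3 A3q0 Phi_Ck.
pose kappa (t : R) := pos (q t); pose p (t : R) : R := q t 0 (inord 2).
have p0 : p 0 = 1 by rewrite /p q00 mxE inordK.
have k0 : kappa 0 = o by rewrite /kappa q00 pos_q0.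
have dp (t : R) : `|t| < d1 -> is_derive t 1 p (- (p t * p t * rr (kappa t))).
  move=> /qP[_ /(is_derive_coord 0 (inord 2))].
  by rewrite mxE inordK.
have dk (t : R) : `|t| < d1 -> is_derive t 1 kappa (p t *: (ei + f (kappa t) *: ej)).
  move=> /qP[_ dq].
  have E := is_deriveD (is_derive_scalel ei (is_derive_coord 0 (inord 0) dq))
    (is_derive_scalel ej (is_derive_coord 0 (inord 1) dq)).
  apply: (is_derive_eq E); rewrite !mxE !inordK//= scalerDr scalerA.
  by [].
have cp : {for (0 : R), continuous p}.
  by apply: derivable_cont; have [] := dp 0 _; rewrite ?normr0.
have [d2 /= d20 d2P] : exists2 d2 : R, 0 < d2 & forall t : R, `|t| < d2 -> 0 < p t <= 2.
  have /cvgrPdist_lt/(_ 1 ltr01)/nbhs_ballP[d2 /= d20 d2P] := cp.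
  exists d2 => // t td; have := d2P t; rewrite -ball_normE /= sub0r normrN p0.
  by move=> /(_ td); rewrite ltr_norml => /andP[h1 h2]; apply/andP; split; lra.
pose d := Num.min d1 d2.
have dd1 (t : R) : `|t| < d -> `|t| < d1 by rewrite lt_min => /andP[].
have dd2 (t : R) : `|t| < d -> `|t| < d2 by rewrite lt_min => /andP[].
have Wk (t : R) : `|t| < d -> W (kappa t) by move=> /dd1/qP[].
have dcomp (e : 'rV[R]_2 -> R^o) (t : R) : `|t| < d -> differentiable e (kappa t) ->
    is_derive t 1 (fun t : R => e (kappa t))
      (p t * ('D_ei e (kappa t) + f (kappa t) * 'D_ej e (kappa t))).
  move=> td de; have [dkt kE] := dk t (dd1 t td).
  have dkt' : differentiable kappa t by apply/derivable1_diffP.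
  split; first by apply/derivable1_diffP/differentiable_comp.
  rewrite -[LHS]/('D_1 (e \o kappa) t) derive_comp// kE.
  rewrite scalerDr scalerA derive_lin2// mulrDr mulrA.
  by [].
have Bk : forall t : R, `|t| < d -> B (kappa t) = 0.
  apply: (@gronwall0 _ (fun t : R => B (kappa t)) (2 * K) d); first by rewrite mulr_ge0.
  - move=> t td; have dB := Ck_differentiable CB (Wk t td).
    by have [] := dcomp B t td dB.
  - move=> t td; have dB := Ck_differentiable CB (Wk t td).
    have [_ ->] := dcomp B t td dB; have /andP[pt0 pt2] := d2P t (dd2 t td).
    rewrite normrM -mulrA; apply: ler_pM => //; first by rewrite gtr0_norm.
    exact: hB (Wk t td).
  - by rewrite k0.
have Jopen : open [set t : R | `|t| < d].
  rewrite (_ : [set _ | _] = ball (0 : R) d); first exact: ball_open.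
  by apply/seteqP; split=> t; rewrite -ball_normE /= sub0r normrN.
exists d, kappa, p; split; [by rewrite lt_min d10|exact: k0|exact: p0|..].
- move=> t td; have /andP[pt0 _] := d2P t (dd2 t td); split.
  + exact: Wk.
  + exact: pt0.
  + exact: dk (dd1 t td).
  + exact: dp (dd1 t td).
  + exact: Bk.
split.
- move=> Dj0; apply: (@gronwall0 _ (fun t : R => 'D_ej B (kappa t)) (2 * (K + C)) d).
  + by rewrite mulr_ge0// addr_ge0.
  + move=> t td; have dB := Ck_differentiable (Ck_derive ej CB) (Wk t td).
    by have [] := dcomp ('D_ej B) t td dB.
  + move=> t td; have dB := Ck_differentiable (Ck_derive ej CB) (Wk t td).
    have [_ ->] := dcomp ('D_ej B) t td dB; have /andP[pt0 pt2] := d2P t (dd2 t td).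
    rewrite normrM -mulrA; apply: ler_pM => //; first by rewrite gtr0_norm.
    exact: h_bound (Wk t td) (Bk t td).
  + by rewrite k0.
have qP' (t : R) : `|t| < d -> is_derive t 1 q (Phi (q t)) by move=> /dd1/qP[].
have qA (t : R) : `|t| < d -> A3 (q t) by move=> /dd1/qP[].
have Cq1 : Ck (V := R^o) 1 [set t : R | `|t| < d] q.
  apply: (Ck_curveS Jopen qP') => t td.
  apply: (@continuous_comp R^o _ _ q Phi); last first.
    exact: (Ck_continuous Phi_Ck (qA t td)).
  apply: differentiable_continuous; apply/derivable1_diffP.
  by have [] := qP' t td.
have Cq2 : Ck (V := R^o) 2 [set t : R | `|t| < d] q.
  apply: (Ck_curveS Jopen qP').
  exact: (@Ck_comp_mx R R^o 3 1 3 1 _ A3 q Phi Jopen oA3 qA Cq1 Phi_Ck).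
exact: (@Ck_comp_mx R R^o 3 1 2 2 _ A3 q pos Jopen oA3 qA Cq2 (pos_Ck 2 oA3)).
Qed.

End NullCurve.

(** * Curves in the light-like set *)

Section GammaLinear.
Context {R : realType} {M : oriented_manifold3 R} {r : smoothness}.
Variables (g : lorentz_metric M r) (c : chart M) (x : 'rV[R]_3).

Lemma gamma_linl a b (v v' w : 'rV[R]_3) : gamma g c x (a *: v + b *: v') w =
  a *: gamma g c x v w + b *: gamma g c x v' w.
Proof.
apply/rowP => k; rewrite !mxE !mulr_sumr -big_split/=; apply: eq_bigr => i _.
rewrite !mulr_sumr -big_split/=; apply: eq_bigr => j _.
by rewrite !mxE; ring.
Qed.

Lemma gamma_linr a b (v w w' : 'rV[R]_3) : gamma g c x v (a *: w + b *: w') =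
  a *: gamma g c x v w + b *: gamma g c x v w'.
Proof.
apply/rowP => k; rewrite !mxE !mulr_sumr -big_split/=; apply: eq_bigr => i _.
rewrite !mulr_sumr -big_split/=; apply: eq_bigr => j _.
by rewrite !mxE; ring.
Qed.

Lemma gamma_quadratic p m (v w : 'rV[R]_3) :
  gamma g c x (p *: v + m *: w) (p *: v + m *: w) =
  p *: (p *: gamma g c x v v + m *: gamma g c x v w) +
  m *: (p *: gamma g c x w v + m *: gamma g c x w w).
Proof. by rewrite gamma_linl !gamma_linr. Qed.

End GammaLinear.

Lemma is_derive_scale_rV {R : realType} {n} (a : R -> R) (v : R -> 'rV[R]_n) da dv
    (t : R) : is_derive t 1 a da -> is_derive t 1 v dv ->
  is_derive t 1 (fun x => a x *: v x) (da *: v t + a t *: dv).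
Proof.
move=> Da Dv; apply: is_derive_rV => l.
have D := is_deriveM Da (is_derive_coord 0 l Dv).
have E : a t *: (dv 0 l : R^o) + v t 0 l *: (da : R^o) = (da *: v t + a t *: dv) 0 l.
  by rewrite !mxE addrC; congr (_ + _); exact: mulrC.
apply: near_eq_is_derive (is_derive_eq D E).
by apply: filterE => y; rewrite mxE.
Qed.

Section CurveInSurface.
Context {R : realType} {M : oriented_manifold3 R} {r : smoothness}.
Variable g : lorentz_metric M r.
Hypothesis hr : at_least 4 r.
Variables (F : 'rV[R]_2 -> M) (W : set 'rV[R]_2).
Hypotheses (oW : open W) (CF : Ck_map 4 W F).
Variables i j : 'I_2.
Hypothesis ij : i != j.

Local Notation s k l u := (S_F g F u k l).
Local Notation ei := (delta_mx 0 i : 'rV[R]_2).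
Local Notation ej := (delta_mx 0 j : 'rV[R]_2).

Definition slope (u : 'rV[R]_2) : R^o := - s i j u / s j j u.

Variables (J : set R) (kappa : R -> 'rV[R]_2) (p p' m' : R -> R).
Hypothesis oJ : open J.
Hypothesis kW : forall t, J t -> W (kappa t).
Hypothesis kd : forall t, J t -> s j j (kappa t) != 0.
Hypothesis kB : forall t, J t -> B_F g F (kappa t) = 0.
Let m t := p t * slope (kappa t).
Hypothesis dk : forall t : R, J t -> is_derive t 1 kappa (p t *: (ei + slope (kappa t) *: ej)).
Hypothesis dp : forall t : R, J t -> is_derive t 1 p (p' t).
Hypothesis dm : forall t : R, J t -> is_derive t 1 m (m' t).

Let sigma := F \o kappa.

Lemma derive_kappa {N : normedModType R} (e : 'rV[R]_2 -> N) t : J t ->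
  differentiable e (kappa t) ->
  is_derive t 1 (e \o kappa) (p t *: 'D_ei e (kappa t) + m t *: 'D_ej e (kappa t)).
Proof.
move=> Jt de; have [dkt kE] := dk Jt.
have dkt' : differentiable kappa t by apply/derivable1_diffP.
split; first by apply/derivable1_diffP/differentiable_comp.
by rewrite derive_comp// kE scalerDr scalerA derive_lin2.
Qed.

Lemma derive_sigma c t : J t -> in_chart F W c (kappa t) ->
  is_derive t 1 (coord c \o sigma)
    (p t *: frame F c i (kappa t) + m t *: frame F c j (kappa t)).
Proof.
move=> Jt ct; apply: (derive_kappa (e := coord c \o F)) => //.
exact: (Ck_differentiable (coordF_Ck CF c)).
Qed.

Let kcont t : J t -> {for t, continuous kappa}.
Proof.
by move=> Jt; apply: differentiable_continuous; apply/derivable1_diffP; have [] := dk Jt.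
Qed.

Let near_chart c t : J t -> in_chart F W c (kappa t) ->
  \forall t1 \near t, J t1 /\ in_chart F W c (kappa t1).
Proof.
move=> Jt ct; apply: filterI; first exact: near_open oJ Jt (fun y h => h).
apply: (kcont Jt).
exact: near_open (@in_chart_open _ _ _ _ oW CF c) ct (fun y h => h).
Qed.

Lemma cov_sigma c t : J t -> in_chart F W c (kappa t) ->
  cov g c sigma (1 : R^o) (1 : R^o) t =
  p' t *: frame F c i (kappa t) + m' t *: frame F c j (kappa t)
  + (p t *: (p t *: D2F g F c i i (kappa t) + m t *: D2F g F c j i (kappa t))
  + m t *: (p t *: D2F g F c i j (kappa t) + m t *: D2F g F c j j (kappa t))).
Proof.
move=> Jt ct; have [_ v1] := derive_sigma Jt ct.
have df k : differentiable (frame F c k) (kappa t).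
  exact: (Ck_differentiable (frame_Ck CF c k)).
have D : is_derive t 1 (fun t => p t *: frame F c i (kappa t) + m t *: frame F c j (kappa t))
   ((p' t *: frame F c i (kappa t) + p t *: (p t *: 'D_ei (frame F c i) (kappa t) + m t *: 'D_ej (frame F c i) (kappa t))) +
   (m' t *: frame F c j (kappa t) + m t *: (p t *: 'D_ei (frame F c j) (kappa t) + m t *: 'D_ej (frame F c j) (kappa t)))).
  have prod (a a' : R -> R) k : is_derive t 1 a (a' t) ->
      is_derive t 1 (fun t => a t *: frame F c k (kappa t))
        (a' t *: frame F c k (kappa t) + a t *: (p t *: 'D_ei (frame F c k) (kappa t) + m t *: 'D_ej (frame F c k) (kappa t))).
    by move=> da; exact: is_derive_scale_rV da (derive_kappa Jt (df k)).
  exact: is_deriveD (prod p p' i (dp Jt)) (prod m m' j (dm Jt)).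
have E2 : 'D_1 ('D_1 (coord c \o sigma)) t = 'D_1 (fun t => p t *: frame F c i (kappa t) + m t *: frame F c j (kappa t)) t.
  apply: near_eq_derive; apply: filterS (near_chart Jt ct) => t1 [Jt1 ct1].
  by have [_] := derive_sigma Jt1 ct1.
rewrite /cov E2; have [_ ->] := D; rewrite v1.
have alg (a b p0 m0 : R) (fi fj dii dji dij djj gii gij gji gjj : 'rV[R]_3) :
    (a *: fi + p0 *: (p0 *: dii + m0 *: dji)) + (b *: fj + m0 *: (p0 *: dij + m0 *: djj)) +
    (p0 *: (p0 *: gii + m0 *: gij) + m0 *: (p0 *: gji + m0 *: gjj)) =
    a *: fi + b *: fj + (p0 *: (p0 *: (dii + gii) + m0 *: (dji + gji)) +
    m0 *: (p0 *: (dij + gij) + m0 *: (djj + gjj))).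
  by apply/rowP => k; rewrite !mxE; ring.
have E3 := gamma_quadratic g c (coord c (F (kappa t))) (p t) (m t)
  (frame F c i (kappa t)) (frame F c j (kappa t)).
exact: etrans (congr1 (fun v => _ + v) E3) (alg _ _ _ _ _ _ _ _ _ _ _ _ _ _).
Qed.

(** Where B = 0, the direction d_i + slope d_j is in the kernel of S. *)
Lemma kernel_S t k : J t ->
  p t * s i k (kappa t) + m t * s j k (kappa t) = 0.
Proof.
move=> Jt; have Wt := kW Jt; have d0 := kd Jt; have B0 := kB Jt.
rewrite (B_FE g oW CF ij Wt) in B0.
have [->|->] := ord2_or k ij.
- rewrite (S_F_sym g oW CF j i Wt) /m /slope.
  have alg (a b d x : R) : d != 0 -> a * d - b * b = 0 -> x * a + x * (- b / d) * b = 0.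
    move=> dn /eqP; rewrite subr_eq0 => /eqP E.
    by have -> : a = b * b / d; [rewrite -E mulfK|field].
  exact: alg d0 B0.
- have alg (b d x : R) : d != 0 -> x * b + x * (- b / d) * d = 0 by move=> dn; field.
  exact: alg d0.
Qed.

Lemma velocity_frame c t k : J t -> in_chart F W c (kappa t) ->
  metric g c (coord c (sigma t)) ('D_1 (coord c \o sigma) t) (frame F c k (kappa t)) = 0.
Proof.
move=> Jt ct; have [_ ->] := derive_sigma Jt ct.
have E := kernel_S k Jt.
rewrite (S_F_chart g oW CF i k ct) (S_F_chart g oW CF j k ct) in E.
have alg (G : 'M[R]_3) (a b : R) v w z : a * bil G v z + b * bil G w z = 0 ->
  bil G (a *: v + b *: w) z = 0 by rewrite bilDl !bilZl.
exact: alg E.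
Qed.

Lemma velocity_null c t : J t -> in_chart F W c (kappa t) ->
  metric g c (coord c (sigma t)) ('D_1 (coord c \o sigma) t) ('D_1 (coord c \o sigma) t) = 0.
Proof.
move=> Jt ct; have Ei := velocity_frame i Jt ct; have Ej := velocity_frame j Jt ct.
have [_ E] := derive_sigma Jt ct.
have alg (G : 'M[R]_3) (a b : R) v w z : bil G z v = 0 -> bil G z w = 0 ->
  bil G z (a *: v + b *: w) = 0.
  by move=> e1 e2; rewrite bilDr !bilZr e1 e2 !mulr0 addr0.
have := alg _ (p t) (m t) _ _ _ Ei Ej; rewrite -E; exact.
Qed.

Lemma derive_kernel_S c t k : J t -> in_chart F W c (kappa t) ->
  p' t * s i k (kappa t) + m' t * s j k (kappa t)
  + (p t * (p t * (conn g F c i i k (kappa t) + conn g F c i k i (kappa t)) +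
            m t * (conn g F c j i k (kappa t) + conn g F c j k i (kappa t)))
  + m t * (p t * (conn g F c i j k (kappa t) + conn g F c i k j (kappa t)) +
            m t * (conn g F c j j k (kappa t) + conn g F c j k j (kappa t)))) = 0.
Proof.
move=> Jt ct.
have dS n := derive_kappa Jt (Ck_differentiable (S_F_Ck g hr oW CF c n k) ct).
have D := is_deriveD (is_deriveM (dp Jt) (dS i)) (is_deriveM (dm Jt) (dS j)).
have [_ E] := D.
have Z0 : 'D_1 (p * ((fun u => s i k u : R^o) \o kappa) + m * ((fun u => s j k u : R^o) \o kappa)) t = 0.
  rewrite -[RHS](derive_cst (0 : R^o) t (1 : R^o)).
  apply: near_eq_derive; apply: near_open oJ Jt _ => t1 Jt1.
  exact: kernel_S.
rewrite Z0 in E; rewrite [RHS]E.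
rewrite !(derive_S g hr oW CF _ _ _ ct).
have alg (P Q P' Q' A B X Y Z T : R) :
  P' * A + Q' * B + (P * (P * X + Q * Y) + Q * (P * Z + Q * T)) =
  (P *: ((P *: (X : R^o) + Q *: (Y : R^o)) : R^o) + A *: (P' : R^o)) +
  (Q *: ((P *: (Z : R^o) + Q *: (T : R^o)) : R^o) + B *: (Q' : R^o)).
  by rewrite /GRing.scale/=; ring.
exact: alg.
Qed.

(** The product of the velocity with F_k vanishes identically; its derivative
    gives g(sigma'', F_k) = - g(sigma', D_k sigma'), the coefficients of
    sigma' being frozen, which is - p^2 / 2 times the value of the form d_k S
    at the null vector X. As the cofactor matrix of S is s_jj X X^T where B =
    0, Jacobi's formula turns s_jj times this value into d_k B. *)
Lemma acceleration_frame c t k : J t -> in_chart F W c (kappa t) ->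
  2 * s j j (kappa t) *
  metric g c (coord c (sigma t)) (cov g c sigma (1 : R^o) (1 : R^o) t) (frame F c k (kappa t)) =
  - (p t * p t) * 'D_(basis_vec k) (B_F g F : _ -> R^o) (kappa t).
Proof.
move=> Jt ct; have Wt := kW Jt; have d0 := kd Jt; have B0 := kB Jt.
rewrite (B_FE g oW CF ij Wt) in B0.
rewrite (cov_sigma Jt ct) (derive_B_F g hr oW CF ij k ct).
have K := derive_kernel_S k Jt ct.
have sym n l : conn g F c n k l (kappa t) = conn g F c k n l (kappa t).
  by rewrite /conn (D2F_sym g hr oW CF n k ct).
rewrite !sym in K.
have lin (G : 'M[R]_3) (a b x y : R) (v1 v2 w1 w2 w3 w4 z : 'rV[R]_3) :
  bil G (a *: v1 + b *: v2 + (x *: (x *: w1 + y *: w2) + y *: (x *: w3 + y *: w4))) z =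
  a * bil G v1 z + b * bil G v2 z + (x * (x * bil G w1 z + y * bil G w2 z) +
    y * (x * bil G w3 z + y * bil G w4 z)) by rewrite !(bilDl, bilZl).
have E := lin (gram g c (coord c (F (kappa t)))) (p' t) (m' t) (p t) (m t)
  (frame F c i (kappa t)) (frame F c j (kappa t)) (D2F g F c i i (kappa t))
  (D2F g F c j i (kappa t)) (D2F g F c i j (kappa t)) (D2F g F c j j (kappa t))
  (frame F c k (kappa t)).
apply: etrans (congr1 (fun x => 2 * s j j (kappa t) * x) E) _.
have alg (a b d a' b' P Sik Sjk iik jik ijk jjk kii kij kji kjj : R) :
  d != 0 -> a * d - b * b = 0 ->
  a' * Sik + b' * Sjk + (P * (P * (iik + kii) + P * (- b / d) * (jik + kji)) +
    P * (- b / d) * (P * (ijk + kij) + P * (- b / d) * (jjk + kjj))) = 0 ->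
  2 * d * (a' * Sik + b' * Sjk + (P * (P * iik + P * (- b / d) * jik) +
    P * (- b / d) * (P * ijk + P * (- b / d) * jjk))) =
  - (P * P) * (2 * kii * d + 2 * kjj * a - 2 * b * (kij + kji)).
  move=> dn /eqP; rewrite subr_eq0 => /eqP ad.
  have -> : a = b * b / d by rewrite -ad mulfK.
  set X := a' * Sik + b' * Sjk => /eqP; rewrite addr_eq0 => /eqP ->.
  by field.
rewrite (S_F_chart g oW CF i k ct) (S_F_chart g oW CF j k ct) in K.
exact: alg d0 B0 K.
Qed.

Lemma acceleration_vector c t w : J t -> in_chart F W c (kappa t) ->
  metric g c (coord c (sigma t)) (cov g c sigma (1 : R^o) (1 : R^o) t) w =
  p' t * frame_w g F c w i (kappa t) + m' t * frame_w g F c w j (kappa t) +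
  (p t * (p t * conn_w g F c w i i (kappa t) + m t * conn_w g F c w j i (kappa t)) +
   m t * (p t * conn_w g F c w i j (kappa t) + m t * conn_w g F c w j j (kappa t))).
Proof.
move=> Jt ct; rewrite (cov_sigma Jt ct).
have lin (G : 'M[R]_3) (a b x y : R) (v1 v2 w1 w2 w3 w4 z : 'rV[R]_3) :
  bil G (a *: v1 + b *: v2 + (x *: (x *: w1 + y *: w2) + y *: (x *: w3 + y *: w4))) z =
  a * bil G v1 z + b * bil G v2 z + (x * (x * bil G w1 z + y * bil G w2 z) +
    y * (x * bil G w3 z + y * bil G w4 z)) by rewrite !(bilDl, bilZl).
exact: lin.
Qed.

Lemma sigma_Ck : Ck (V := R^o) 2 J kappa -> Ck_map (V := R^o) 2 J sigma.
Proof.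
move=> Ck2; split=> [t Jt|c].
  apply: (@continuous_comp R^o _ _ kappa F); first exact: kcont.
  exact: CF.1 _ (kW Jt).
have oJc : open (J `&` sigma @^-1` dom c).
  rewrite openE => t [Jt ct].
  have := near_chart Jt (conj (kW Jt) ct : in_chart F W c (kappa t)).
  by apply: filterS => t1 [Jt1 [_ ct1]].
have sub : J `&` sigma @^-1` dom c `<=` J by move=> t [].
have inW t : (J `&` sigma @^-1` dom c) t -> in_chart F W c (kappa t).
  by move=> [Jt ct]; split => //; exact: kW.
exact: (@Ck_comp_mx R R^o 2 1 3 2 _ _ kappa (coord c \o F) oJc
  (@in_chart_open _ _ _ _ oW CF c) inW (Ck_restrict sub Ck2)
  (Ck_le (isT : (2 <= 4)%N) (coordF_Ck CF c))).
Qed.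

Lemma acceleration_cov t : acceleration g sigma t =
  cov g (chart_at (sigma t)) sigma (1 : R^o) (1 : R^o) t.
Proof.
rewrite /acceleration /cov /velocity /local_curve.
have E (f : R -> 'rV[R]_3) : derive1 f = 'D_(1 : R^o) f by apply/funext => x; exact: derive1E.
by rewrite !E.
Qed.

Lemma velocityE t : velocity sigma t = 'D_1 (coord (chart_at (sigma t)) \o sigma) t.
Proof. exact: derive1E. Qed.

(** The acceleration is a tangent vector, so it may be shown to vanish in any
    chart. *)
Lemma acceleration_change c t : Ck (V := R^o) 2 J kappa ->
  J t -> in_chart F W c (kappa t) ->
  cov g c sigma (1 : R^o) (1 : R^o) t = 0 -> acceleration g sigma t = 0.
Proof.
move=> Ck2 Jt ct c0; rewrite acceleration_cov.
have [csig Csig] := sigma_Ck Ck2.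
pose c' := chart_at (sigma t).
pose A := (J `&` sigma @^-1` dom c) `&` (J `&` sigma @^-1` dom c').
have oJc b : open (J `&` sigma @^-1` dom b).
  rewrite openE => t1 [Jt1 ct1].
  have := near_chart Jt1 (conj (kW Jt1) ct1 : in_chart F W b (kappa t1)).
  by apply: filterS => t2 [Jt2 [_ ct2]].
have oA : open A by apply: openI.
have At : A t by split; split => //; [exact: ct.2|exact: dom_chart_at].
have CA : Ck (V := R^o) 2 A (coord c \o sigma).
  by apply: Ck_restrict (Csig c) => x [].
have := @cov_change R M r g hr R^o A sigma c c' oA (fun u Au => Au.1.2)
  (fun u Au => Au.2.2) CA t 1 1 At.
by rewrite c0 mul0mx.
Qed.

End CurveInSurface.

(** * Linear algebra of a nondegenerate form *)

Section LinearAlgebra.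
Context {R : realType}.

Lemma bil_test3 (G : 'M[R]_3) (v1 v2 v3 z : 'rV[R]_3) : G \in unitmx ->
  det3 v1 v2 v3 != 0 -> bil G z v1 = 0 -> bil G z v2 = 0 -> bil G z v3 = 0 -> z = 0.
Proof.
move=> Gu d0 z1 z2 z3; pose Q : 'M[R]_3 := \matrix_(i < 3) nth 0 [:: v1; v2; v3] i.
have Qu : Q^T \in unitmx by rewrite unitmx_tr unitmxE unitfE.
have : z *m G *m Q^T = 0.
  apply/rowP => k; rewrite [RHS]mxE.
  have -> : (z *m G *m Q^T) 0 k = bil G z (nth 0 [:: v1; v2; v3] k).
    rewrite /bil [LHS]mxE [RHS]mxE; apply: eq_bigr => l _.
    by congr (_ * _); rewrite !mxE.
  by case: k => -[|[|[|//]]].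
move=> zGQ; have : z *m (G *m Q^T) = 0 by rewrite mulmxA.
have u : G *m Q^T \in unitmx by rewrite unitmx_mul Gu.
by move=> z0; rewrite -(mulmxK u z) z0 mul0mx.
Qed.

(** The vector z separates v from a. *)
Lemma row_free_col_mx (G : 'M[R]_3) (v a z : 'rV[R]_3) :
  v != 0 -> bil G v z = 0 -> bil G a z != 0 -> row_free (col_mx v a).
Proof.
move=> v0 vz az; rewrite -kermx_eq0; apply/rowV0P => u /sub_kermxP.
rewrite -[u]hsubmxK mul_row_col => E.
have [x Ex] : exists x, lsubmx u = x%:M by exists (lsubmx u 0 0); exact: mx11_scalar.
have [y Ey] : exists y, rsubmx u = y%:M by exists (rsubmx u 0 0); exact: mx11_scalar.
move: E; rewrite Ex Ey !mul_scalar_mx => E.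
have y0 : y = 0.
  have : bil G (x *: v + y *: a) z = 0 by rewrite E /bil !mul0mx mxE.
  rewrite bilDl !bilZl vz mulr0 add0r => /eqP; rewrite mulf_eq0 (negbTE az) orbF.
  by move/eqP.
move: E; rewrite y0 scale0r addr0 => /eqP; rewrite scaler_eq0 (negbTE v0) orbF => /eqP ->.
have s0 : (0%:M : 'M[R]_1) = 0 by apply/matrixP => a1 b1; rewrite !mxE mul0rn.
by rewrite s0 row_mx0.
Qed.

(** A totally isotropic subspace has at most half the dimension of the space.
    *)
Lemma no_isotropic_plane (G : 'M[R]_3) (E : 'M[R]_(2, 3)) : G \in unitmx ->
  row_free E -> E *m G *m E^T != 0.
Proof.
move=> Gu Ef; apply/eqP => /mulmx0_rank_max.
rewrite mxrankMfree ?row_free_unit// mxrank_tr.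
by move: Ef; rewrite /row_free => /eqP ->.
Qed.

End LinearAlgebra.

(** * Connected sets *)

Section Connectedness.
Context {R : realType} {V : normedModType R}.

(** A convex set is a union of segments with a common end. *)
Lemma convex_connected (A : set V) :
  (forall x y (s : R), A x -> A y -> 0 <= s <= 1 -> A (x + s *: (y - x))) -> connected A.
Proof.
move=> cvA; have [[x Ax]|] := pselect (A !=set0); last first.
  by move=> /set0P/negP/negPn/eqP ->; exact: connected0.
pose seg y : set V := (fun s : R => x + s *: (y - x)) @` `[0, 1]%classic.
have -> : A = \bigcup_(y in A) seg y.
  apply/seteqP; split=> [y Ay|z [y Ay [s s01 <-]]].
    exists y => //; exists 1; first by rewrite /= in_itv/= lexx ler01.
    by rewrite scale1r subrKC.
  by apply: cvA => //; move: s01; rewrite /= in_itv.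
apply: bigcup_connected.
  exists x => y Ay; exists 0; first by rewrite /= in_itv/= lexx ler01.
  by rewrite scale0r addr0.
move=> y Ay; apply: connected_continuous_connected.
  exact/connected_intervalP/interval_is_interval.
apply: continuous_subspaceT => s; apply: cvgD; first exact: cvg_cst.
by apply: cvgZr_tmp; exact: cvg_id.
Qed.

End Connectedness.

(** * The tangent plane at a light-like point *)

Section LightlikePoint.
Context {R : realType} {M : oriented_manifold3 R} {r : smoothness}.
Variable g : lorentz_metric M r.
Hypothesis hr : at_least 4 r.
Variables (F : 'rV[R]_2 -> M) (W : set 'rV[R]_2).
Hypotheses (oW : open W) (CF : Ck_map 4 W F).

Local Notation s k l u := (S_F g F u k l).

(** At a light-like point s_jj gram_w = - omega^2, so that (F_i, F_j, w) is a
    basis if omega is not zero. *)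
Lemma frame_w_test i j c w u z : i != j -> in_chart F W c u -> B_F g F u = 0 ->
  s j j u != 0 -> omega g F i j c w u != 0 ->
  metric g c (coord c (F u)) z (frame F c i u) = 0 ->
  metric g c (coord c (F u)) z (frame F c j u) = 0 ->
  metric g c (coord c (F u)) z w = 0 -> z = 0.
Proof.
move=> ij cu B0 d0 om0 zi zj zw.
have gE := gram_wE g oW CF ij w cu.
have gw : s j j u * gram_w g F i j c w u = - (omega g F i j c w u) ^+ 2.
  have B0' := B0; rewrite (B_FE g oW CF ij cu.1) in B0'.
  rewrite /gram_w /omega B0.
  have alg (a b d x y z0 : R) : a * d - b * b = 0 ->
    d * (0 * z0 - (a * (y * y) - 2 * b * (x * y) + d * (x * x))) = - (d * x - b * y) ^+ 2.
    move=> /eqP; rewrite subr_eq0 => /eqP ad.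
    transitivity (- (a * d) * (y * y) + 2 * b * d * (x * y) - d * d * (x * x)); first by ring.
    by rewrite ad; ring.
  exact: alg B0'.
apply: (bil_test3 (gram_unit g (in_chart_coord cu)) _ zi zj zw).
apply: contraNneq om0 => d3.
have : s j j u * gram_w g F i j c w u = 0 by rewrite -gE d3 mulr0 mulr0.
by rewrite gw => /eqP; rewrite oppr_eq0 sqrf_eq0.
Qed.

(** If both diagonal entries vanished, so would s_ij, as B = 0, and the
    tangent plane would be totally isotropic. *)
Lemma exists_nonisotropic o : W o -> row_free (\matrix_(i < 2) F_ F i o) ->
  B_F g F o = 0 -> exists i j : 'I_2, i != j /\ s j j o != 0.
Proof.
move=> Wo rf B0; have co := in_base_chart F Wo.
have n01 : (0 : 'I_2) != 1 by [].
have n10 : (1 : 'I_2) != 0 by [].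
have [s1|] := boolP (s 1 1 o != 0); first by exists 0, 1.
have [s0|] := boolP (s 0 0 o != 0); first by exists 1, 0.
rewrite !negbK => /eqP s0 /eqP s1.
have B0' := B0; rewrite (B_FE g oW CF n01 Wo) s0 s1 mulr0 sub0r in B0'.
move: B0' => /eqP; rewrite oppr_eq0 mulf_eq0 orbb => /eqP s01.
have := no_isotropic_plane (gram_unit g (in_chart_coord co)) rf.
have -> : (\matrix_(i < 2) F_ F i o) *m gram g (base_chart F o) (coord (base_chart F o) (F o)) *m
   (\matrix_(i < 2) F_ F i o)^T = S_F g F o.
  apply/matrixP => k l; rewrite [RHS]mxE /metric [RHS]mxE [LHS]mxE.
  apply: eq_bigr => m _; rewrite !mxE; congr (_ * _).
  by apply: eq_bigr => n _; rewrite !mxE.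
suff -> : S_F g F o = 0 by rewrite eqxx.
apply/matrixP => k l; rewrite [RHS]mxE.
have s10 : s 1 0 o = 0 by rewrite (S_F_sym g oW CF 1 0 Wo).
have ord2P (n : 'I_2) : n = 0 \/ n = 1.
  by case: n => -[|[|//]] n2; [left|right]; exact/val_inj.
by case: (ord2P k) => ->; case: (ord2P l) => ->.
Qed.

(** The vector s_jj F_i - s_ij F_j is not zero and g is nondegenerate. *)
Lemma exists_transverse i j o : i != j -> W o -> row_free (\matrix_(k < 2) F_ F k o) ->
  s j j o != 0 -> exists w, omega g F i j (base_chart F o) w o != 0.
Proof.
move=> ij Wo rf d0; have co := in_base_chart F Wo.
pose c := base_chart F o; pose G := gram g c (coord c (F o)).
have [//|H] := pselect (exists w, omega g F i j c w o != 0).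
have Z w : bil G (s j j o *: F_ F i o - s i j o *: F_ F j o) w = 0.
  have lin (G0 : 'M[R]_3) (a b : R) v v' z :
      bil G0 (a *: v - b *: v') z = a * bil G0 v z - b * bil G0 v' z.
    by rewrite -scaleNr bilDl !bilZl mulNr.
  apply: etrans (lin G _ _ _ _ w) _.
  have [e|n0] := eqVneq (omega g F i j c w o) 0; first exact: e.
  by exfalso; apply: H; exists w.
have : s j j o *: F_ F i o - s i j o *: F_ F j o = 0.
  apply: (bil_nondeg (gram_unit g (in_chart_coord co))) => z.
  by rewrite Z /bil !mul0mx mxE.
move=> E; exfalso; move/negP: d0; apply.
pose u : 'rV[R]_2 := s j j o *: delta_mx 0 i - s i j o *: delta_mx 0 j.
have uE : u *m (\matrix_(k < 2) F_ F k o) = 0.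
  by rewrite /u mulmxBl -!scalemxAl -!rowE !rowK.
have u0 : u = 0 by apply: (row_free_inj rf); rewrite uE mul0mx.
have ent (a b : R) : (a *: delta_mx 0 i - b *: delta_mx 0 j : 'rV[R]_2) 0 i = a.
  by rewrite !mxE !eqxx (negbTE ij)/= mulr1 mulr0 subr0.
by rewrite -[X in X == 0](ent _ (s i j o)) -/u u0 mxE.
Qed.

End LightlikePoint.

(** * The two sides of a graph *)

Section GraphSides.
Context {R : realType}.
Variables i j : 'I_2.
Hypothesis ij : i != j.
Variables (o : 'rV[R]_2) (d e : R) (gam : R -> R).
Hypotheses (d0 : 0 < d) (e0 : 0 < e).
Hypothesis gam_cont : forall t : R, `|t| < d -> {for t, continuous gam}.
Hypothesis gam_e : forall t : R, `|t| < d -> `|o 0 j - gam t| < e.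

Definition box : set 'rV[R]_2 :=
  [set u | `|o 0 i - u 0 i| < d /\ `|o 0 j - u 0 j| < e].

(** For tau = 1 the part of the box above the graph of gam, for tau = -1 the
    part below. *)
Definition side (tau : R) : set 'rV[R]_2 :=
  [set u | box u /\ 0 < tau * (u 0 j - gam (u 0 i - o 0 i))].

Local Notation vec a b := (a *: delta_mx 0 i + b *: delta_mx 0 j : 'rV[R]_2).

Lemma vecE a b : (vec a b) 0 i = a /\ (vec a b) 0 j = b.
Proof.
by rewrite !mxE !eqxx (negbTE ij) eq_sym (negbTE ij)/= !mulr0 !mulr1 addr0 add0r.
Qed.

Lemma rV2_eq (u v : 'rV[R]_2) : u 0 i = v 0 i -> u 0 j = v 0 j -> u = v.
Proof. by move=> ui uj; apply/rowP => k; case: (ord2_or k ij) => ->. Qed.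

Lemma vec_coord (u : 'rV[R]_2) : u = vec (u 0 i) (u 0 j).
Proof. by have [a b] := vecE (u 0 i) (u 0 j); apply: rV2_eq. Qed.

Lemma coord_cvg (k : 'I_2) (u : 'rV[R]_2) : {for u, continuous (fun v : 'rV[R]_2 => v 0 k : R)}.
Proof. exact: matrix_normedtype.coord_continuous. Qed.

Lemma box_open : open box.
Proof.
have ob k (a : R) : open [set u : 'rV[R]_2 | `|o 0 k - u 0 k| < a].
  have -> : [set u : 'rV[R]_2 | `|o 0 k - u 0 k| < a] =
      (fun v : 'rV[R]_2 => v 0 k) @^-1` ball (o 0 k) a.
    by apply/seteqP; split => u; rewrite -ball_normE.
  by apply: open_comp; [move=> u _; exact: coord_cvg|exact: ball_open].
have -> : box = [set u | `|o 0 i - u 0 i| < d] `&` [set u | `|o 0 j - u 0 j| < e].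
  by [].
by apply: openI; exact: ob.
Qed.

Lemma box_convex (x y : 'rV[R]_2) (s : R) :
  box x -> box y -> 0 <= s <= 1 -> box (x + s *: (y - x)).
Proof.
have seg (k : 'I_2) (a : R) : `|o 0 k - x 0 k| < a -> `|o 0 k - y 0 k| < a ->
    0 <= s <= 1 -> `|o 0 k - (x + s *: (y - x)) 0 k| < a.
  move=> xa ya s01; have := @ball_segment R R^o (o 0 k) (x 0 k) (y 0 k) a s.
  by rewrite -!ball_normE/= !mxE; exact.
by move=> [x1 x2] [y1 y2] s01; split; exact: seg.
Qed.

Lemma box_connected : connected box.
Proof. by apply: convex_connected => x y s; exact: box_convex. Qed.

(** A side is the image of an open rectangle: the second coordinate
    interpolates between the graph and the edge of the box. *)
Lemma side_connected tau : tau = 1 \/ tau = -1 -> connected (side tau).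
Proof.
move=> tau1.
pose P : set 'rV[R]_2 := [set q | -d < q 0 i < d /\ 0 < q 0 j < 1].
(* q_i is the position relative to o, q_j runs from the graph to the edge *)
pose phi (q : 'rV[R]_2) := vec (o 0 i + q 0 i)
  (gam (q 0 i) + q 0 j * (o 0 j + tau * e - gam (q 0 i))).
have Pd q : P q -> `|q 0 i| < d by move=> [+ _]; rewrite ltr_norml.
have -> : side tau = phi @` P.
  apply/seteqP; split=> [u [[ui uj] us]|_ [q Pq <-]].
    have td : `|u 0 i - o 0 i| < d by rewrite distrC.
    have ge := gam_e td; move: ge uj us; rewrite !ltr_norml.
    set t := u 0 i - o 0 i => /andP[g1 g2] /andP[u1 u2] us.
    have den : o 0 j + tau * e - gam t != 0.
      by case: tau1 => ->; apply/eqP; lra.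
    exists (vec t ((u 0 j - gam t) / (o 0 j + tau * e - gam t))).
      have [E1 E2] := vecE t ((u 0 j - gam t) / (o 0 j + tau * e - gam t)).
      split; first by rewrite E1 -ltr_norml.
      rewrite E2; case: tau1 us den => -> us den; apply/andP; split.
      - by rewrite divr_gt0//; lra.
      - by rewrite ltr_pdivrMr; lra.
      - by rewrite -mulrNN -invrN divr_gt0//; lra.
      - by rewrite ltr_ndivrMr; lra.
    rewrite /phi; have [-> ->] := vecE t ((u 0 j - gam t) / (o 0 j + tau * e - gam t)).
    by rewrite divfK// [gam t + _]addrC subrK (addrC (o 0 i)) subrK -vec_coord.
  have qd := Pd _ Pq; have := gam_e qd; have [_ /andP[q1 q2]] := Pq.
  have [E1 E2] := vecE (o 0 i + q 0 i) (gam (q 0 i) + q 0 j * (o 0 j + tau * e - gam (q 0 i))).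
  rewrite ltr_norml => /andP[g1 g2].
  split; first split.
  - by rewrite E1 opprD addrA subrr sub0r normrN.
  - rewrite E2 ltr_norml; case: tau1 => ->; apply/andP; split; nra.
  - rewrite E1 E2 (addrC (o 0 i)) addrK [gam _ + _]addrC addrK.
    by case: tau1 => ->; nra.
apply: connected_continuous_connected.
  have itv (a b x y s : R) : a < x < b -> a < y < b -> 0 <= s <= 1 ->
      a < x + s * (y - x) < b.
    move=> /andP[x1 x2] /andP[y1 y2] /andP[s0 s1].
    have [xy|yx] := leP x y.
      have h1 : 0 <= s * (y - x) by rewrite mulr_ge0// subr_ge0.
      have h2 : 0 <= (1 - s) * (y - x) by rewrite mulr_ge0// subr_ge0.
      by apply/andP; split; lra.
    have h1 : 0 <= s * (x - y) by rewrite mulr_ge0// subr_ge0 ltW.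
    have h2 : 0 <= (1 - s) * (x - y) by rewrite mulr_ge0// subr_ge0// ltW.
    by apply/andP; split; lra.
  apply: convex_connected => x y s [xi xj] [yi yj] s01.
  by split; rewrite !mxE; exact: itv.
apply: continuous_in_subspaceT => q; rewrite inE => Pq; have qd := Pd _ Pq.
have cg : {for q, continuous (fun v : 'rV[R]_2 => gam (v 0 i))}.
  apply: (@continuous_comp _ _ _ (fun v : 'rV[R]_2 => v 0 i) gam); first exact: coord_cvg.
  exact: gam_cont.
have ci := @coord_cvg i q; have cj := @coord_cvg j q.
have co a : {for q, continuous (fun=> a : R^o)} by exact: cst_continuous.
have c1 : {for q, continuous (fun v : 'rV[R]_2 => o 0 i + v 0 i : R^o)}.
  exact: (cvgD (co (o 0 i)) ci).
have c2 : {for q, continuous (fun v : 'rV[R]_2 =>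
    gam (v 0 i) + v 0 j * (o 0 j + tau * e - gam (v 0 i)) : R^o)}.
  exact: (cvgD cg (cvgM cj (cvgB (co (o 0 j + tau * e)) cg))).
have s1 : {for q, continuous (fun v : 'rV[R]_2 => (o 0 i + v 0 i) *: (delta_mx 0 i : 'rV[R]_2))}.
  apply: (cvgZr_tmp (a := delta_mx 0 i) c1).
have s2 : {for q, continuous (fun v : 'rV[R]_2 =>
    (gam (v 0 i) + v 0 j * (o 0 j + tau * e - gam (v 0 i))) *: (delta_mx 0 j : 'rV[R]_2))}.
  apply: (cvgZr_tmp (a := delta_mx 0 j) c2).
exact: (cvgD s1 s2).
Qed.

Lemma graph_closure tau (u : 'rV[R]_2) : tau = 1 \/ tau = -1 ->
  `|u 0 i - o 0 i| < d -> u 0 j = gam (u 0 i - o 0 i) -> closure (side tau) u.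
Proof.
move=> tau1 ud uj N /nbhs_ballP[rho /= rho0 uN].
have ge := gam_e ud; rewrite -uj in ge.
(* a step off the graph that stays in the neighborhood and in the box *)
pose x := Num.min (rho / 2) ((e - `|o 0 j - u 0 j|) / 2).
have x0 : 0 < x by rewrite lt_min !divr_gt0// subr_gt0.
have x1 : x <= rho / 2 by rewrite ge_min lexx.
have x2 : x <= (e - `|o 0 j - u 0 j|) / 2 by rewrite ge_min lexx orbT.
pose v : 'rV[R]_2 := u + (tau * x) *: delta_mx 0 j.
have vi : v 0 i = u 0 i by rewrite !mxE (negbTE ij) andbF mulr0 addr0.
have vj : v 0 j = u 0 j + tau * x by rewrite !mxE !eqxx mulr1.
have ntau : `|tau * x| = x.
  by case: tau1 => ->; rewrite normrM ?normrN1 ?normr1 mul1r gtr0_norm.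
exists v; split.
  split; last by rewrite vi vj -uj [u 0 j + _]addrC addrK mulrA;
    case: tau1 => ->; rewrite ?mulrNN !mul1r.
  rewrite /box/= vi vj distrC; split => //.
  rewrite opprD addrA (le_lt_trans (ler_normB _ _))// ntau.
  move: ge x2 x0; move: (`|_|) => y; lra.
apply: uN; rewrite -ball_normE /= /v opprD addrA subrr sub0r normrN normrZ ntau.
have n1 : `|delta_mx 0 j : 'rV[R]_2| <= 1.
  by apply: rV_norm_le => // k; rewrite mxE; case: (_ && _); rewrite ?normr1 ?normr0.
have : x * `|delta_mx 0 j : 'rV[R]_2| <= x * 1 by rewrite ler_wpM2l// ltW.
rewrite mulr1 => /le_lt_trans; apply; apply: (le_lt_trans x1).
by rewrite ltr_pdivrMr// ltr_pMr// ltr1n.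
Qed.

End GraphSides.

(** * A neighborhood of a light-like point *)

Lemma continuous_near_bounded {R : realType} {V : normedModType R} (f : V -> R^o) x :
  {for x, continuous f} -> \forall y \near x, `|f y| <= `|f x| + 1.
Proof.
move=> /cvgrPdist_le/(_ 1 ltr01); apply: filterS => y.
have := lerB_dist (f y) (f x); rewrite distrC.
by move: `|f y| `|f x| `|f x - f y| => a b n; lra.
Qed.

Lemma continuous_near_sign {R : realType} {V : normedModType R} (f : V -> R^o) x :
  {for x, continuous f} -> f x != 0 -> \forall y \near x, 0 < f x * f y.
Proof.
move=> cf fx; have D00 : 0 < `|f x| by rewrite normr_gt0.
have /cvgrPdist_lt/(_ _ D00) := cf; apply: filterS => y.
move: (f x) (f y) fx => a b; have [a0|a0|] := ltrgtP a 0; last by [].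
- rewrite (ltr0_norm a0) => _; rewrite ltr_norml => /andP[h1 h2]; rewrite nmulr_rgt0 ?a0//; lra.
- rewrite (gtr0_norm a0) => _; rewrite ltr_norml => /andP[h1 h2]; rewrite pmulr_rgt0 ?a0//; lra.
Qed.

Section LocalPicture.
Context {R : realType} {M : oriented_manifold3 R} {r : smoothness}.
Variable g : lorentz_metric M r.
Hypothesis hr : at_least 4 r.
Variables (F : 'rV[R]_2 -> M) (W : set 'rV[R]_2) (o : 'rV[R]_2) (phi : 'rV[R]_2 -> R^o).
Hypotheses (oW : open W) (Wo : W o) (CF : Ck_map 4 W F).
Hypothesis rf : forall u, W u -> row_free (\matrix_(i < 2) F_ F i u).
Hypotheses (Bo : B_F g F o = 0) (Cphi : Ck 2 W phi).
Hypothesis AF : forall u, W u -> A_F g F u = phi u * B_F g F u.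

Let c := base_chart F o.
Local Notation s k l u := (S_F g F u k l).
Local Notation DB k := ('D_(basis_vec k) (B_F g F : _ -> R^o)).
Local Notation Dslope i j k := ('D_(basis_vec k) (slope g F i j)).

(** One ball on which all the conditions at o persist; being a ball in the sup
    norm, it is a box in the coordinates. *)
Lemma local_picture (U : set 'rV[R]_2) : open U -> U o ->
  exists (i j : 'I_2) (w : 'rV[R]_3) (e K C : R),
  [/\ i != j, 0 < e, 0 <= K, 0 <= C &
    [/\ forall u, ball o e u -> [/\ U u, in_chart F W c u, s j j u != 0 & omega g F i j c w u != 0],
        forall u, ball o e u -> `|null_derivative g F i j u| <= K * `|B_F g F u|,
        forall u, ball o e u -> `|Dslope i j j u| <= C,
        DB j o != 0 -> forall u, ball o e u -> 0 < DB j o * DB j u &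
        Ck 2 (ball o e) (slope g F i j)]].
Proof.
move=> oU Uo; have [i [j [ij d0]]] := exists_nonisotropic oW CF Wo (rf Wo) Bo.
have [w om0] := exists_transverse ij Wo (rf Wo) d0.
have co : in_chart F W c o := in_base_chart F Wo.
have oA : open (in_chart F W c) := @in_chart_open _ _ _ _ oW CF c.
have Cs k l := S_F_Ck g hr oW CF c k l.
have [K K0 nK] := key_inequality hr oW CF ij co
  (Ck_le (leq0n 2) (Ck_restrict (fun u (cu : in_chart F W c u) => cu.1) Cphi)) AF d0 om0.
have nA : \forall u \near o, in_chart F W c u by exact: near_open oA co (fun y h => h).
have nU : \forall u \near o, U u by exact: near_open oU Uo (fun y h => h).
have ns : \forall u \near o, s j j u != 0.
  exact: (cvgr_neq0 _ (Ck_continuous (Cs j j) co) d0).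
have Com : Ck 3 (in_chart F W c) (omega g F i j c w : _ -> R^o).
  exact: (Ck_sub oA (Ck_mul oA (Cs j j) (frame_w_Ck g hr oW CF c w i))
    (Ck_mul oA (Cs i j) (frame_w_Ck g hr oW CF c w j))).
have nom : \forall u \near o, omega g F i j c w u != 0.
  exact: (cvgr_neq0 _ (Ck_continuous Com co) om0).
have [e1 /= e10 e1P] := (nbhs_ballP _ _).1 (filterI nA ns).
have oB1 : open (ball o e1) by exact: ball_open.
have Csl : Ck 3 (ball o e1) (slope g F i j).
  have CsB k l : Ck 3 (ball o e1) (fun u => s k l u : R^o).
    by apply: Ck_restrict (Cs k l) => u /e1P[].
  have s0 u : ball o e1 u -> s j j u != 0 by move=> /e1P[].
  exact: (Ck_mul oB1 (Ck_opp oB1 (CsB i j)) (Ck_inv oB1 s0 (CsB j j))).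
have o1 : ball o e1 o by exact: ballxx.
have nsl : \forall u \near o, `|Dslope i j j u| <= `|Dslope i j j o| + 1.
  exact: continuous_near_bounded (Ck_continuous (Ck_derive (basis_vec j) Csl) o1).
have nD : \forall u \near o, DB j o != 0 -> 0 < DB j o * DB j u.
  have [D0|D0] := eqVneq (DB j o) 0; first by apply: filterE.
  have CD := Ck_continuous (Ck_derive (basis_vec j) (B_F_Ck g hr oW CF ij c)) co.
  by apply: filterS (continuous_near_sign CD D0) => u.
have n1 : nbhs o ((U `&` [set u | omega g F i j c w u != 0]) `&`
    ([set u | `|null_derivative g F i j u| <= K * `|B_F g F u|] `&`
    ([set u | `|Dslope i j j u| <= `|Dslope i j j o| + 1] `&`
     [set u | DB j o != 0 -> 0 < DB j o * DB j u]))).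
  exact: (filterI (filterI nU nom) (filterI nK (filterI nsl nD))).
have [e2 /= e20 e2P] := (nbhs_ballP _ _).1 n1.
exists i, j, w, (Num.min e1 e2), K, (`|Dslope i j j o| + 1).
have m1 u : ball o (Num.min e1 e2) u -> ball o e1 u.
  by apply: le_ball; rewrite ge_min lexx.
have m2 u : ball o (Num.min e1 e2) u -> ball o e2 u.
  by apply: le_ball; rewrite ge_min lexx orbT.
have Csl2 : Ck 2 (ball o (Num.min e1 e2)) (slope g F i j).
  exact: (Ck_le (isT : (2 <= 3)%N) (Ck_restrict m1 Csl)).
split; [exact: ij|by rewrite lt_min e10|exact: K0|by rewrite addr_ge0|split].
- by move=> u ub; have [cu su] := e1P _ (m1 _ ub); have [[Uu ou] _] := e2P _ (m2 _ ub).
- by move=> u /m2/e2P[_ []].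
- by move=> u /m2/e2P[_ [_ []]].
- by move=> D0 u /m2/e2P[_ [_ [_]]]; exact.
- exact: Csl2.
Qed.

Section Integration.
Variables (i j : 'I_2) (w : 'rV[R]_3) (e K C : R).
Hypotheses (ij : i != j) (e0 : 0 < e) (K0 : 0 <= K) (C0 : 0 <= C).
Hypothesis pic : forall u, ball o e u ->
  [/\ in_chart F W c u, s j j u != 0 & omega g F i j c w u != 0].
Hypothesis picK : forall u, ball o e u -> `|null_derivative g F i j u| <= K * `|B_F g F u|.
Hypothesis picC : forall u, ball o e u -> `|Dslope i j j u| <= C.
Hypothesis picS : Ck 2 (ball o e) (slope g F i j).

Let V := ball o e.
Let oV : open V. Proof. exact: ball_open. Qed.
Let Vo : V o. Proof. exact: ballxx. Qed.

Let VB : Ck 2 V (B_F g F : _ -> R^o).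
Proof.
have sub : V `<=` in_chart F W c by move=> u /pic[].
exact: Ck_le (Ck_restrict sub (B_F_Ck g hr oW CF ij c)).
Qed.

(** [null_curve_ode] for B_F and the slope of the null direction. *)
Lemma null_curve_in_picture (rr : 'rV[R]_2 -> R^o) : Ck 1 V rr ->
  exists d (kappa : R -> 'rV[R]_2) (p : R -> R),
  [/\ 0 < d, kappa 0 = o, p 0 = 1,
    (forall t : R, `|t| < d -> [/\ V (kappa t), 0 < p t,
      is_derive t 1 kappa (p t *: (delta_mx 0 i + slope g F i j (kappa t) *: delta_mx 0 j)),
      is_derive t 1 p (- (p t * p t * rr (kappa t))) & B_F g F (kappa t) = 0]) &
    (DB j o = 0 -> forall t : R, `|t| < d -> DB j (kappa t) = 0) /\
    Ck (V := R^o) 2 [set t : R | `|t| < d] kappa].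
Proof.
move=> Crr.
exact: (@null_curve_ode R i j ij V (slope g F i j) rr (B_F g F) o K C oV Vo
  (Ck_le (isT : (1 <= 2)%N) picS) Crr VB Bo K0 C0 picK picC).
Qed.

(** With X = d_i + slope d_j, this is g(D_X dF(X), w) / g(dF(X), w). For a
    curve of velocity p X the acceleration is p' dF(X) + p^2 D_X dF(X); its
    product with w vanishes if p' = - p^2 affine_rate. *)
Definition affine_rate (u : 'rV[R]_2) : R^o :=
  ((Dslope i j i u + slope g F i j u * Dslope i j j u) * frame_w g F c w j u +
   (conn_w g F c w i i u + slope g F i j u * (conn_w g F c w j i u + conn_w g F c w i j u) +
    slope g F i j u * slope g F i j u * conn_w g F c w j j u)) *
  (frame_w g F c w i u + slope g F i j u * frame_w g F c w j u)^-1.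

Lemma affine_denominator u : V u -> frame_w g F c w i u + slope g F i j u * frame_w g F c w j u != 0.
Proof.
move=> /pic[_ d0]; apply: contraNneq; rewrite /omega /slope => E.
have alg (b d x y : R) : d != 0 -> x + - b / d * y = 0 -> d * x - b * y = 0.
  by move=> dn /eqP; rewrite addr_eq0 => /eqP ->; field.
by apply/eqP; exact: alg d0 E.
Qed.

Lemma affine_rate_Ck : Ck 1 V affine_rate.
Proof.
have sub : V `<=` in_chart F W c by move=> u /pic[].
have Cq k l := Ck_restrict sub (conn_w_Ck g hr oW CF c w k l).
have Cw k : Ck 1 V (frame_w g F c w k : _ -> R^o).
  exact: Ck_le (Ck_restrict sub (frame_w_Ck g hr oW CF c w k)).
have Cs : Ck 1 V (slope g F i j) by exact: Ck_le picS.
have Cd k : Ck 1 V (Dslope i j k) by exact: (Ck_derive (basis_vec k) picS).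
have t1 := Ck_mul oV (Ck_add oV (Cd i) (Ck_mul oV Cs (Cd j))) (Cw j).
have t2 := Ck_mul oV Cs (Ck_add oV (Cq j i) (Cq i j)).
have t3 := Ck_mul oV (Ck_mul oV Cs Cs) (Cq j j).
have t4 := Ck_add oV t1 (Ck_add oV (Ck_add oV (Cq i i) t2) t3).
have t5 := Ck_inv oV affine_denominator (Ck_add oV (Cw i) (Ck_mul oV Cs (Cw j))).
have t6 := Ck_mul oV t4 t5.
by apply: Ck_ext oV _ t6 => u _.
Qed.

Variables (d : R) (kappa : R -> 'rV[R]_2) (p p' : R -> R).
Let J := [set t : R | `|t| < d].
Hypothesis kV : forall t, J t -> V (kappa t).
Hypothesis kp : forall t, J t -> 0 < p t.
Hypothesis dk : forall t : R, J t ->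
  is_derive t 1 kappa (p t *: (delta_mx 0 i + slope g F i j (kappa t) *: delta_mx 0 j)).
Hypothesis dp : forall t : R, J t -> is_derive t 1 p (p' t).
Hypothesis kB : forall t, J t -> B_F g F (kappa t) = 0.
Hypothesis kC : Ck (V := R^o) 2 J kappa.

Let m t := p t * slope g F i j (kappa t).
Let m' t := p' t * slope g F i j (kappa t) +
  p t * (p t * Dslope i j i (kappa t) + m t * Dslope i j j (kappa t)).

Let kW t : J t -> W (kappa t). Proof. by move=> /kV/pic[[]]. Qed.
Let kd t : J t -> s j j (kappa t) != 0. Proof. by move=> /kV/pic[]. Qed.

Let oJ : open J.
Proof.
rewrite (_ : J = ball (0 : R) d); first exact: ball_open.
by apply/seteqP; split=> t; rewrite -ball_normE /= sub0r normrN.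
Qed.

Let dm (t : R) : J t -> is_derive t 1 m (m' t).
Proof.
move=> Jt; have ds := Ck_differentiable picS (kV Jt).
have D := is_deriveM (dp Jt) (derive_kappa dk Jt ds).
have alg (P P' S X Y Q : R) : P *: ((P *: (X : R^o) + Q *: (Y : R^o)) : R^o) + S *: (P' : R^o) =
  P' * S + P * (P * X + Q * Y) by rewrite /GRing.scale/=; ring.
exact: (is_derive_eq D (alg _ _ _ _ _ _)).
Qed.

Let in_own_chart t : J t -> in_chart F W (chart_at (F (kappa t))) (kappa t).
Proof. by move=> Jt; exact: in_base_chart (kW Jt). Qed.

Lemma velocity_neq0 t : J t -> velocity (F \o kappa) t != 0.
Proof.
move=> Jt; have ct := in_own_chart Jt.
rewrite velocityE; have [_ ->] := derive_sigma CF dk Jt ct.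
apply/eqP => E; have p0 := kp Jt.
pose u : 'rV[R]_2 := p t *: delta_mx 0 i + m t *: delta_mx 0 j.
have uE : u *m (\matrix_(k < 2) F_ F k (kappa t)) = 0.
  by rewrite /u mulmxDl -!scalemxAl -!rowE !rowK.
have u0 : u = 0 by apply: (row_free_inj (rf (kW Jt))); rewrite uE mul0mx.
have [ui _] := vecE ij (p t) (m t).
by move: p0; rewrite -ui -/u u0 mxE ltxx.
Qed.

Lemma curve_regular : regular_curve (F \o kappa) J.
Proof.
split; first exact: (sigma_Ck oW CF oJ kW dk kC).
exact: velocity_neq0.
Qed.

Lemma curve_null : null_curve g (F \o kappa) J.
Proof.
move=> t Jt; rewrite velocityE.
exact: (velocity_null oW CF ij kW kd kB dk Jt (in_own_chart Jt)).
Qed.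

(** F_j is orthogonal to the velocity but, as d_j B does not vanish, not to
    the acceleration. *)
Lemma curve_acceleration_independent t : J t -> DB j (kappa t) != 0 ->
  row_free (col_mx (velocity (F \o kappa) t) (acceleration g (F \o kappa) t)).
Proof.
move=> Jt D0; have ct := in_own_chart Jt.
apply: (row_free_col_mx (velocity_neq0 Jt)
  (G := gram g (chart_at (F (kappa t))) (coord (chart_at (F (kappa t))) (F (kappa t))))
  (z := frame F (chart_at (F (kappa t))) j (kappa t))).
  rewrite velocityE.
  exact: (velocity_frame oW CF ij kW kd kB dk j Jt ct).
rewrite acceleration_cov.
have A := acceleration_frame hr oW CF ij oJ kW kd kB dk dp dm j Jt ct.
apply: contraNneq D0 => Z; move: A; rewrite /metric.
have p0 := kp Jt; have pp : - (p t * p t) != 0 by rewrite oppr_eq0 mulf_neq0// gt_eqF.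
move=> A; have : - (p t * p t) * DB j (kappa t) = 0.
  by rewrite -A; apply: etrans (congr1 (fun x => _ * x) Z) (mulr0 _).
by move/eqP; rewrite mulf_eq0 (negbTE pp).
Qed.

(** dB = 0 along the curve, so the acceleration is orthogonal to F_i and F_j;
    it is orthogonal to w by the choice of p. *)
Lemma curve_geodesic : (forall t, J t -> DB j (kappa t) = 0) ->
  (forall t, J t -> p' t = - (p t * p t * affine_rate (kappa t))) ->
  geodesic g (F \o kappa) J.
Proof.
move=> Dj pE; split; first exact: (sigma_Ck oW CF oJ kW dk kC).
move=> t Jt; have [ct d0 om0] := pic (kV Jt).
apply: (acceleration_change hr oW CF oJ kW dk kC Jt ct).
have Di : DB i (kappa t) = 0.
  have := picK (kV Jt); rewrite (kB Jt) normr0 mulr0 normr_le0 /null_derivative (Dj t Jt) mulr0 addr0.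
  by move/eqP.
have A k : DB k (kappa t) = 0 -> metric g c (coord c (F (kappa t)))
    (cov g c (F \o kappa) (1 : R^o) (1 : R^o) t) (frame F c k (kappa t)) = 0.
  move=> Dk; have := acceleration_frame hr oW CF ij oJ kW kd kB dk dp dm k Jt ct.
  rewrite Dk mulr0 => /eqP; rewrite mulf_eq0 => /orP[|/eqP//].
  by rewrite mulf_eq0 (negbTE d0) orbF pnatr_eq0.
apply: (frame_w_test oW CF ij ct (kB Jt) d0 om0 (A i Di) (A j (Dj t Jt))).
apply: etrans (acceleration_vector oW CF oJ dk dp dm w Jt ct) _.
have dn := affine_denominator (kV Jt).
rewrite /m' /m (pE t Jt) /affine_rate.
have alg (P x y sg Di' Dj' ii ji ij' jj : R) : x + sg * y != 0 ->
  let rr := ((Di' + sg * Dj') * y + (ii + sg * (ji + ij') + sg * sg * jj)) * (x + sg * y)^-1 in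
  - (P * P * rr) * x + (- (P * P * rr) * sg + P * (P * Di' + P * sg * Dj')) * y +
  (P * (P * ii + P * sg * ji) + P * sg * (P * ij' + P * sg * jj)) = 0.
  by move=> n /=; field.
exact: alg dn.
Qed.

End Integration.

End LocalPicture.

(** * The two cases *)

Lemma open_interval_ball {R : realType} (d : R) : 0 < d ->
  open_interval [set t : R | `|t| < d].
Proof.
move=> d0; split.
- rewrite (_ : [set _ | _] = ball (0 : R) d); first exact: ball_open.
  by apply/seteqP; split=> t; rewrite -ball_normE /= sub0r normrN.
- move=> x y /=; rewrite !ltr_norml => /andP[x1 x2] /andP[y1 y2] z /andP[xz zy].
  by rewrite ltr_norml (lt_le_trans x1 xz) (le_lt_trans zy y2).
- by exists 0; rewrite /= normr0.
Qed.

Lemma is_derive0_cst {R : realType} (f : R -> R) (d : R) :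
  (forall t : R, `|t| < d -> is_derive t 1 f 0) -> forall t, `|t| < d -> f t = f 0.
Proof.
move=> df t td.
have bt x : Num.min 0 t <= x <= Num.max 0 t -> `|x| < d.
  move: td; rewrite !ltr_norml => /andP[t1 t2] /andP[].
  rewrite ge_min le_max => /orP[] h1 /orP[] h2; apply/andP; split; lra.
have := @mvt_bound R f (fun=> 0) 0 0 t (fun x h => df x (bt x h)).
rewrite mul0r normr0 => /(_ (fun _ _ => lexx _)).
by rewrite normr_le0 subr_eq0 => /eqP.
Qed.

Section Conclusion.
Context {R : realType} {M : oriented_manifold3 R} {r : smoothness}.
Variable g : lorentz_metric M r.
Hypothesis hr : at_least 4 r.
Variables (F : 'rV[R]_2 -> M) (W : set 'rV[R]_2) (o : 'rV[R]_2).
Hypotheses (oW : open W) (Wo : W o) (CF : Ck_map 4 W F).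
Hypothesis rf : forall u, W u -> row_free (\matrix_(i < 2) F_ F i u).
Hypothesis Bo : B_F g F o = 0.

Let c := base_chart F o.
Local Notation s k l u := (S_F g F u k l).
Local Notation DB k := ('D_(basis_vec k) (B_F g F : _ -> R^o)).
Local Notation Dslope i j k := ('D_(basis_vec k) (slope g F i j)).

Variables (i j : 'I_2) (w : 'rV[R]_3) (e K C : R).
Hypotheses (ij : i != j) (e0 : 0 < e) (K0 : 0 <= K) (C0 : 0 <= C).
Hypothesis pic : forall u, ball o e u ->
  [/\ in_chart F W c u, s j j u != 0 & omega g F i j c w u != 0].
Hypothesis picK : forall u, ball o e u -> `|null_derivative g F i j u| <= K * `|B_F g F u|.
Hypothesis picC : forall u, ball o e u -> `|Dslope i j j u| <= C.
Hypothesis picS : Ck 2 (ball o e) (slope g F i j).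

Let oo : ball o e o. Proof. exact: ballxx. Qed.

Let dB u : ball o e u -> differentiable (B_F g F : _ -> R^o) u.
Proof. by move=> /pic[cu _ _]; exact: (Ck_differentiable (B_F_Ck g hr oW CF ij c)). Qed.

Lemma degenerate_case : DB j o = 0 ->
  degenerate_lightlike g F o /\
  exists S : set M, lightlike_geodesic_segment g (F o) S /\
    S `<=` F @` (ball o e `&` lightlike g F).
Proof.
move=> D0.
have Di : DB i o = 0.
  have := picK oo; rewrite Bo normr0 mulr0 normr_le0 /null_derivative D0 mulr0 addr0.
  by move/eqP.
split.
  split; first exact: Bo.
  move=> v; have E := derive_dir v (dB oo).
  rewrite (sum_ord2 _ ij) Di D0 !scaler0 addr0 in E.
  by rewrite -[RHS]E; exact: esym (deriveE v (dB oo)).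
have [d [kappa [p [d0 k0 p0 kP [kD kC]]]]] :=
  null_curve_in_picture hr oW CF Bo ij e0 K0 C0 pic picK picC picS
    (affine_rate_Ck hr oW CF pic picS).
pose J := [set t : R | `|t| < d].
have kV t : J t -> ball o e (kappa t) by move=> /kP[].
have kp t : J t -> 0 < p t by move=> /kP[].
have dk (t : R) : J t -> is_derive t 1 kappa
    (p t *: (delta_mx 0 i + slope g F i j (kappa t) *: delta_mx 0 j)) by move=> /kP[].
have dp (t : R) : J t -> is_derive t 1 p (- (p t * p t * affine_rate g F o i j w (kappa t))).
  by move=> /kP[].
have kB t : J t -> B_F g F (kappa t) = 0 by move=> /kP[].
exists ((F \o kappa) @` J); split; last first.
  move=> x [t Jt <-]; exists (kappa t); last by [].
  exact: conj (kV t Jt) (kB t Jt).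
exists J, (F \o kappa); split.
  by split; [exact: open_interval_ball|rewrite /J/= normr0|rewrite /= k0].
split => //.
- exact: (curve_geodesic hr oW CF ij pic picK picS kV dk dp kB kC (kD D0)
    (fun t _ => erefl)).
- move=> t Jt; exact: (curve_null oW CF ij pic kV dk kB Jt).
- move=> t Jt; exact: (velocity_neq0 CF rf ij pic kV kp dk Jt).
Qed.

Hypothesis picD : DB j o != 0 -> forall u, ball o e u -> 0 < DB j o * DB j u.

Lemma box_ball d u : d <= e -> box i j o d e u -> ball o e u.
Proof.
move=> de [ui uj]; rewrite -ball_normE /=.
pose m := Num.max `|o 0 i - u 0 i| `|o 0 j - u 0 j|.
have me : m < e by rewrite gt_max uj (lt_le_trans ui de).
apply: le_lt_trans me; apply: rV_norm_le => [|k].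
  by rewrite le_max normr_ge0.
by rewrite !mxE le_max; case: (ord2_or k ij) => ->; rewrite lexx ?orbT.
Qed.

Lemma ball_coord u k : ball o e u -> `|o 0 k - u 0 k| < e.
Proof.
rewrite -ball_normE /=; apply: le_lt_trans.
by have := rV_coord_le (o - u) k; rewrite !mxE.
Qed.

(** By the mean value theorem, as d_j B keeps the sign that it has at o. *)
Lemma B_monotone v (x : R) : DB j o != 0 -> 0 < x -> ball o e v ->
  ball o e (v + x *: delta_mx 0 j) ->
  0 < DB j o * (B_F g F (v + x *: delta_mx 0 j) - B_F g F v).
Proof.
move=> D0 x0 vV vxV.
have seg (y : R) : 0 <= y <= x -> ball o e (v + y *: delta_mx 0 j).
  move=> /andP[y0 yx].
  have yx1 : 0 <= y / x <= 1 by rewrite divr_ge0 ?ler_pdivrMr ?mul1r// ltW.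
  have := ball_segment vV vxV yx1.
  by rewrite [v + _ - v]addrC addKr scalerA divfK// gt_eqF.
have dg (y : R) : 0 <= y <= x -> is_derive y 1
    (fun y : R => (B_F g F : _ -> R^o) (v + y *: delta_mx 0 j))
    (DB j (v + y *: delta_mx 0 j)).
  by move=> yx; apply: is_derive_line; exact: dB (seg y yx).
have [y /andP[y0 yx]] := mvt_exists x0 dg.
rewrite scale0r addr0 subr0 => ->.
have yV : ball o e (v + y *: delta_mx 0 j) by apply: seg; rewrite !ltW.
by rewrite mulrA mulr_gt0//; exact: picD.
Qed.

(** For a curve of velocity X itself the coordinate u_i is the parameter up to
    a constant, so the curve is a graph over u_i. In the box around it,
    monotonicity in the direction j gives the sign of B on both sides. *)
Lemma nondegenerate_case : DB j o != 0 ->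
  exists V : set 'rV[R]_2,
    [/\ open V, connected V, V o & V `<=` ball o e] /\
    (nondegenerate_lightlike g F o /\
      exists (J : set R) (sigma : R -> M),
        [/\ open_interval J,
            regular_curve sigma J,
            null_curve g sigma J,
            sigma @` J = F @` (V `&` lightlike g F) &
            forall t, J t ->
              row_free (col_mx (velocity sigma t) (acceleration g sigma t))] /\
        changes_causal_type g F V).
Proof.
move=> D0.
(* with rr = 0 the factor p is constant, equal to 1 *)
have C00 : Ck 1 (ball o e) (fun=> 0 : R^o) by exact: Ck_cst.
have [d1 [kappa [p [d10 k0 p0 kP [_ kC1]]]]] :=
  null_curve_in_picture hr oW CF Bo ij e0 K0 C0 pic picK picC picS C00.
pose d := Num.min d1 e.
have d0 : 0 < d by rewrite lt_min d10.
have dd1 (t : R) : `|t| < d -> `|t| < d1 by rewrite lt_min => /andP[].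
have de : d <= e by rewrite ge_min lexx orbT.
pose J := [set t : R | `|t| < d].
have kV t : J t -> ball o e (kappa t) by move=> /dd1/kP[].
have kp t : J t -> 0 < p t by move=> /dd1/kP[].
have dk (t : R) : J t -> is_derive t 1 kappa
    (p t *: (delta_mx 0 i + slope g F i j (kappa t) *: delta_mx 0 j)) by move=> /dd1/kP[].
have dp (t : R) : J t -> is_derive t 1 p 0.
  by move=> /dd1/kP[_ _ _ + _]; rewrite mulr0 oppr0.
have kB t : J t -> B_F g F (kappa t) = 0 by move=> /dd1/kP[].
have kC : Ck (V := R^o) 2 J kappa by exact: Ck_restrict dd1 kC1.
have p1 t : J t -> p t = 1 by move=> Jt; rewrite (is_derive0_cst dp Jt).
have ki (t : R) : J t -> kappa t 0 i = o 0 i + t.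
  have dki (x : R) : `|x| < d -> is_derive x 1 (fun x : R => kappa x 0 i - x) 0.
    move=> Jx; have := is_derive_coord 0 i (dk x Jx).
    rewrite p1// scale1r -[X in X + _]scale1r.
    have [-> _] := vecE ij 1 (slope g F i j (kappa x)) => D1.
    have D2 := is_deriveB D1 (is_derive_id x (1 : R)).
    by apply: (is_derive_eq D2); rewrite subrr.
  move=> Jt; have := is_derive0_cst dki Jt; rewrite k0 subr0 => <-.
  by rewrite subrK.
pose gam (t : R) := kappa t 0 j.
have gam_cont (t : R) : `|t| < d -> {for t, continuous gam}.
  move=> Jt; apply: derivable_cont.
  by have [] := is_derive_coord 0 j (dk t Jt).
have gam_e (t : R) : `|t| < d -> `|o 0 j - gam t| < e.
  by move=> Jt; exact: ball_coord (kV t Jt).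
pose V := box i j o d e.
have VV : V `<=` ball o e by move=> u; exact: box_ball.
have Vt u : V u -> J (u 0 i - o 0 i) by move=> [ui _]; rewrite /J/= distrC.
(* the height of u above the curve *)
pose h (u : 'rV[R]_2) := u 0 j - gam (u 0 i - o 0 i).
have kap u : V u -> kappa (u 0 i - o 0 i) + h u *: delta_mx 0 j = u.
  move=> Vu; apply: (rV2_eq ij).
    by rewrite !mxE (negbTE ij) andbF mulr0 addr0 ki; [rewrite addrC subrK|exact: Vt].
  by rewrite !mxE !eqxx mulr1 addrC subrK.
have Bpos u : V u -> 0 < h u -> 0 < DB j o * B_F g F u.
  move=> Vu hu; have vu : ball o e (kappa (u 0 i - o 0 i) + h u *: delta_mx 0 j).
    by rewrite kap//; exact: VV.
  have := B_monotone D0 hu (kV _ (Vt u Vu)) vu.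
  by rewrite kap// (kB _ (Vt u Vu)) subr0.
have Bneg u : V u -> h u < 0 -> DB j o * B_F g F u < 0.
  move=> Vu hu; have hu' : 0 < - h u by rewrite oppr_gt0.
  have E : u + - h u *: delta_mx 0 j = kappa (u 0 i - o 0 i).
    by rewrite -[X in X + _](kap u Vu) scaleNr addrK.
  have uV : ball o e (u + - h u *: delta_mx 0 j) by rewrite E; exact: kV (Vt u Vu).
  have := B_monotone D0 hu' (VV u Vu) uV.
  by rewrite E (kB _ (Vt u Vu)) sub0r mulrN oppr_gt0.
have Bzero u : V u -> h u = 0 -> u = kappa (u 0 i - o 0 i).
  by move=> Vu hu; have := kap u Vu; rewrite hu scale0r addr0.
have Bzero' u : V u -> B_F g F u = 0 -> h u = 0.
  move=> Vu Bu; have [hu|hu|//] := ltrgtP (h u) 0.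
    by have := Bneg u Vu hu; rewrite Bu mulr0 ltxx.
  by have := Bpos u Vu hu; rewrite Bu mulr0 ltxx.
have kVbox t : J t -> V (kappa t).
  move=> Jt; split; last exact: gam_e.
  by rewrite ki// opprD addrA subrr sub0r normrN.
exists V; split.
  split; [exact: box_open|exact: box_connected| |exact: VV].
  by split; rewrite subrr normr0.
split.
  split; first exact: Bo.
  exists (delta_mx 0 j); have E := deriveE (delta_mx 0 j) (dB oo).
  by apply: contra_neq D0 => D; rewrite E.
exists J, (F \o kappa); split.
  split.
  - exact: open_interval_ball.
  - exact: (curve_regular oW CF rf ij pic kV kp dk kC).
  - move=> t Jt; exact: (curve_null oW CF ij pic kV dk kB Jt).
  - apply/seteqP; split=> [_ [t Jt <-]|_ [u [Vu Lu] <-]].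
      exists (kappa t); last by [].
      exact: conj (kVbox t Jt) (kB t Jt).
    exists (u 0 i - o 0 i); first exact: Vt.
    by rewrite /= -(Bzero u Vu (Bzero' u Vu Lu)).
  - move=> t Jt; apply: (curve_acceleration_independent hr oW CF rf ij pic picS kV kp dk dp kB Jt).
    have := picD D0 (kV t Jt); apply: contraTneq => ->.
    by rewrite mulr0 ltxx.
(* the space-like side lies above the curve if d_j B(o) > 0, below it
   otherwise *)
pose tau : R := if 0 < DB j o then 1 else -1.
have tau1 : tau = 1 \/ tau = -1 by rewrite /tau; case: ifP; [left|right].
have taun : - tau = 1 \/ - tau = -1 by case: tau1 => ->; rewrite ?opprK; [right|left].
have sgn (x : R) : (0 < DB j o * x) = (0 < tau * x).
  rewrite /tau; case: ifPn => [D1|]; first by rewrite pmulr_rgt0// mul1r.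
  rewrite -leNgt le_eqVlt (negbTE D0)/= => D1.
  by rewrite nmulr_rgt0// mulN1r oppr_gt0.
have BhE u : V u -> (0 < tau * B_F g F u) = (0 < h u).
  move=> Vu; rewrite -sgn; have [hu|hu|hu] := ltrgtP (h u) 0.
  - by apply/negbTE; rewrite -leNgt ltW// Bneg.
  - exact: Bpos.
  - by rewrite (Bzero u Vu hu) kB ?mulr0 ?ltxx//; exact: Vt.
have BhN u : V u -> (0 < - (tau * B_F g F u)) = (h u < 0).
  move=> Vu; have Dn : (DB j o * - B_F g F u) = - (DB j o * B_F g F u) by rewrite mulrN.
  rewrite -mulrN -sgn Dn oppr_gt0; have [hu|hu|hu] := ltrgtP (h u) 0.
  - exact: Bneg.
  - by apply/negbTE; rewrite -leNgt ltW// Bpos.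
  - by rewrite (Bzero u Vu hu) kB ?mulr0 ?ltxx//; exact: Vt.
have sg u : V u ->
    (0 < B_F g F u) = (0 < tau * h u) /\ (B_F g F u < 0) = (0 < - tau * h u).
  move=> Vu; move: (BhE u Vu) (BhN u Vu); case: tau1 => ->.
    by rewrite !mul1r mulN1r !oppr_gt0.
  by rewrite !mulN1r !opprK mul1r !oppr_gt0.
have E1 : V `&` spacelike g F = side i j o d e gam tau.
  apply/seteqP; split=> u [Vu hu]; split => //; have [h1 _] := sg u Vu.
    by rewrite -/(h u) -h1.
  by rewrite /spacelike h1.
have E2 : V `&` timelike g F = side i j o d e gam (- tau).
  apply/seteqP; split=> u [Vu hu]; split => //; have [_ h2] := sg u Vu.
    by rewrite -/(h u) -h2.
  by rewrite /timelike h2.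
split.
- by rewrite E1; exact: side_connected.
- by rewrite E2; exact: side_connected.
- move=> u [Vu Lu]; have hu := Bzero' u Vu Lu.
  have uj : u 0 j = gam (u 0 i - o 0 i) by apply/eqP; rewrite -subr_eq0; apply/eqP.
  by rewrite E1 E2; split; apply: graph_closure => //; exact: Vt.
Qed.

End Conclusion.

Theorem corollaryC (R : realType) (M : oriented_manifold3 R) (r : smoothness)
    (g : lorentz_metric M r) (hr : at_least 4 r)
    (U : set 'rV[R]_2) (hUopen : open U) (hUconn : connected U)
    (o : 'rV[R]_2) (ho : U o) (ohat : M)
    (F : 'rV[R]_2 -> M) (k : nat) (hk : (2 <= k)%N) (hF : immersion F k U)
    (hFo : F o = ohat) (hX : X4_0 g F o ohat) :
  exists V : set 'rV[R]_2,
    [/\ open V, connected V, V o & V `<=` U] /\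
    ((nondegenerate_lightlike g F o /\
      exists (J : set R) (sigma : R -> M),
        [/\ open_interval J,
            regular_curve sigma J,
            null_curve g sigma J,
            sigma @` J = F @` (V `&` lightlike g F) &
            forall t, J t ->
              row_free (col_mx (velocity sigma t) (acceleration g sigma t))] /\
        changes_causal_type g F V)
     \/
     (degenerate_lightlike g F o /\
      exists S : set M,
        lightlike_geodesic_segment g ohat S /\
        S `<=` F @` (V `&` lightlike g F))).
Proof.
have [W [[oW Wo [CF rf] _ Bo] [phi [Cphi AF]]]] := hX.
have [i [j [w [e [K [C [ij e0 K0 C0 [picU picK picC picD picS]]]]]]]] :=
  local_picture hr oW Wo CF rf Bo Cphi AF hUopen ho.
have pic u : ball o e u -> [/\ in_chart F W (base_chart F o) u, S_F g F u j j != 0 &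
    omega g F i j (base_chart F o) w u != 0] by move=> /picU[].
have sub : ball o e `<=` U by move=> u /picU[].
have [D0|D0] := eqVneq ('D_(basis_vec j) (B_F g F : _ -> R^o) o) 0.
  exists (ball o e); split.
    split => //; [exact: ball_open| |exact: ballxx].
    by apply: convex_connected => x y s; exact: ball_segment.
  right; rewrite -hFo.
  exact: (degenerate_case hr oW CF rf Bo ij e0 K0 C0 pic picK picC picS D0).
have [V [[oV cV Vo Vb] H]] :=
  nondegenerate_case hr oW CF rf Bo ij e0 K0 C0 pic picK picC picS picD D0.
by exists V; split; [split => //; exact: subset_trans Vb sub|left].
Qed.
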